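(* Let $F=\sqrt{\alpha(\alpha+\beta)}$ be a two-dimensional square-root metric which is Einsteinian (equivalently, of isotropic flag curvature). Then $\alpha$ and $\beta$ can be locally determined by $$\alpha=\frac{\sqrt{B}}{(1-B)^{\frac34}}\sqrt{\frac{(y^1)^2+(y^2)^2}{u^2+v^2}},\qquad \beta=\frac{B}{(1-B)^{\frac34}}\,\frac{uy^1+vy^2}{u^2+v^2},$$ where $0<B=B(x)<1$, $u=u(x)$, $v=v(x)$ are some scalar functions which satisfy the following PDEs: $$u_1=v_2,\qquad u_2=-v_1,\qquad uB_1+vB_2=0,$$ where $u_i:=u_{x^i}$, $v_i:=v_{x^i}$ and $B_i:=B_{x^i}$. Further, the isotropic flag curvature $\mathbf K$ is given by $$\mathbf K=-\frac{(u^2+v^2)\sqrt{1-B}}{2B^2}(B_{11}+B_{22})-\frac{(u^2+v^2)^2(3B-2)}{4B^3\sqrt{1-B}}\Big(\frac{B_1}{v}\Big)^2,$$ where $B_{ij}:=B_{x^ix^j}$.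
   Context: A square-root metric is a Finsler metric $F=\sqrt{\alpha(\alpha+\beta)}$ with $\alpha=\sqrt{a_{ij}(x)y^iy^j}$ Riemannian, $\beta=b_i(x)y^i$ a 1-form, and $\|\beta\|_\alpha=\sqrt{a^{ij}b_ib_j}<1$, where $(a^{ij})=(a_{ij})^{-1}$. For a Finsler metric $F$ with fundamental tensor $g_{ij}=\frac12[F^2]_{y^iy^j}$ and inverse $(g^{ij})$, the geodesic coefficients are $G^i=\frac14 g^{il}\{[F^2]_{x^ky^l}y^k-[F^2]_{x^l}\}$, the Riemann curvature is $$R^i_{\ k}=2\frac{\partial G^i}{\partial x^k}-y^j\frac{\partial^2G^i}{\partial x^j\partial y^k}+2G^j\frac{\partial^2G^i}{\partial y^j\partial y^k}-\frac{\partial G^i}{\partial y^j}\frac{\partial G^j}{\partial y^k},$$ and the Ricci curvature is $Ric=R^k_{\ k}$. On an $n$-manifold write $Ric=(n-1)\lambda(x,y)F^2$; $F$ is an Einstein metric (Einsteinian) if $\lambda$ depends only on $x$. In dimension two the flag curvature is $\mathbf K=Ric/F^2$, and $F$ is of isotropic flag curvature if $\mathbf K=\mathbf K(x)$ depends only on $x$.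
   Formalization: The local form is asserted only around points where β is nonzero, since 0<B forces β≠0 (β=0 with α Euclidean is a counterexample); the formula for K is asserted where v≠0, so that B_1/v is defined. *)

(* Defs.v *)
From HB Require Import structures.
From mathcomp Require Import all_boot all_order all_algebra.
From mathcomp Require Import all_classical all_reals all_analysis.

Set Implicit Arguments.
Unset Strict Implicit.
Unset Printing Implicit Defensive.

Import Order.TTheory GRing.Theory Num.Theory.
Import numFieldNormedType.Exports.

Local Open Scope classical_set_scope.
Local Open Scope ring_scope.

Section Calculus.
Context {R : realType} {n : nat}.
Implicit Types (U V W : set 'rV[R]_n) (f : 'rV[R]_n -> R).

Definition partial (i : 'I_n) f (x : 'rV[R]_n) : R := 'D_(delta_mx 0 i) f x.

(* Class C^k on U; U is meant to be open. *)
Fixpoint Ck (k : nat) U f : Prop :=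
  if k is k'.+1 then
    (forall x, U x -> differentiable f x) /\ (forall i, Ck k' U (partial i f))
  else forall x, U x -> {for x, continuous f}.

Definition smooth U f : Prop := forall k, Ck k U f.

Definition smooth_map U (phi : 'rV[R]_n -> 'rV[R]_n) : Prop :=
  forall i, smooth U (fun x => phi x 0 i).

(* phi : V -> W is a smooth coordinate system on the open set V `<=` U, with
   inverse the parametrization psi : W -> V. *)
Definition local_coordinates U V W (phi psi : 'rV[R]_n -> 'rV[R]_n) : Prop :=
  [/\ open V, V `<=` U & open W] /\
  [/\ forall p, V p -> W (phi p) /\ psi (phi p) = p,
      forall x, W x -> V (psi x) /\ phi (psi x) = x,
      smooth_map V phi & smooth_map W psi].

End Calculus.

Section Finsler.
Context {R : realType} {n : nat}.

(* Functions of a point x and of a tangent vector y at x, in coordinates. *)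
Definition tfun := 'rV[R]_n -> 'rV[R]_n -> R.

Implicit Types (F H : tfun) (x y : 'rV[R]_n) (i j k : 'I_n).

Definition dx k H : tfun := fun x y => partial k (H ^~ y) x.
Definition dy k H : tfun := fun x y => partial k (H x) y.

Definition sqF F : tfun := fun x y => F x y ^+ 2.

Definition fundamental_tensor F x y : 'M[R]_n :=
  \matrix_(i, j) (2^-1 * dy j (dy i (sqF F)) x y).

Definition geodesic_coeff F i : tfun := fun x y =>
  4^-1 * \sum_l invmx (fundamental_tensor F x y) i l *
           ((\sum_k dy l (dx k (sqF F)) x y * y 0 k) - dx l (sqF F) x y).

Definition riemann_curvature F i k : tfun := fun x y =>
  let G := geodesic_coeff F in
  2 * dx k (G i) x y
  - \sum_j y 0 j * dy k (dx j (G i)) x y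
  + 2 * \sum_j G j x y * dy k (dy j (G i)) x y
  - \sum_j dy j (G i) x y * dy k (G j) x y.

Definition ricci F : tfun := fun x y => \sum_k riemann_curvature F k k x y.

Definition einstein (U : set 'rV[R]_n) F : Prop :=
  exists lambda : 'rV[R]_n -> R, forall x y, U x -> y != 0 ->
    ricci F x y = (n%:R - 1) * lambda x * F x y ^+ 2.

End Finsler.

Section FlagCurvature.
Context {R : realType}.
Implicit Type F : @tfun R 2.

Definition flag_curvature F x y : R := ricci F x y / F x y ^+ 2.

Definition isotropic_flag_curvature (U : set 'rV[R]_2) F : Prop :=
  exists K : 'rV[R]_2 -> R, forall x y : 'rV[R]_2, U x -> y != 0 ->
    flag_curvature F x y = K x.

End FlagCurvature.

Section SquareRootMetric.
Context {R : realType} {n : nat}.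
Variables (a : 'rV[R]_n -> 'M[R]_n) (b : 'rV[R]_n -> 'rV[R]_n).

Definition alpha (x y : 'rV[R]_n) : R :=
  Num.sqrt (\sum_i \sum_j a x i j * y 0 i * y 0 j).

Definition beta (x y : 'rV[R]_n) : R := \sum_i b x 0 i * y 0 i.

Definition beta_norm (x : 'rV[R]_n) : R :=
  Num.sqrt (\sum_i \sum_j invmx (a x) i j * b x 0 i * b x 0 j).

Definition sqroot_metric (x y : 'rV[R]_n) : R :=
  Num.sqrt (alpha x y * (alpha x y + beta x y)).

Definition riemannian (U : set 'rV[R]_n) : Prop :=
  [/\ forall i j, smooth U (fun x => a x i j),
      forall x (i j : 'I_n), U x -> a x i j = a x j i &
      forall x (y : 'rV[R]_n), U x -> y != 0 ->
        0 < \sum_i \sum_j a x i j * y 0 i * y 0 j].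

(* The data (a, b) define a square-root metric [sqroot_metric a b] on U.  The
   bound on the norm of beta makes it positive and strongly convex. *)
Definition is_sqroot_metric (U : set 'rV[R]_n) : Prop :=
  [/\ riemannian U, smooth_map U b & forall x, U x -> beta_norm x < 1].

End SquareRootMetric.

Section NormalForm.
Context {R : realType}.
Implicit Types (W : set 'rV[R]_2) (B u v : 'rV[R]_2 -> R).

Definition normal_form_pde W B u v : Prop :=
  [/\ smooth W B, smooth W u & smooth W v] /\
  forall x, W x ->
    [/\ 0 < B x < 1, u x ^+ 2 + v x ^+ 2 != 0,
        partial 0 u x = partial 1 v x, partial 1 u x = - partial 0 v x &
        u x * partial 0 B x + v x * partial 1 B x = 0].

(* The expressions of alpha and beta in the coordinates parametrized by psi:
   y is a tangent vector at x in these coordinates, and ['d psi x y] is the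
   same tangent vector in the original ones. *)
Definition normal_form (a : 'rV[R]_2 -> 'M[R]_2) (b : 'rV[R]_2 -> 'rV[R]_2)
    W (psi : 'rV[R]_2 -> 'rV[R]_2) B u v : Prop :=
  forall x y : 'rV[R]_2, W x ->
    alpha a (psi x) ('d psi x y) =
      Num.sqrt (B x) / (1 - B x) `^ (3 / 4) *
      Num.sqrt ((y 0 0 ^+ 2 + y 0 1 ^+ 2) / (u x ^+ 2 + v x ^+ 2)) /\
    beta b (psi x) ('d psi x y) =
      B x / (1 - B x) `^ (3 / 4) *
      ((u x * y 0 0 + v x * y 0 1) / (u x ^+ 2 + v x ^+ 2)).

End NormalForm.

(* Main.v *)
Require Import Defs.
From HB Require Import structures.
From mathcomp Require Import all_boot all_order all_algebra.
From mathcomp Require Import all_classical all_reals all_analysis.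
From mathcomp Require Import ring lra.
From mathcomp.real_closed Require Import complex.

Set Implicit Arguments.
Unset Strict Implicit.
Unset Printing Implicit Defensive.

Import Order.TTheory GRing.Theory Num.Theory.
Import numFieldNormedType.Exports.

Local Open Scope classical_set_scope.
Local Open Scope ring_scope.


(** The Einstein condition Ric = lambda F^2 says that the Ricci curvature of
    F = sqrt(alpha (alpha + beta)), which a priori is only rational in y and
    alpha(y), has no pole.  The geodesic coefficients of F have a common denominator
    d ([geodesic_sqroot]), and Ric has a pole of order four along d = 0, whose
    coefficient is three times the square of an explicit expression
    ([ricci_sqroot_pole]).  So d divides this square.  In normal coordinates at a
    point, with beta along the first axis, the directions (1 - t^2, 2 t) turn this
    into a divisibility of polynomials in t.  The denominator has no real zero, but
    evaluating at a complex one ([pole_conditions]) gives the derivatives of beta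
    up to one unknown: the diagonal ones vanish and the off-diagonal ones are
    proportional ([einstein_normalized]).

    Invariantly, with B the squared norm of beta and rho = (1 - B)^(3/4) / B, this
    says that the products om2 and om1 of rho with beta and with its Hodge dual are
    closed 1-forms and that dB is proportional to om1 ([coframe_normalized],
    [coframe_closed]).  Passing from normal coordinates to arbitrary ones needs the
    tensoriality of the Ricci curvature, which is proved from its coordinate formula
    ([ricci_pull]).

    Where beta does not vanish, closed independent 1-forms are the differentials of
    local coordinates, by the Poincare lemma and the inverse function theorem
    ([closed_form_exact], [inverse_function], [closed_coframe_coordinates]).  In the
    coordinates given by om1 and om2 the function B depends on the first coordinate
    only, and the metric has the required form with u = 0 and v = 1 ([local_form]).

    For the curvature, in any local form the two 1-forms dual to the vector fields
    (v, - u) and (u, v) are closed by the Cauchy-Riemann equations, and in the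
    coordinates that they define the square of the metric is
    m (r^2 + sqrt(B) r y_2), where r is the Euclidean length of y and m and B depend
    on the first coordinate only.  The curvature of this metric is computed directly
    ([ricci_model]); the derivatives of B in the new coordinates are expressed by the
    Laplacian of B and by its first derivatives in the old ones
    ([flag_curvature_normal_form]). *)

(** * Calculus of smooth functions of several variables *)

Section Differential.
Context {R : realType} {V W : normedModType R}.
Implicit Types (f g : V -> W) (x : V).

Lemma differentiable_eps f x (L : {linear V -> W}) : continuous L ->
  (forall e, 0 < e -> \forall h \near (0 : V),
     `|f (h + x) - f x - L h| <= e * `|h|) ->
  differentiable f x /\ 'd f x = L :> (V -> W).
Proof.
move=> cL fe.
have E : f \o shift x = cst (f x) + L +o_ 0 id.
  apply/eqaddoP => e e0; apply: filterS (fe e e0) => h.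
  by rewrite opprD addrA.
have dL := diff_unique cL E.
by split=> //; apply/diff_locallyP; rewrite dL.
Qed.

Lemma diff_eps f x : differentiable f x -> forall e, 0 < e ->
  \forall h \near (0 : V), `|f (h + x) - f x - 'd f x h| <= e * `|h|.
Proof.
move=> /diff_locally /eqaddoP fe e e0; apply: filterS (fe e e0) => h.
by rewrite opprD addrA.
Qed.

Lemma near_eq_differentiable f g x :
  (\near x, f x = g x) -> differentiable f x -> differentiable g x.
Proof.
move=> fg df; have fx : f x = g x by exact: (nbhs_singleton fg).
apply: (differentiable_eps (diff_continuous df) _).1 => e e0.
have fgh : \forall h \near (0 : V), f (h + x) = g (h + x).
  have := fg; rewrite (near_shift 0 x) /= => H.
  by apply: filterS H => h /=; rewrite subr0.
by apply: filterS2 fgh (diff_eps df e0) => h <-; rewrite -fx.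
Qed.

End Differential.

Section PartialDerivatives.
Context {R : realType} {n : nat}.
Implicit Types (U : set 'rV[R]_n) (f g : 'rV[R]_n -> R) (x v : 'rV[R]_n).

Lemma open_eq_nbhs U f g : open U -> (forall x, U x -> f x = g x) ->
  forall x, U x -> \near x, f x = g x.
Proof.
move=> oU fg x Ux; near=> z; apply: fg; near: z; exact: open_nbhs_nbhs.
Unshelve. all: by end_near. Qed.

Lemma eq_differentiable U f g : open U -> (forall x, U x -> f x = g x) ->
  forall x, U x -> differentiable f x -> differentiable g x.
Proof. by move=> oU fg x Ux; apply/near_eq_differentiable/(open_eq_nbhs oU). Qed.

Lemma eq_partial U f g i : open U -> (forall x, U x -> f x = g x) ->
  forall x, U x -> partial i f x = partial i g x.
Proof.
move=> oU fg x Ux; apply: near_eq_derive.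
exact: open_eq_nbhs fg x Ux.
Qed.

Lemma partialD f g i x : differentiable f x -> differentiable g x ->
  partial i (fun x => f x + g x) x = partial i f x + partial i g x.
Proof. by move=> df dg; apply: deriveD; exact: diff_derivable. Qed.

Lemma partialM f g i x : differentiable f x -> differentiable g x ->
  partial i (fun x => f x * g x) x = partial i f x * g x + f x * partial i g x.
Proof.
move=> df dg; rewrite /partial [LHS]deriveM; try exact: diff_derivable.
by rewrite addrC /GRing.scale /= [_ * g x]mulrC.
Qed.

Lemma partial_cst c i x : partial i (fun=> c) x = 0.
Proof. exact: derive_cst. Qed.

Lemma partialV f i x : f x != 0 -> differentiable f x ->
  partial i (fun x => (f x)^-1) x = - (f x) ^- 2 * partial i f x.
Proof.
by move=> f0 df; rewrite /partial [LHS]deriveV//; exact: diff_derivable.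
Qed.

Lemma differentiable_coordf j x : differentiable (fun x : 'rV[R]_n => x 0 j : R) x.
Proof. exact: differentiable_coord. Qed.

Lemma partial_coord j i x : partial i (fun x => x 0 j : R) x = (i == j)%:R.
Proof.
have L : linear (fun x : 'rV[R]_n => x 0 j : R) by move=> a u v; rewrite !mxE.
pose l := GRing.isLinear.Build _ _ _ _ _ L.
pose l' : {linear 'rV[R]_n -> R} := HB.pack (fun x : 'rV[R]_n => x 0 j : R) l.
have c : continuous (l' : 'rV[R]_n -> R) by exact: coord_continuous.
rewrite /partial deriveE; last exact: differentiable_coordf.
rewrite -[fun _ => _]/(l' : _ -> _) (diff_lin _ c) /=.
by rewrite mxE eqxx /= eq_sym.
Qed.

Lemma derive_partial f x v : differentiable f x ->
  'D_v f x = \sum_j v 0 j * partial j f x.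
Proof.
move=> df; rewrite deriveE // [in LHS](row_sum_delta v) linear_sum /=.
by apply: eq_bigr => j _; rewrite /partial deriveE // -[RHS]/(_ *: _) -linearZ.
Qed.

End PartialDerivatives.

Section Sqrt.
Context {R : realType}.

Lemma is_derive_sqrt (x : R) : 0 < x ->
  is_derive x 1 (@Num.sqrt R) ((2 * Num.sqrt x)^-1).
Proof. by move=> x0; exact: is_derive1_sqrt. Qed.

Lemma differentiable_sqrtf n (f : 'rV[R]_n -> R) x : 0 < f x ->
  differentiable f x -> differentiable (fun x => Num.sqrt (f x)) x.
Proof.
move=> f0 df; apply: (@differentiable_comp _ _ _ _ f Num.sqrt) => //.
by apply/derivable1_diffP; have [] := is_derive_sqrt f0.
Qed.

Lemma partial_sqrt n (f : 'rV[R]_n -> R) i x : 0 < f x ->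
  differentiable f x ->
  partial i (fun x => Num.sqrt (f x)) x = (2 * Num.sqrt (f x))^-1 * partial i f x.
Proof.
move=> f0 df.
have dS : differentiable (@Num.sqrt R) (f x).
  by apply/derivable1_diffP; have [] := is_derive_sqrt f0.
rewrite /partial deriveE; last exact: differentiable_sqrtf.
rewrite (_ : (fun _ => _) = Num.sqrt \o f) // diff_comp //=.
rewrite -[X in 'd _ _ X]deriveE //; set w := 'D_ _ f x.
have -> : w = w *: (1 : R) by rewrite /GRing.scale /= mulr1.
rewrite linearZ /= -deriveE // [in RHS]/GRing.scale /= mulr1.
by rewrite (@derive_val _ _ _ _ _ _ _ (is_derive_sqrt f0)) [RHS]mulrC.
Qed.

End Sqrt.

Lemma continuous_rV {R : realType} {T : topologicalType} {n : nat}
    (g : T -> 'rV[R]_n) (x : T) :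
  (forall j, {for x, continuous (fun x => g x 0 j)}) -> {for x, continuous g}.
Proof.
move=> cg; apply/cvgrPdist_le => e e0; near=> z.
rewrite /Num.norm /= mx_normrE; apply: bigmax_le; first exact: ltW.
move=> [i j] _; rewrite !mxE /= ord1.
move: j; near: z; apply: filter_forall => j.
by have /cvgrPdist_le := cg j; apply.
Unshelve. all: by end_near. Qed.

Section Maps.
Context {R : realType} {m n : nat}.
Implicit Types (g : 'rV[R]_m -> 'rV[R]_n) (f : 'rV[R]_n -> R).

Lemma rV_funE g : g = fun x => \sum_j g x 0 j *: delta_mx 0 j.
Proof. by apply/funext => x; rewrite -row_sum_delta. Qed.

Lemma differentiable_rV g x :
  (forall j, differentiable (fun x => g x 0 j) x) -> differentiable g x.
Proof.
move=> dg; rewrite (rV_funE g).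
rewrite (_ : (fun _ => _) = \sum_j (fun x => g x 0 j *: delta_mx 0 j)); last first.
  by apply/funext => z; rewrite fct_sumE.
apply: differentiable_sum => j; exact: differentiableZl.
Qed.

Lemma derive_rV g x v : (forall j, differentiable (fun x => g x 0 j) x) ->
  'D_v g x = \row_j 'D_v (fun x => g x 0 j) x.
Proof.
move=> dg; rewrite derive_mx; last first.
  by apply: diff_derivable; exact: differentiable_rV.
by apply/rowP => j; rewrite !mxE.
Qed.

Lemma differentiable_rVcomp g f x :
  (forall j, differentiable (fun x => g x 0 j) x) -> differentiable f (g x) ->
  differentiable (fun x => f (g x)) x.
Proof.
by move=> dg df; apply: (@differentiable_comp _ _ _ _ g f) => //; exact: differentiable_rV.
Qed.

Lemma partial_comp g f i x :
  (forall j, differentiable (fun x => g x 0 j) x) -> differentiable f (g x) ->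
  partial i (fun x => f (g x)) x =
  \sum_j partial i (fun x => g x 0 j) x * partial j f (g x).
Proof.
move=> dg df; have dg' := differentiable_rV dg.
rewrite /partial deriveE; last exact: differentiable_rVcomp.
rewrite (_ : (fun _ => _) = f \o g) // diff_comp //=.
rewrite -[X in 'd f _ X]deriveE // -deriveE // derive_partial //.
by apply: eq_bigr => j _; rewrite derive_rV // mxE.
Qed.

End Maps.

Section Ck.
Context {R : realType} {n : nat}.
Implicit Types (U V : set 'rV[R]_n) (f g : 'rV[R]_n -> R) (k : nat).

(** On an open set the predicate only depends on the values of f there; this is
    what lets the inductions on k below work with formulas for the derivatives. *)
Lemma Ck_eq k U f g : open U -> (forall x, U x -> f x = g x) ->
  Ck k U f -> Ck k U g.
Proof.
move=> oU; elim: k f g => [|k IH] f g fg /=.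
  move=> cf x Ux.
  rewrite /prop_for /continuous_at -(fg _ Ux).
  have cfx : f x @[x --> x] --> f x := cf x Ux.
  apply: cvg_trans cfx; apply: near_eq_cvg; first exact: nbhs_filter.
  exact: (@open_eq_nbhs _ _ U f g oU fg x Ux).
move=> [df cf]; split=> [x Ux|i]; first exact: (eq_differentiable oU fg Ux (df x Ux)).
by apply: IH (cf i) => x Ux; exact: (eq_partial i oU fg Ux).
Qed.

Lemma CkW k U f : Ck k.+1 U f -> Ck k U f.
Proof.
elim: k f => [|k IH] f /=; last by move=> [df cf]; split=> // i; exact/IH/cf.
by move=> [df _] x Ux; exact/differentiable_continuous/df.
Qed.

Lemma Ck_sub k U V f : V `<=` U -> Ck k U f -> Ck k V f.
Proof.
move=> VU; elim: k f => [|k IH] f /=; first by move=> cf x /VU; exact: cf.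
by move=> [df cf]; split=> [x /VU|i]; [exact: df|exact/IH/cf].
Qed.

Lemma Ck_cst k U (c : R) : Ck k U (fun=> c).
Proof.
elim: k c => [|k IH] c /=.
  by move=> x _; exact: (@cst_continuous _ _ c).
split=> [x _|i]; first exact: differentiable_cst.
by rewrite (_ : partial _ _ = fun=> 0) //; apply/funext => x; exact: partial_cst.
Qed.

Lemma Ck_coord k U j : Ck k U (fun x : 'rV[R]_n => x 0 j : R).
Proof.
case: k => [|k] /=; first by move=> x _; exact: (@coord_continuous _ _ _ 0 j).
split=> [x _|i]; first exact: differentiable_coordf.
rewrite (_ : partial _ _ = fun=> (i == j)%:R); first exact: Ck_cst.
by apply/funext => x; exact: partial_coord.
Qed.

Lemma CkD k U f g : open U -> Ck k U f -> Ck k U g ->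
  Ck k U (fun x => f x + g x).
Proof.
move=> oU; elim: k f g => [|k IH] f g /=.
  by move=> cf cg x Ux; apply: continuousD; [exact: cf|exact: cg].
move=> [df cf] [dg cg]; split=> [x Ux|i].
  by apply: differentiableD; [exact: df|exact: dg].
apply: (@Ck_eq _ _ (fun x => partial i f x + partial i g x)) => //.
  by move=> x Ux; rewrite partialD //; [exact: df|exact: dg].
by apply: IH; [exact: cf|exact: cg].
Qed.

Lemma CkM k U f g : open U -> Ck k U f -> Ck k U g ->
  Ck k U (fun x => f x * g x).
Proof.
move=> oU; elim: k f g => [|k IH] f g.
  by move=> cf cg x Ux; apply: continuousM; [exact: cf|exact: cg].
move=> Cf Cg; have [df cf] := Cf; have [dg cg] := Cg; split=> [x Ux|i].
  by apply: differentiableM; [exact: df|exact: dg].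
apply: (@Ck_eq _ _ (fun x => partial i f x * g x + f x * partial i g x)) => //.
  by move=> x Ux; rewrite partialM //; [exact: df|exact: dg].
by apply: (CkD oU); apply: IH; [exact: cf|exact: CkW|exact: CkW|exact: cg].
Qed.

Lemma Ck_sum k U (I : Type) (r : seq I) (F : I -> 'rV[R]_n -> R) : open U ->
  (forall i, Ck k U (F i)) -> Ck k U (fun x => \sum_(i <- r) F i x).
Proof.
move=> oU cF; elim: r => [|i r IH].
  by under eq_fun do rewrite big_nil; exact: Ck_cst.
by under eq_fun do rewrite big_cons; exact: CkD.
Qed.

Lemma CkV k U f : open U -> (forall x, U x -> f x != 0) -> Ck k U f ->
  Ck k U (fun x => (f x)^-1).
Proof.
move=> oU f0; elim: k => [|k IH].
  by move=> cf x Ux; exact: (@continuousV _ _ f x (f0 x Ux) (cf x Ux)).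
move=> Cf; have [df cf] := Cf; split=> [x Ux|i].
  by apply: differentiableV; [exact: df|exact: f0].
apply: (@Ck_eq _ _ (fun x => (-1) * ((f x)^-1 * (f x)^-1) * partial i f x)) => //.
  move=> x Ux; rewrite partialV //; [|exact: f0|exact: df].
  by rewrite mulN1r -expr2 exprVn.
have C1 := IH (CkW Cf).
apply: (CkM oU) (cf i); apply: (CkM oU) (CkM oU C1 C1); exact: Ck_cst.
Qed.

(** The derivative of the root contains the root itself, so the induction is on k
   and uses the statement for the same f. *)
Lemma Ck_sqrt k U f : open U -> (forall x, U x -> 0 < f x) -> Ck k U f ->
  Ck k U (fun x => Num.sqrt (f x)).
Proof.
move=> oU f0; elim: k => [|k IH].
  move=> cf x Ux; apply: (@continuous_comp _ _ _ f Num.sqrt); first exact: cf.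
  exact: sqrt_continuous.
move=> Cf; have [df cf] := Cf; split=> [x Ux|i].
  by apply: differentiable_sqrtf; [exact: f0|exact: df].
apply: (@Ck_eq _ _ (fun x => (2 * Num.sqrt (f x))^-1 * partial i f x)) => //.
  by move=> x Ux; rewrite partial_sqrt //; [exact: f0|exact: df].
apply: (CkM oU) (cf i); apply: (CkV oU) => [x Ux|].
  by rewrite mulf_neq0 // gt_eqF // sqrtr_gt0 f0.
by apply: (CkM oU); [exact: Ck_cst|exact: IH (CkW Cf)].
Qed.

Lemma smooth_partial U f i : smooth U f -> smooth U (partial i f).
Proof. by move=> sf k; exact: (sf k.+1).2. Qed.

Lemma smooth_diff U f x : smooth U f -> U x -> differentiable f x.
Proof. by move=> /(_ 1%N)[+ _]; exact. Qed.

Lemma smooth_eq U f g : open U -> (forall x, U x -> f x = g x) ->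
  smooth U f -> smooth U g.
Proof. by move=> oU fg sf k; exact: Ck_eq (sf k). Qed.

Lemma smooth_sub U V f : V `<=` U -> smooth U f -> smooth V f.
Proof. by move=> VU sf k; exact: Ck_sub (sf k). Qed.

Lemma smooth_cst U (c : R) : smooth U (fun=> c).
Proof. by move=> k; exact: Ck_cst. Qed.

Lemma smooth_coord U j : smooth U (fun x : 'rV[R]_n => x 0 j : R).
Proof. by move=> k; exact: Ck_coord. Qed.

Lemma smoothD U f g : open U -> smooth U f -> smooth U g ->
  smooth U (fun x => f x + g x).
Proof. by move=> oU sf sg k; exact: CkD. Qed.

Lemma smoothM U f g : open U -> smooth U f -> smooth U g ->
  smooth U (fun x => f x * g x).
Proof. by move=> oU sf sg k; exact: CkM. Qed.

Lemma smoothN U f : open U -> smooth U f -> smooth U (fun x => - f x).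
Proof.
move=> oU sf; apply: (@smooth_eq _ (fun x => -1 * f x)) => //.
  by move=> x _; rewrite mulN1r.
by apply: smoothM => //; exact: smooth_cst.
Qed.

Lemma smoothB U f g : open U -> smooth U f -> smooth U g ->
  smooth U (fun x => f x - g x).
Proof. by move=> oU sf sg; apply: smoothD => //; exact: smoothN. Qed.

Lemma smoothX U f k : open U -> smooth U f -> smooth U (fun x => f x ^+ k).
Proof.
move=> oU sf; elim: k => [|k IH].
  by under eq_fun do rewrite expr0; exact: smooth_cst.
by under eq_fun do rewrite exprS; exact: smoothM.
Qed.

Lemma smooth_sum U (I : Type) (r : seq I) (F : I -> 'rV[R]_n -> R) : open U ->
  (forall i, smooth U (F i)) -> smooth U (fun x => \sum_(i <- r) F i x).
Proof. by move=> oU sF k; apply: Ck_sum => // i; exact: sF. Qed.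

Lemma smoothV U f : open U -> (forall x, U x -> f x != 0) -> smooth U f ->
  smooth U (fun x => (f x)^-1).
Proof. by move=> oU f0 sf k; exact: CkV. Qed.

Lemma smooth_sqrt U f : open U -> (forall x, U x -> 0 < f x) -> smooth U f ->
  smooth U (fun x => Num.sqrt (f x)).
Proof. by move=> oU f0 sf k; exact: Ck_sqrt. Qed.

End Ck.

Section Composition.
Context {R : realType} {m n : nat}.

Lemma Ck_comp k (U : set 'rV[R]_m) (W : set 'rV[R]_n)
    (g : 'rV[R]_m -> 'rV[R]_n) (f : 'rV[R]_n -> R) : open U ->
  (forall x, U x -> W (g x)) -> (forall j, Ck k U (fun x => g x 0 j)) ->
  Ck k W f -> Ck k U (fun x => f (g x)).
Proof.
move=> oU gUW; elim: k f => [|k IH] f.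
  move=> cg cf x Ux; apply: (@continuous_comp _ _ _ g f); last exact/cf/gUW.
  by apply: continuous_rV => j; exact: cg.
move=> Cg Cf; have [df cf] := Cf.
have dg j x : U x -> differentiable (fun x => g x 0 j) x by exact: (Cg j).1.
split=> [x Ux|i].
  by apply: differentiable_rVcomp => [j|]; [exact: dg|exact/df/gUW].
apply: (@Ck_eq _ _ _ _
    (fun x => \sum_j partial i (fun x => g x 0 j) x * partial j f (g x))) => //.
  by move=> x Ux; rewrite partial_comp // => [j|]; [exact: dg|exact/df/gUW].
apply: (Ck_sum _ oU) => j; apply: (CkM oU) ((Cg j).2 i) _.
by apply: IH (cf j) => l; exact/CkW/Cg.
Qed.

Lemma smooth_comp (U : set 'rV[R]_m) (W : set 'rV[R]_n)
    (g : 'rV[R]_m -> 'rV[R]_n) (f : 'rV[R]_n -> R) : open U ->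
  (forall x, U x -> W (g x)) -> (forall j, smooth U (fun x => g x 0 j)) ->
  smooth W f -> smooth U (fun x => f (g x)).
Proof. by move=> oU gUW sg sf k; apply: (@Ck_comp k U W) => // j; exact: sg. Qed.

End Composition.

(** * Symmetry of second derivatives *)

Lemma continuous_near_lt {R : realType} {T : topologicalType} (f : T -> R)
    (x : T) (e : R) : {for x, continuous f} -> 0 < e ->
  \forall z \near x, `|f z - f x| < e.
Proof.
move=> /cvgrPdist_lt cf e0; near=> z; rewrite distrC.
by near: z; exact: cf.
Unshelve. all: by end_near. Qed.

Section Schwarz.
Context {R : realType} {n : nat}.
Implicit Types (U : set 'rV[R]_n) (f : 'rV[R]_n -> R) (x v : 'rV[R]_n).

Lemma is_derive_line f x v (t : R) : differentiable f (t *: v + x) ->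
  is_derive t 1 (fun t => f (t *: v + x)) ('D_v f (t *: v + x)).
Proof.
move=> dif; have df : derivable f (t *: v + x) v by exact: diff_derivable.
have E : (fun h : R => h^-1 *: (f ((h *: (1 : R) + t) *: v + x) - f (t *: v + x)))
    = (fun h => h^-1 *: (f (h *: v + (t *: v + x)) - f (t *: v + x))).
  by apply/funext => h; rewrite scalerDl addrA -[h *: 1]/(h * 1) mulr1.
apply: DeriveDef; first by rewrite /derivable E.
by rewrite /derive E.
Qed.

Lemma mean_value_line f x v (h : R) : 0 < h ->
  (forall t, 0 <= t <= h -> differentiable f (t *: v + x)) ->
  exists2 c, 0 < c < h & f (h *: v + x) - f x = h * 'D_v f (c *: v + x).
Proof.
move=> h0 df.
have D t : 0 <= t <= h -> is_derive t 1 (fun t => f (t *: v + x)) ('D_v f (t *: v + x)).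
  by move=> th; exact/is_derive_line/df.
have [||c] := @MVT R (fun t => f (t *: v + x)) (fun t => 'D_v f (t *: v + x)) 0 h h0.
- by move=> t; rewrite in_itv /= => /andP[t0 th]; apply: D; rewrite !ltW.
- apply: derivable_within_continuous => t; rewrite in_itv /= => th.
  by have [] := D t th.
rewrite in_itv /= scale0r add0r subr0 => ch ->.
by exists c; rewrite // mulrC.
Qed.

Lemma open_norm_ball U x : open U -> U x ->
  exists2 r, 0 < r & forall z, `|z - x| < r -> U z.
Proof.
move=> oU Ux; have /nbhs_ballP[r r0 rU] := open_nbhs_nbhs (conj oU Ux).
by exists r => // z zx; apply: rU; rewrite mx_norm_ball /ball_ /= distrC.
Qed.

Lemma continuous_norm_ball f x e : {for x, continuous f} -> 0 < e ->
  exists2 r, 0 < r & forall z, `|z - x| < r -> `|f z - f x| < e.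
Proof.
move=> cf e0; have /nbhs_ballP[r r0 rU] := continuous_near_lt cf e0.
exists r => // z zx; apply: rU.
by rewrite mx_norm_ball /ball_ /= distrC.
Qed.

Let second_difference f i j x (h : R) :=
  f (h *: delta_mx 0 i + (h *: delta_mx 0 j + x))
  - f (h *: delta_mx 0 i + x) - f (h *: delta_mx 0 j + x) + f x.

Lemma second_difference_partial U f i j x e : open U -> Ck 2 U f -> U x ->
  0 < e -> exists2 d, 0 < d & forall h, 0 < h < d ->
    `|second_difference f i j x h / h ^+ 2 - partial j (partial i f) x| < e.
Proof.
move=> oU [df /(_ i) [di /(_ j) cij]] Ux e0.
have [r1 r10 r1U] := open_norm_ball oU Ux.
have [r2 r20 r2c] := continuous_norm_ball (cij x Ux) e0.
pose K : R := `|delta_mx 0 i : 'rV[R]_n| + `|delta_mx 0 j : 'rV[R]_n| + 1.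
have K0 : 0 < K by rewrite ltr_wpDl // addr_ge0.
pose r := Num.min r1 r2; have r0 : 0 < r by rewrite lt_min r10.
exists (r / K) => [|h /andP[h0 hd]]; first by rewrite divr_gt0.
have near_x s t : 0 <= s <= h -> 0 <= t <= h ->
    `|(s *: delta_mx 0 j + (t *: delta_mx 0 i + x)) - x| < r.
  move=> /andP[s0 sh] /andP[t0 th]; rewrite addrA addrK.
  apply: le_lt_trans (ler_normD _ _) _; rewrite !normrZ !ger0_norm //.
  apply: (@le_lt_trans _ _ (h * K)); last by rewrite -ltr_pdivlMr.
  rewrite [h * K]mulrDr mulr1 ler_wpDr ?(ltW h0) // mulrDr addrC.
  by rewrite lerD // ler_wpM2r.
have inU s t : 0 <= s <= h -> 0 <= t <= h ->
    U (s *: delta_mx 0 j + (t *: delta_mx 0 i + x)).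
  by move=> sh th; apply: r1U; apply: lt_le_trans (near_x _ _ sh th) _; rewrite ge_min lexx.
have h00 : (0 : R) <= 0 <= h by rewrite lexx ltW.
have hh : 0 <= h <= h by rewrite lexx ltW.
have swap (s t : R) : s *: delta_mx 0 j + (t *: delta_mx 0 i + x) =
    t *: delta_mx 0 i + (s *: delta_mx 0 j + x) by rewrite addrCA.
have inU0 t : 0 <= t <= h -> U (t *: delta_mx 0 i + x).
  by move=> th; have := inU 0 t h00 th; rewrite scale0r add0r.
have D1 t : 0 <= t <= h -> is_derive t 1
    (fun t => f (t *: delta_mx 0 i + (h *: delta_mx 0 j + x))
              - f (t *: delta_mx 0 i + x))
    (partial i f (t *: delta_mx 0 i + (h *: delta_mx 0 j + x))
     - partial i f (t *: delta_mx 0 i + x)).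
  move=> th; apply: is_deriveB; apply: is_derive_line; apply: df.
    by rewrite -swap; exact: inU.
  exact: inU0.
have [||c] := MVT h0 (df := fun t =>
    partial i f (t *: delta_mx 0 i + (h *: delta_mx 0 j + x))
     - partial i f (t *: delta_mx 0 i + x)) (f := fun t =>
     f (t *: delta_mx 0 i + (h *: delta_mx 0 j + x)) - f (t *: delta_mx 0 i + x)).
- by move=> t; rewrite in_itv /= => /andP[t0 th]; apply: D1; rewrite !ltW.
- apply: derivable_within_continuous => t; rewrite in_itv /= => th.
  by have [] := D1 t th.
rewrite in_itv /= => /andP[c0 ch] E1.
have cc : 0 <= c <= h by rewrite !ltW.
have [c' /andP[c'0 c'h]] :=
    @mean_value_line (partial i f) (c *: delta_mx 0 i + x) (delta_mx 0 j) h h0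
      (fun t th => di _ (inU t c th cc)).
rewrite swap => E2.
rewrite E2 in E1.
have -> : second_difference f i j x h / h ^+ 2 =
    partial j (partial i f) (c' *: delta_mx 0 j + (c *: delta_mx 0 i + x)).
  rewrite (_ : second_difference f i j x h = h * partial j (partial i f)
    (c' *: delta_mx 0 j + (c *: delta_mx 0 i + x)) * (h - 0)).
    by rewrite subr0; field; exact: lt0r_neq0.
  by rewrite /partial -E1 !scale0r !add0r /second_difference; ring.
apply: r2c; apply: lt_le_trans (near_x _ _ _ cc) _; first by rewrite !ltW.
by rewrite ge_min lexx orbT.
Qed.

(** Both mixed derivatives are the limit of one and the same symmetric second
    difference quotient. *)
Lemma Schwarz U f i j x : open U -> Ck 2 U f -> U x ->
  partial i (partial j f) x = partial j (partial i f) x.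
Proof.
move=> oU Cf Ux; apply/eqP; rewrite -subr_eq0 -normr_eq0; apply/eqP.
apply: le_anti; rewrite normr_ge0 andbT; apply/ler_addgt0Pr => e e0.
rewrite add0r; have e20 : 0 < e / 2 by rewrite divr_gt0.
have [d d0 D] := second_difference_partial i j oU Cf Ux e20.
have [d' d'0 D'] := second_difference_partial j i oU Cf Ux e20.
pose h := Num.min d d' / 2.
have m0 : 0 < Num.min d d' by rewrite lt_min d0.
have h0 : 0 < h by rewrite divr_gt0.
have hm : h < Num.min d d' by rewrite ltr_pdivrMr // ltr_pMr // ltr1n.
have := D h; have := D' h; move: hm; rewrite lt_min => /andP[-> ->].
rewrite h0 => /(_ isT) + /(_ isT).
have -> : second_difference f j i x h = second_difference f i j x h.
  by rewrite /second_difference (addrCA (h *: _)); ring.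
move: (second_difference f i j x h / h ^+ 2) => q.
move: (partial _ _ _) (partial _ _ _) => P P' /ltW A /ltW B.
by apply: le_trans (ler_distD q _ _) _; rewrite distrC (splitr e) lerD.
Qed.

Lemma smooth_Schwarz U f i j x : open U -> smooth U f -> U x ->
  partial i (partial j f) x = partial j (partial i f) x.
Proof. by move=> oU sf; apply: Schwarz oU (sf 2%N). Qed.

End Schwarz.

(** * Functions of a point and a tangent vector *)

Section Joint.
Context {R : realType} {n : nat}.
Implicit Types (U : set 'rV[R]_n) (H K : @tfun R n) (x y : 'rV[R]_n).

(** Encoding H as a function on a space of pairs makes every statement about
    partial derivatives in x or y an instance of the calculus above. *)
Definition joint H : 'rV[R]_(n + n) -> R := fun z => H (lsubmx z) (rsubmx z).

(** The slit tangent bundle over U. *)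
Definition slit U : set 'rV[R]_(n + n) := [set z | U (lsubmx z) /\ rsubmx z != 0].

Definition tsmooth U H := smooth (slit U) (joint H).

Lemma open_slit U : open U -> open (slit U).
Proof.
move=> oU; apply: openI.
  by apply: open_comp => // z _; exact: continuous_lsubmx.
apply: (@open_comp _ _ (rsubmx : 'rV[R]_(n + n) -> 'rV[R]_n)
    [set y | y != 0]) => [z _|]; first exact: continuous_rsubmx.
rewrite (_ : [set y | _] = ~` [set 0]); last first.
  by apply/seteqP; split => y /= /eqP.
apply: closed_openC; exact: accessible_closed_set1 (hausdorff_accessible (@norm_hausdorff _ _)) 0.
Qed.

Lemma slit_row_mx U x y : slit U (row_mx x y) <-> U x /\ y != 0.
Proof. by rewrite /slit /= row_mxKl row_mxKr. Qed.

Lemma jointE H x y : joint H (row_mx x y) = H x y.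
Proof. by rewrite /joint row_mxKl row_mxKr. Qed.

Lemma delta_lshift k : delta_mx 0 (lshift n k) = row_mx (delta_mx 0 k) 0 :> 'rV[R]_(n + n).
Proof.
apply/rowP => j; case: (split_ordP j) => i ->.
  by rewrite row_mxEl !mxE /= eq_lshift.
by rewrite row_mxEr !mxE /= eq_rlshift.
Qed.

Lemma delta_rshift k : delta_mx 0 (rshift n k) = row_mx 0 (delta_mx 0 k) :> 'rV[R]_(n + n).
Proof.
apply/rowP => j; case: (split_ordP j) => i ->.
  by rewrite row_mxEl !mxE /= eq_lrshift.
by rewrite row_mxEr !mxE /= eq_rshift.
Qed.

Lemma dx_joint H k x y : dx k H x y = partial (lshift n k) (joint H) (row_mx x y).
Proof.
rewrite /dx /partial /derive; set d := (fun _ : R => _).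
set d' := (fun _ : R => _); suff -> : d = d' by [].
apply/funext => h; rewrite /d /d' jointE delta_lshift scale_row_mx /= add_row_mx jointE.
by rewrite scaler0 add0r.
Qed.

Lemma dy_joint H k x y : dy k H x y = partial (rshift n k) (joint H) (row_mx x y).
Proof.
rewrite /dy /partial /derive; set d := (fun _ : R => _).
set d' := (fun _ : R => _); suff -> : d = d' by [].
apply/funext => h; rewrite /d /d' jointE delta_rshift scale_row_mx /= add_row_mx jointE.
by rewrite scaler0 add0r.
Qed.

Lemma joint_dx H k : joint (dx k H) = partial (lshift n k) (joint H).
Proof. by apply/funext => z; rewrite {1}/joint dx_joint hsubmxK. Qed.

Lemma joint_dy H k : joint (dy k H) = partial (rshift n k) (joint H).
Proof. by apply/funext => z; rewrite {1}/joint dy_joint hsubmxK. Qed.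

Section Over.
Variable U : set 'rV[R]_n.
Hypothesis oU : open U.
Let oS := open_slit oU.

Lemma joint_eq H K : (forall x y, U x -> y != 0 -> H x y = K x y) ->
  forall z, slit U z -> joint H z = joint K z.
Proof. by move=> HK z [Uz z0]; exact: HK. Qed.

Lemma tsmooth_eq H K : (forall x y, U x -> y != 0 -> H x y = K x y) ->
  tsmooth U H -> tsmooth U K.
Proof. by move=> HK; apply/smooth_eq/joint_eq. Qed.

Lemma eq_dx H K k : (forall x y, U x -> y != 0 -> H x y = K x y) ->
  forall x y, U x -> y != 0 -> dx k H x y = dx k K x y.
Proof.
move=> HK x y Ux y0; rewrite !dx_joint; apply: eq_partial oS (joint_eq HK) _ _.
exact/slit_row_mx.
Qed.

Lemma eq_dy H K k : (forall x y, U x -> y != 0 -> H x y = K x y) ->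
  forall x y, U x -> y != 0 -> dy k H x y = dy k K x y.
Proof.
move=> HK x y Ux y0; rewrite !dy_joint; apply: eq_partial oS (joint_eq HK) _ _.
exact/slit_row_mx.
Qed.

Lemma tsmooth_diff H x y : tsmooth U H -> U x -> y != 0 ->
  differentiable (joint H) (row_mx x y).
Proof. by move=> sH Ux y0; apply: smooth_diff sH _; exact/slit_row_mx. Qed.

Lemma tsmooth_dx H k : tsmooth U H -> tsmooth U (dx k H).
Proof. by rewrite /tsmooth joint_dx; exact: smooth_partial. Qed.

Lemma tsmooth_dy H k : tsmooth U H -> tsmooth U (dy k H).
Proof. by rewrite /tsmooth joint_dy; exact: smooth_partial. Qed.

Lemma tsmoothD H K : tsmooth U H -> tsmooth U K ->
  tsmooth U (fun x y => H x y + K x y).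
Proof. exact: smoothD. Qed.

Lemma tsmoothM H K : tsmooth U H -> tsmooth U K ->
  tsmooth U (fun x y => H x y * K x y).
Proof. exact: smoothM. Qed.

Lemma tsmoothV H : (forall x y, U x -> y != 0 -> H x y != 0) -> tsmooth U H ->
  tsmooth U (fun x y => (H x y)^-1).
Proof. by move=> H0 sH; apply: (smoothV oS) sH => z [? ?]; exact: H0. Qed.

Lemma tsmooth_sqrt H : (forall x y, U x -> y != 0 -> 0 < H x y) -> tsmooth U H ->
  tsmooth U (fun x y => Num.sqrt (H x y)).
Proof. by move=> H0 sH; apply: (smooth_sqrt oS) sH => z [? ?]; exact: H0. Qed.

Lemma tsmooth_x (f : 'rV[R]_n -> R) : smooth U f -> tsmooth U (fun x _ => f x).
Proof.
have sl j : smooth (slit U) (fun z : 'rV[R]_(n + n) => lsubmx z 0 j).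
  rewrite (_ : (fun z => _) = fun x : 'rV[R]_(n + n) => x 0 (lshift n j)).
    exact: smooth_coord.
  by apply/funext => z; rewrite mxE.
by move=> sf; exact: (smooth_comp oS (fun z Sz => Sz.1) sl sf).
Qed.

Lemma tsmooth_cst (c : R) : tsmooth U (fun _ _ => c).
Proof. by apply: (@tsmooth_x (fun=> c)); exact: smooth_cst. Qed.

Lemma tsmoothN H : tsmooth U H -> tsmooth U (fun x y => - H x y).
Proof. exact: smoothN. Qed.

Lemma tsmooth_y j : tsmooth U (fun _ y => y 0 j).
Proof.
rewrite /tsmooth (_ : joint _ = fun x : 'rV[R]_(n + n) => x 0 (rshift n j)).
  exact: smooth_coord.
by apply/funext => z; rewrite /joint mxE.
Qed.

Section Rules.
Variables (x y : 'rV[R]_n).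
Hypotheses (Ux : U x) (y0 : y != 0).

Lemma dxD H K k : tsmooth U H -> tsmooth U K ->
  dx k (fun x y => H x y + K x y) x y = dx k H x y + dx k K x y.
Proof.
by move=> sH sK; rewrite !dx_joint [LHS]partialD //; exact: tsmooth_diff.
Qed.

Lemma dyD H K k : tsmooth U H -> tsmooth U K ->
  dy k (fun x y => H x y + K x y) x y = dy k H x y + dy k K x y.
Proof.
by move=> sH sK; rewrite !dy_joint [LHS]partialD //; exact: tsmooth_diff.
Qed.

Lemma dxM H K k : tsmooth U H -> tsmooth U K ->
  dx k (fun x y => H x y * K x y) x y = dx k H x y * K x y + H x y * dx k K x y.
Proof.
move=> sH sK; rewrite !dx_joint -[in RHS](jointE H) -[in RHS](jointE K).
exact: (partialM _ (tsmooth_diff sH Ux y0) (tsmooth_diff sK Ux y0)).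
Qed.

Lemma dyM H K k : tsmooth U H -> tsmooth U K ->
  dy k (fun x y => H x y * K x y) x y = dy k H x y * K x y + H x y * dy k K x y.
Proof.
move=> sH sK; rewrite !dy_joint -[in RHS](jointE H) -[in RHS](jointE K).
exact: (partialM _ (tsmooth_diff sH Ux y0) (tsmooth_diff sK Ux y0)).
Qed.

Lemma dxV H k : H x y != 0 -> tsmooth U H ->
  dx k (fun x y => (H x y)^-1) x y = - (H x y) ^- 2 * dx k H x y.
Proof.
move=> + sH; rewrite !dx_joint -[in RHS](jointE H) -jointE => H0.
exact: (partialV _ H0 (tsmooth_diff sH Ux y0)).
Qed.

Lemma dyV H k : H x y != 0 -> tsmooth U H ->
  dy k (fun x y => (H x y)^-1) x y = - (H x y) ^- 2 * dy k H x y.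
Proof.
move=> + sH; rewrite !dy_joint -[in RHS](jointE H) -jointE => H0.
exact: (partialV _ H0 (tsmooth_diff sH Ux y0)).
Qed.

Lemma dx_sqrt H k : 0 < H x y -> tsmooth U H ->
  dx k (fun x y => Num.sqrt (H x y)) x y = (2 * Num.sqrt (H x y))^-1 * dx k H x y.
Proof.
move=> + sH; rewrite !dx_joint -[in RHS](jointE H) -jointE => H0.
exact: (partial_sqrt _ H0 (tsmooth_diff sH Ux y0)).
Qed.

Lemma dy_sqrt H k : 0 < H x y -> tsmooth U H ->
  dy k (fun x y => Num.sqrt (H x y)) x y = (2 * Num.sqrt (H x y))^-1 * dy k H x y.
Proof.
move=> + sH; rewrite !dy_joint -[in RHS](jointE H) -jointE => H0.
exact: (partial_sqrt _ H0 (tsmooth_diff sH Ux y0)).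
Qed.

Lemma dx_y j k : dx k (fun _ y => y 0 j) x y = 0.
Proof. by rewrite /dx partial_cst. Qed.

Lemma dy_y j k : dy k (fun _ y => y 0 j) x y = (k == j)%:R.
Proof. by rewrite /dy partial_coord. Qed.

Lemma dy_x (f : 'rV[R]_n -> R) k : dy k (fun x _ => f x) x y = 0.
Proof. by rewrite /dy partial_cst. Qed.

Lemma dydy H i j : tsmooth U H -> dy i (dy j H) x y = dy j (dy i H) x y.
Proof.
move=> sH; rewrite !dy_joint !joint_dy; apply: smooth_Schwarz oS sH _.
exact/slit_row_mx.
Qed.

End Rules.
End Over.

(** Pull-back of a function on the tangent bundle by the differential of psi. *)
Definition tpull (psi : 'rV[R]_n -> 'rV[R]_n) H : @tfun R n := fun x y =>
  H (psi x) (\row_m \sum_l partial l (fun x => psi x 0 m) x * y 0 l).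

Section Pull.
Variables (V U : set 'rV[R]_n) (psi : 'rV[R]_n -> 'rV[R]_n).
Hypotheses (oV : open V) (oU : open U) (psiVU : forall x, V x -> U (psi x)).
Hypothesis spsi : smooth_map V psi.

Let J x (y : 'rV[R]_n) : 'rV[R]_n :=
  \row_m \sum_l partial l (fun x => psi x 0 m) x * y 0 l.
Hypothesis J_neq0 : forall x y, V x -> y != 0 -> J x y != 0.

Let Phi (z : 'rV[R]_(n + n)) : 'rV[R]_(n + n) :=
  row_mx (psi (lsubmx z)) (J (lsubmx z) (rsubmx z)).

Let oS := open_slit oV.

Lemma pull_push_smooth j : tsmooth V (fun x y => J x y 0 j).
Proof.
rewrite (_ : (fun x y => _) = (fun x y : 'rV[R]_n =>
    \sum_l partial l (fun x => psi x 0 j) x * y 0 l)); last first.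
  by apply/funext => x; apply/funext => y; rewrite mxE.
rewrite /tsmooth /joint; apply: smooth_sum => // l.
apply: (smoothM oS); last exact: tsmooth_y.
by apply: (@tsmooth_x V oV (partial l (fun x => psi x 0 j))); exact/smooth_partial.
Qed.

Lemma Phi_smooth j : smooth (slit V) (fun z => Phi z 0 j).
Proof.
rewrite /Phi; case: (split_ordP j) => i ->.
  rewrite (_ : (fun z => _) = joint (fun x _ => psi x 0 i)); last first.
    by apply/funext => z; rewrite row_mxEl.
  exact: tsmooth_x.
rewrite (_ : (fun z => _) = joint (fun x y => J x y 0 i)); last first.
  by apply/funext => z; rewrite row_mxEr.
exact: pull_push_smooth.
Qed.

Lemma Phi_slit z : slit V z -> slit U (Phi z).
Proof.
move=> [Vz z0]; rewrite /Phi; apply/slit_row_mx; split; first exact: psiVU.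
exact: J_neq0.
Qed.

Lemma tsmooth_pull H : tsmooth U H -> tsmooth V (tpull psi H).
Proof.
move=> sH; rewrite /tsmooth.
rewrite (_ : joint _ = fun z => joint H (Phi z)); last first.
  by apply/funext => z; rewrite /Phi jointE.
exact: (smooth_comp oS Phi_slit Phi_smooth sH).
Qed.

Lemma partial_pull H i x y : tsmooth U H -> V x -> y != 0 ->
  partial i (joint (tpull psi H)) (row_mx x y) =
  \sum_j partial i (joint (fun x _ => psi x 0 j)) (row_mx x y) * tpull psi (dx j H) x y +
  \sum_j partial i (joint (fun x y => J x y 0 j)) (row_mx x y) * tpull psi (dy j H) x y.
Proof.
move=> sH Vx y0; have S : slit V (row_mx x y) by exact/slit_row_mx.
rewrite (_ : joint _ = fun z => joint H (Phi z)); last first.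
  by apply/funext => z; rewrite /Phi jointE.
rewrite partial_comp; last first.
- by apply: smooth_diff sH _; exact: Phi_slit.
- by move=> j; apply: smooth_diff (Phi_smooth j) S.
rewrite big_split_ord /=; congr (_ + _); apply: eq_bigr => j _; congr (_ * _).
- by congr partial; apply/funext => z; rewrite /Phi row_mxEl.
- by rewrite -joint_dx /Phi jointE row_mxKl row_mxKr.
- by congr partial; apply/funext => z; rewrite /Phi row_mxEr.
- by rewrite -joint_dy /Phi jointE row_mxKl row_mxKr.
Qed.

Lemma dx_pull H i x y : tsmooth U H -> V x -> y != 0 ->
  dx i (tpull psi H) x y =
  \sum_j partial i (fun x => psi x 0 j) x * tpull psi (dx j H) x y +
  \sum_j (\sum_l partial i (partial l (fun x => psi x 0 j)) x * y 0 l)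
     * tpull psi (dy j H) x y.
Proof.
move=> sH Vx y0; rewrite dx_joint partial_pull //.
congr (_ + _); apply: eq_bigr => j _; congr (_ * _); rewrite -dx_joint //.
rewrite /dx; under eq_fun do rewrite mxE.
have dp l : differentiable (partial l (fun x => psi x 0 j)) x.
  by apply: (@smooth_diff _ _ V) => //; exact: smooth_partial.
rewrite /partial -fct_sumE derive_sum => [|l]; last first.
  by apply: diff_derivable; apply: differentiableM (dp l) (differentiable_cst _ _).
apply: eq_bigr => l _.
rewrite [LHS](partialM _ (dp l) (differentiable_cst _ _)) partial_cst.
by rewrite mulr0 addr0.
Qed.

Lemma dy_pull H i x y : tsmooth U H -> V x -> y != 0 ->
  dy i (tpull psi H) x y =
  \sum_j partial i (fun x => psi x 0 j) x * tpull psi (dy j H) x y.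
Proof.
move=> sH Vx y0; rewrite dy_joint partial_pull //.
rewrite big1 ?add0r => [|j _]; last by rewrite -dy_joint dy_x mul0r.
apply: eq_bigr => j _; congr (_ * _); rewrite -dy_joint //.
rewrite /dy; under eq_fun do rewrite mxE.
have dc l : differentiable (fun y : 'rV[R]_n => y 0 l : R) y.
  exact: differentiable_coordf.
rewrite /partial -fct_sumE derive_sum => [|l]; last first.
  by apply: diff_derivable; apply: differentiableM (differentiable_cst _ _) (dc l).
have pl l := partialM i (differentiable_cst (partial l (fun x => psi x 0 j) x) y) (dc l).
rewrite (bigD1 i) //= big1 ?addr0 => [|l li].
  by rewrite [LHS]pl partial_cst mul0r add0r partial_coord eqxx mulr1.
by rewrite [LHS]pl partial_cst mul0r add0r partial_coord eq_sym (negPf li) mulr0.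
Qed.

End Pull.
End Joint.

(** Sealed copies of the partial derivatives: they keep the unifier from
    comparing distinct derivatives by unfolding them to limits. *)
HB.lock Definition pd (R : realType) n (i : 'I_n) (f : 'rV[R]_n -> R) :
  'rV[R]_n -> R := partial i f.
HB.lock Definition Dx (R : realType) n (i : 'I_n) (H : @tfun R n) : @tfun R n :=
  dx i H.
HB.lock Definition Dy (R : realType) n (i : 'I_n) (H : @tfun R n) : @tfun R n :=
  dy i H.

Section Sealed.
Context {R : realType} {n : nat}.
Implicit Types (U V : set 'rV[R]_n) (f g : 'rV[R]_n -> R) (H K : @tfun R n).

Lemma pdE i f : partial i f = pd i f. Proof. by rewrite pd.unlock. Qed.
Lemma DxE i H : dx i H = Dx i H. Proof. by rewrite Dx.unlock. Qed.
Lemma DyE i H : dy i H = Dy i H. Proof. by rewrite Dy.unlock. Qed.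

Lemma smooth_pd U f i : smooth U f -> smooth U (pd i f).
Proof. by rewrite -pdE; exact: smooth_partial. Qed.

Lemma eq_pd U f g i : open U -> (forall x, U x -> f x = g x) ->
  forall x, U x -> pd i f x = pd i g x.
Proof. by rewrite -!pdE; exact: eq_partial. Qed.

Lemma pd_Schwarz U f i j x : open U -> smooth U f -> U x ->
  pd i (pd j f) x = pd j (pd i f) x.
Proof. by rewrite -!pdE; exact: smooth_Schwarz. Qed.

Lemma tsmooth_Dx U k H : tsmooth U H -> tsmooth U (Dx k H).
Proof. by rewrite -DxE; exact: tsmooth_dx. Qed.

Lemma tsmooth_Dy U k H : tsmooth U H -> tsmooth U (Dy k H).
Proof. by rewrite -DyE; exact: tsmooth_dy. Qed.

Lemma Dy_Dy U i j H x y : open U -> U x -> y != 0 -> tsmooth U H ->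
  Dy i (Dy j H) x y = Dy j (Dy i H) x y.
Proof. by move=> oU Ux y0; rewrite Dy.unlock; exact: (dydy oU). Qed.

End Sealed.

(** * Covariance of the Ricci curvature *)


Section Spray.
Context {R : realType}.

Lemma ord2P (P : 'I_2 -> Prop) : P 0 -> P 1 -> forall k, P k.
Proof.
move=> P0 P1 [[|[|k]] hk] //.
- by rewrite (_ : Ordinal hk = 0) //; exact: val_inj.
- by rewrite (_ : Ordinal hk = 1) //; exact: val_inj.
Qed.

Lemma sum2 (V : nmodType) (F : 'I_2 -> V) : \sum_(i < 2) F i = F 0 + F 1.
Proof.
by rewrite !big_ord_recl big_ord0 addr0; congr (F _ + F _); exact: val_inj.
Qed.

(** Proves A = B from the equation l = r: with the multiplier c chosen by hand,
    what remains is an identity of polynomials. *)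
Lemma add_multiple (l r : R) : l = r -> forall c A B : R,
  A + c * (r - l) = B -> A = B.
Proof. by move=> -> c A B; rewrite subrr mulr0 addr0. Qed.

(** The algebra behind covariance: y is a tangent vector, J the Jacobian matrix
    of a change of coordinates, H and T its second and third derivatives, the
    g's and the gt's the values of a spray and of its derivatives in the two
    coordinate systems.  When the transformation laws are substituted, all terms
    with second and third derivatives cancel. *)
Lemma jacobi_endomorphism_change (J gx gtx gy gty : 'I_2 -> 'I_2 -> R)
    (H gxy gtxy gyy gtyy : 'I_2 -> 'I_2 -> 'I_2 -> R)
    (T : 'I_2 -> 'I_2 -> 'I_2 -> 'I_2 -> R) (g gt y : 'I_2 -> R)
    (yt := fun j => \sum_l J j l * y l) :
  (forall m, H m 1 0 = H m 0 1) ->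
  (forall m i j k, T m i j k = T m j i k) ->
  (forall m i j k, T m i j k = T m i k j) ->
  (forall m, \sum_i J m i * gt i =
     g m + 2^-1 * \sum_i \sum_j H m i j * y i * y j) ->
  (forall m k, \sum_i J m i * gty i k =
     \sum_n gy m n * J n k + \sum_i H m i k * y i) ->
  (forall m j k, \sum_i J m i * gtyy i j k =
     \sum_n \sum_p gyy m n p * J n j * J p k + H m j k) ->
  (forall m k, \sum_i H m i k * gt i + \sum_i J m i * gtx i k =
     \sum_n gx m n * J n k + \sum_n gy m n * \sum_l H n l k * y l +
     2^-1 * \sum_i \sum_j T m i j k * y i * y j) ->
  (forall m j k, \sum_i H m i j * gty i k + \sum_i J m i * gtxy i j k =
     \sum_n \sum_p gxy m n p * J n j * J p k +
     \sum_n \sum_p gyy m n p * (\sum_l H n l j * y l) * J p k +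
     \sum_n gy m n * H n k j + \sum_l T m l k j * y l) ->
  forall m k,
  \sum_i J m i * (2 * gtx i k - \sum_j y j * gtxy i j k
     + 2 * \sum_j gt j * gtyy i j k - \sum_j gty i j * gty j k) =
  \sum_n (2 * gx m n - \sum_j yt j * gxy m j n
     + 2 * \sum_j g j * gyy m j n - \sum_j gy m j * gy j n) * J n k.
Proof.
move=> SH ST1 ST2 E0 Ey Eyy Ex Exy m k.
have := E0 0; have := E0 1; have := Ey m 0; have := Ey m 1.
have := Ey 0 k; have := Ey 1 k; have := Eyy m 0 k; have := Eyy m 1 k.
have := Ex m k; have := Exy m 0 k; have := Exy m 1 k.
have S0 := SH 0; have S1 := SH 1; have Sm := SH m.
have t1 := ST1 m 1 0; have t2 i := ST2 m i 1 0.
rewrite /yt !sum2; elim/ord2P: k => /=;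
  rewrite ?(t1 0, t2 0, t1 1, t2 1) ?S0 ?S1 ?Sm;
  move=> e1 e2 e3 e4 e5 e6 e7 e8 e9 e10 e11.
- refine (add_multiple e3 (c := 2) _); refine (add_multiple e2 (c := (- y 0)) _).
  refine (add_multiple e1 (c := (- y 1)) _); refine (add_multiple e5 (c := (2 * gt 0)) _).
  refine (add_multiple e4 (c := (2 * gt 1)) _); refine (add_multiple e9 (c := (- gty 0 0)) _).
  refine (add_multiple e8 (c := (- gty 1 0)) _); refine (add_multiple e7 (c := (- gy m 0)) _).
  refine (add_multiple e6 (c := (- gy m 1)) _).
  refine (add_multiple e11 (c := (2 * (gyy m 0 0 * J 0 0 + gyy m 0 1 * J 1 0))) _).
  refine (add_multiple e10 (c := (2 * (gyy m 1 0 * J 0 0 + gyy m 1 1 * J 1 0))) _).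
  by field.
- refine (add_multiple e3 (c := 2) _); refine (add_multiple e2 (c := (- y 0)) _).
  refine (add_multiple e1 (c := (- y 1)) _); refine (add_multiple e5 (c := (2 * gt 0)) _).
  refine (add_multiple e4 (c := (2 * gt 1)) _); refine (add_multiple e9 (c := (- gty 0 1)) _).
  refine (add_multiple e8 (c := (- gty 1 1)) _); refine (add_multiple e7 (c := (- gy m 0)) _).
  refine (add_multiple e6 (c := (- gy m 1)) _).
  refine (add_multiple e11 (c := (2 * (gyy m 0 0 * J 0 1 + gyy m 0 1 * J 1 1))) _).
  refine (add_multiple e10 (c := (2 * (gyy m 1 0 * J 0 1 + gyy m 1 1 * J 1 1))) _).
  by field.
Qed.

End Spray.

(** * Rules of derivation and geodesic coefficients *)

Section Derivations.
Context {R : realType} {n : nat}.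
Variable U : set 'rV[R]_n.
Hypothesis oU : open U.
Implicit Types (H K : @tfun R n) (d : 'I_n + 'I_n).

Definition tderiv d H : @tfun R n :=
  match d with inl k => Dx k H | inr k => Dy k H end.

(** A relation rather than an equation, so that proof search along the syntax
    of H computes its derivative K. *)
Definition is_tderiv d H K :=
  tsmooth U H /\ forall x y, U x -> y != 0 -> tderiv d H x y = K x y.

Lemma is_tderivD d H K H' K' : is_tderiv d H H' -> is_tderiv d K K' ->
  is_tderiv d (fun x y => H x y + K x y) (fun x y => H' x y + K' x y).
Proof.
move=> [sH dH] [sK dK]; split=> [|x y Ux y0]; first exact: tsmoothD.
rewrite -dH // -dK //; case: d {dH dK} => k /=.
  by rewrite -!DxE; exact: (dxD Ux y0 k sH sK).
by rewrite -!DyE; exact: (dyD Ux y0 k sH sK).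
Qed.

Lemma is_tderivM d H K H' K' : is_tderiv d H H' -> is_tderiv d K K' ->
  is_tderiv d (fun x y => H x y * K x y)
              (fun x y => H' x y * K x y + H x y * K' x y).
Proof.
move=> [sH dH] [sK dK]; split=> [|x y Ux y0]; first exact: tsmoothM.
rewrite -dH // -dK //; case: d {dH dK} => k /=.
  by rewrite -!DxE; exact: (dxM Ux y0 k sH sK).
by rewrite -!DyE; exact: (dyM Ux y0 k sH sK).
Qed.

Lemma is_tderiv_cst d (c : R) : is_tderiv d (fun _ _ => c) (fun _ _ => 0).
Proof.
split=> [|x y _ _]; last first.
  case: d => k /=; first by rewrite -DxE; exact: (partial_cst c k x).
  by rewrite -DyE; exact: (partial_cst c k y).
by apply: (@tsmooth_x _ _ U oU (fun=> c)); exact: smooth_cst.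
Qed.

Lemma is_tderivN d H H' : is_tderiv d H H' ->
  is_tderiv d (fun x y => - H x y) (fun x y => - H' x y).
Proof.
move=> dH; have [sH E] := is_tderivM (is_tderiv_cst d (-1)) dH.
split=> [|x y Ux y0].
  by apply: (tsmooth_eq oU _ sH) => x y _ _; rewrite mulN1r.
have : tderiv d (fun x y => - H x y) x y = tderiv d (fun x y => -1 * H x y) x y.
  by congr (tderiv d _ x y); apply/funext => ?; apply/funext => ?; rewrite mulN1r.
by move=> ->; rewrite E // mul0r add0r mulN1r.
Qed.

Lemma is_tderiv_x d (f : 'rV[R]_n -> R) : smooth U f -> is_tderiv d (fun x _ => f x)
  (match d with inl k => fun x _ => pd k f x | inr _ => fun _ _ => 0 end).
Proof.
move=> sf; split=> [|x y Ux y0]; first exact: tsmooth_x.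
by case: d => k /=; [rewrite -DxE -pdE|rewrite -DyE; exact: dy_x].
Qed.

Lemma is_tderiv_y d j : is_tderiv d (fun _ y => y 0 j)
  (match d with inl k => fun _ _ => 0 | inr k => fun _ _ => (k == j)%:R end).
Proof.
split=> [|x y Ux y0]; first exact: tsmooth_y.
by case: d => k /=; [rewrite -DxE; exact: dx_y|rewrite -DyE; exact: dy_y].
Qed.

Lemma is_tderivV d H H' : (forall x y, U x -> y != 0 -> H x y != 0) ->
  is_tderiv d H H' ->
  is_tderiv d (fun x y => (H x y)^-1) (fun x y => - (H x y) ^- 2 * H' x y).
Proof.
move=> H0 [sH dH]; split=> [|x y Ux y0]; first exact: tsmoothV.
rewrite -dH //; case: d {dH} => k /=.
  by rewrite -!DxE; exact: (dxV Ux y0 k (H0 _ _ Ux y0) sH).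
by rewrite -!DyE; exact: (dyV Ux y0 k (H0 _ _ Ux y0) sH).
Qed.

Lemma is_tderiv_sqrt d H H' : (forall x y, U x -> y != 0 -> 0 < H x y) ->
  is_tderiv d H H' ->
  is_tderiv d (fun x y => Num.sqrt (H x y))
              (fun x y => (2 * Num.sqrt (H x y))^-1 * H' x y).
Proof.
move=> H0 [sH dH]; split=> [|x y Ux y0]; first exact: tsmooth_sqrt.
rewrite -dH //; case: d {dH} => k /=.
  by rewrite -!DxE; exact: (dx_sqrt Ux y0 k (H0 _ _ Ux y0) sH).
by rewrite -!DyE; exact: (dy_sqrt Ux y0 k (H0 _ _ Ux y0) sH).
Qed.

Lemma is_tderiv_Dx k H : tsmooth U H -> is_tderiv (inl k) H (Dx k H).
Proof. by []. Qed.

Lemma is_tderiv_Dy k H : tsmooth U H -> is_tderiv (inr k) H (Dy k H).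
Proof. by []. Qed.

Lemma is_tderiv_eq d H K H' K' : is_tderiv d H H' -> is_tderiv d K K' ->
  (forall x y, U x -> y != 0 -> H x y = K x y) ->
  forall x y, U x -> y != 0 -> H' x y = K' x y.
Proof.
move=> [_ dH] [_ dK] HK x y Ux y0; rewrite -dH // -dK //.
case: d {dH dK} => k /=; first by rewrite -!DxE; exact: (eq_dx oU k HK Ux y0).
by rewrite -!DyE; exact: (eq_dy oU k HK Ux y0).
Qed.

End Derivations.

(** Finds the second argument of [is_tderiv] by recursion on the first; the tactic
    [leaf] treats its atoms. *)
Ltac tderive oU leaf :=
  lazymatch goal with
  | |- is_tderiv _ _ (fun x y => @?H x y + @?K x y) _ =>
      refine (@is_tderivD _ _ _ oU _ H K _ _ _ _); tderive oU leaf
  | |- is_tderiv _ _ (fun x y => @?H x y * @?K x y) _ =>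
      refine (@is_tderivM _ _ _ oU _ H K _ _ _ _); tderive oU leaf
  | |- is_tderiv _ _ (fun x y => - (@?H x y)) _ =>
      refine (@is_tderivN _ _ _ oU _ H _ _); tderive oU leaf
  | |- is_tderiv _ _ (fun _ y => fun_of_matrix y _ ?j) _ => exact: is_tderiv_y
  | |- is_tderiv _ _ (fun _ _ => ?c) _ => exact: (is_tderiv_cst oU)
  | |- _ => leaf
  end.

Section Metric.
Context {R : realType}.
Implicit Types (U V : set 'rV[R]_2) (F : @tfun R 2).

(** The part of the definition of a Finsler metric on which the curvature
    depends. *)
Definition regular_metric U F := tsmooth U (sqF F) /\
  forall x y, U x -> y != 0 -> \det (fundamental_tensor F x y) != 0.

(** Four times the lowered geodesic coefficients, that is, the right-hand side of
    the linear system that they solve. *)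
Definition spray_rhs F l : @tfun R 2 := fun x y =>
  (\sum_k Dy l (Dx k (sqF F)) x y * y 0 k) - Dx l (sqF F) x y.

Lemma fundamental_tensorE F x y i j :
  fundamental_tensor F x y i j = 2^-1 * Dy j (Dy i (sqF F)) x y.
Proof. by rewrite mxE !DyE. Qed.

Lemma geodesic_coeffE F i x y : geodesic_coeff F i x y =
  4^-1 * \sum_l invmx (fundamental_tensor F x y) i l * spray_rhs F l x y.
Proof.
rewrite /geodesic_coeff; congr (_ * _); apply: eq_bigr => l _.
rewrite /spray_rhs DxE; congr (_ * (_ - _)); apply: eq_bigr => k _.
by rewrite DxE DyE.
Qed.

Lemma riemann_curvatureE F i k x y (G := geodesic_coeff F) :
  riemann_curvature F i k x y =
  2 * Dx k (G i) x y - \sum_j y 0 j * Dy k (Dx j (G i)) x y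
  + 2 * \sum_j G j x y * Dy k (Dy j (G i)) x y
  - \sum_j Dy j (G i) x y * Dy k (G j) x y.
Proof.
rewrite /riemann_curvature DxE; congr (_ - _ + 2 * _ - _); apply: eq_bigr => j _.
- by rewrite DyE DxE.
- by rewrite !DyE.
- by rewrite !DyE.
Qed.

Lemma det2 (A : 'M[R]_2) : \det A = A 0 0 * A 1 1 - A 0 1 * A 1 0.
Proof.
rewrite (expand_det_row _ 0) sum2 /cofactor !det_mx11 !mxE /= !add0n expr0 expr1.
rewrite mul1r mulN1r mulrN; congr (_ * A _ _ - _ * A _ _); exact: val_inj.
Qed.

Lemma unitmx2 (A : 'M[R]_2) : (A \in unitmx) = (\det A != 0).
Proof. by rewrite unitmxE unitfE. Qed.

Lemma geodesic_eqn U F x y l : regular_metric U F -> U x -> y != 0 ->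
  \sum_i fundamental_tensor F x y l i * geodesic_coeff F i x y =
  4^-1 * spray_rhs F l x y.
Proof.
move=> [_ g0] Ux y0; have gU : fundamental_tensor F x y \in unitmx.
  by rewrite unitmx2; exact: g0.
pose e : 'cV[R]_2 := \col_l spray_rhs F l x y.
have Ge i : geodesic_coeff F i x y = 4^-1 * (invmx (fundamental_tensor F x y) *m e) i 0.
  by rewrite geodesic_coeffE !mxE; congr (_ * _); apply: eq_bigr => j _; rewrite mxE.
under eq_bigr do rewrite Ge mulrCA.
rewrite -mulr_sumr; congr (_ * _).
have := mulKVmx gU e; move/(congr1 (fun M : 'cV_2 => M l 0)).
by rewrite mxE [RHS]mxE => <-.
Qed.

(** Explicit geodesic coefficients are obtained by guessing them and checking the
    linear system, which avoids inverting the fundamental tensor. *)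
Lemma geodesic_unique U F x y (Z : 'I_2 -> R) : regular_metric U F -> U x -> y != 0 ->
  (forall l, \sum_i fundamental_tensor F x y l i * Z i = 4^-1 * spray_rhs F l x y) ->
  forall i, geodesic_coeff F i x y = Z i.
Proof.
move=> rF Ux y0 ZE i; have gU : fundamental_tensor F x y \in unitmx.
  by rewrite unitmx2; exact: rF.2.
pose w : 'cV[R]_2 := \col_i geodesic_coeff F i x y.
pose z : 'cV[R]_2 := \col_i Z i.
suff : w = z by move/colP/(_ i); rewrite !mxE.
rewrite -(mulKmx gU w) -(mulKmx gU z); congr (_ *m _); apply/colP => l.
rewrite !mxE; under eq_bigr do rewrite !mxE -/(fundamental_tensor F x y l _).
under [RHS]eq_bigr do rewrite !mxE -/(fundamental_tensor F x y l _).
have := geodesic_eqn l rF Ux y0; have := ZE l; rewrite !sum2 !mxE => -> ->.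
by [].
Qed.

End Metric.

(** * Pull-back of the Ricci curvature *)

Ltac tsmoothness oU leaf :=
  lazymatch goal with
  | |- tsmooth _ (fun x y => @?H x y + @?K x y) =>
      refine (@tsmoothD _ _ _ oU H K _ _); tsmoothness oU leaf
  | |- tsmooth _ (fun x y => @?H x y * @?K x y) =>
      refine (@tsmoothM _ _ _ oU H K _ _); tsmoothness oU leaf
  | |- tsmooth _ (fun x y => - (@?H x y)) =>
      refine (@tsmoothN _ _ _ oU H _); tsmoothness oU leaf
  | |- tsmooth _ (fun _ y => fun_of_matrix y _ ?j) => exact: (@tsmooth_y _ _ _ j)
  | |- tsmooth _ (fun x y => Dx ?k ?H x y) =>
      refine (@tsmooth_Dx _ _ _ k H _); tsmoothness oU leaf
  | |- tsmooth _ (fun x y => Dy ?k ?H x y) =>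
      refine (@tsmooth_Dy _ _ _ k H _); tsmoothness oU leaf
  | |- tsmooth _ (Dx ?k ?H) =>
      refine (@tsmooth_Dx _ _ _ k H _); tsmoothness oU leaf
  | |- tsmooth _ (Dy ?k ?H) =>
      refine (@tsmooth_Dy _ _ _ k H _); tsmoothness oU leaf
  | |- tsmooth _ (fun _ _ => ?c) =>
      exact: (@tsmooth_cst _ _ _ oU c)
  | |- _ => leaf
  end.

Section GeodesicSmooth.
Context {R : realType}.
Variables (U : set 'rV[R]_2) (F : @tfun R 2).
Hypotheses (oU : open U) (rF : regular_metric U F).
Let g i j : @tfun R 2 := fun x y => fundamental_tensor F x y i j.
Let dg : @tfun R 2 := fun x y => g 0 0 x y * g 1 1 x y - g 0 1 x y * g 1 0 x y.
Let E l := spray_rhs F l.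

Lemma tsmooth_fundamental_tensor i j : tsmooth U (g i j).
Proof.
apply: (tsmooth_eq oU (H := fun x y => 2^-1 * Dy j (Dy i (sqF F)) x y)).
  by move=> x y _ _; rewrite /g fundamental_tensorE.
by tsmoothness oU ltac:(exact: rF.1).
Qed.

Lemma tsmooth_spray_rhs l : tsmooth U (E l).
Proof.
have sL := rF.1; apply: (tsmooth_eq oU (H := fun x y =>
    (Dy l (Dx 0 (sqF F)) x y * y 0 0 + Dy l (Dx 1 (sqF F)) x y * y 0 1)
    - Dx l (sqF F) x y)).
  by move=> x y _ _; rewrite /E /spray_rhs sum2.
by tsmoothness oU ltac:(exact: sL).
Qed.

Lemma geodesic_cramer x y : U x -> y != 0 ->
  geodesic_coeff F 0 x y =
    (g 1 1 x y * E 0 x y - g 0 1 x y * E 1 x y) / (4 * dg x y) /\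
  geodesic_coeff F 1 x y =
    (g 0 0 x y * E 1 x y - g 1 0 x y * E 0 x y) / (4 * dg x y).
Proof.
move=> Ux y0; have d0 : dg x y != 0.
  by have := rF.2 x y Ux y0; rewrite det2.
pose Z (i : 'I_2) : R := if i == 0 then
  (g 1 1 x y * E 0 x y - g 0 1 x y * E 1 x y) / (4 * dg x y) else
  (g 0 0 x y * E 1 x y - g 1 0 x y * E 0 x y) / (4 * dg x y).
suff GZ : forall i, geodesic_coeff F i x y = Z i by rewrite !GZ.
apply: (geodesic_unique rF Ux y0) => l.
rewrite sum2 /Z /= -/(g l 0 x y) -/(g l 1 x y) -/(E l x y).
move: d0; rewrite /dg.
elim/ord2P: l; move: (g 0 0 x y) (g 0 1 x y) (g 1 0 x y) (g 1 1 x y) (E 0 x y) (E 1 x y);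
  by move=> *; field.
Qed.

Lemma tsmooth_geodesic_coeff i : tsmooth U (geodesic_coeff F i).
Proof.
have s4 : tsmooth U (fun x y => (4 * dg x y)^-1).
  apply: (tsmoothV oU (H := fun x y => 4 * dg x y)) => [x y Ux y0|].
    by rewrite mulf_neq0 //; have := rF.2 x y Ux y0; rewrite det2.
  by rewrite /dg; tsmoothness oU ltac:(exact: tsmooth_fundamental_tensor).
elim/ord2P: i.
  apply: (tsmooth_eq oU (H := fun x y =>
    (g 1 1 x y * E 0 x y - g 0 1 x y * E 1 x y) * (4 * dg x y)^-1)).
    by move=> x y Ux y0; have [-> _] := geodesic_cramer Ux y0.
  by tsmoothness oU ltac:(idtac; lazymatch goal with
    | |- tsmooth _ (fun x y => g _ _ x y) => exact: tsmooth_fundamental_tensor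
    | |- tsmooth _ (fun x y => E _ x y) => exact: tsmooth_spray_rhs
    | |- _ => exact: s4
    end).
apply: (tsmooth_eq oU (H := fun x y =>
  (g 0 0 x y * E 1 x y - g 1 0 x y * E 0 x y) * (4 * dg x y)^-1)).
  by move=> x y Ux y0; have [_ ->] := geodesic_cramer Ux y0.
by tsmoothness oU ltac:(idtac; lazymatch goal with
    | |- tsmooth _ (fun x y => g _ _ x y) => exact: tsmooth_fundamental_tensor
    | |- tsmooth _ (fun x y => E _ x y) => exact: tsmooth_spray_rhs
    | |- _ => exact: s4
    end).
Qed.

End GeodesicSmooth.

Section PullMetric.
Context {R : realType}.

(** The Euler-Lagrange equations transform like a covector, up to the second
    derivatives H of the change of coordinates. *)
Lemma spray_change (J Lyy Lxy : 'I_2 -> 'I_2 -> R) (H : 'I_2 -> 'I_2 -> 'I_2 -> R)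
    (G y Ly Lx Z : 'I_2 -> R)
    (q := fun m => \sum_i \sum_j H m i j * y i * y j)
    (yt := fun j => \sum_l J j l * y l) :
  (forall m, H m 1 0 = H m 0 1) -> Lyy 1 0 = Lyy 0 1 ->
  (forall m, \sum_k 2^-1 * Lyy m k * G k = 4^-1 * ((\sum_k Lxy m k * yt k) - Lx m)) ->
  (forall m, \sum_i J m i * Z i = G m + 2^-1 * q m) ->
  forall l,
  \sum_i 2^-1 * (\sum_m \sum_k J m l * J k i * Lyy m k) * Z i =
  4^-1 * ((\sum_k (\sum_m \sum_n J m k * J n l * Lxy n m
                   + \sum_m \sum_n (\sum_j H m j k * y j) * J n l * Lyy m n
                   + \sum_m H m k l * Ly m) * y k)
    - (\sum_m J m l * Lx m + \sum_m (\sum_j H m j l * y j) * Ly m)).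
Proof.
move=> SH SL GE JZ l.
have := GE 0; have := GE 1; have := JZ 0; have := JZ 1.
have S0 := SH 0; have S1 := SH 1.
rewrite /q /yt !sum2; elim/ord2P: l => /=; rewrite ?S0 ?S1 ?SL => e1 e2 e3 e4.
- refine (add_multiple e4 (c := J 0 0) _); refine (add_multiple e3 (c := J 1 0) _).
  refine (add_multiple e2 (c := 2^-1 * (J 0 0 * Lyy 0 0 + J 1 0 * Lyy 0 1)) _).
  refine (add_multiple e1 (c := 2^-1 * (J 0 0 * Lyy 0 1 + J 1 0 * Lyy 1 1)) _).
  by field.
- refine (add_multiple e4 (c := J 0 1) _); refine (add_multiple e3 (c := J 1 1) _).
  refine (add_multiple e2 (c := 2^-1 * (J 0 1 * Lyy 0 0 + J 1 1 * Lyy 0 1)) _).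
  refine (add_multiple e1 (c := 2^-1 * (J 0 1 * Lyy 0 1 + J 1 1 * Lyy 1 1)) _).
  by field.
Qed.

Lemma trace_change (J A B : 'I_2 -> 'I_2 -> R) :
  J 0 0 * J 1 1 - J 0 1 * J 1 0 != 0 ->
  (forall m k, \sum_i J m i * A i k = \sum_n B m n * J n k) ->
  \sum_k A k k = \sum_k B k k.
Proof.
move=> d0 JA; apply: (mulfI d0); rewrite !sum2.
have := JA 0 0; have := JA 0 1; have := JA 1 0; have := JA 1 1.
rewrite !sum2 => e11 e10 e01 e00.
refine (add_multiple e00 (c := J 1 1) _); refine (add_multiple e10 (c := - J 0 1) _).
refine (add_multiple e01 (c := - J 1 0) _); refine (add_multiple e11 (c := J 0 0) _).
by ring.
Qed.

Variables (V U : set 'rV[R]_2) (psi : 'rV[R]_2 -> 'rV[R]_2).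
Hypotheses (oV : open V) (oU : open U) (psiVU : forall x, V x -> U (psi x)).
Hypothesis spsi : smooth_map V psi.
Let p m l := pd l (fun x => psi x 0 m).
Hypothesis psi_det : forall x, V x -> p 0 0 x * p 1 1 x - p 0 1 x * p 1 0 x != 0.

Let pp m i l := pd l (p m i).
Let ppp m i j k := pd k (pp m i j).
Let J x (y : 'rV[R]_2) : 'rV[R]_2 :=
  \row_m \sum_l partial l (fun x => psi x 0 m) x * y 0 l.

Lemma pull_push_neq0 x y : V x -> y != 0 -> J x y != 0.
Proof.
move=> Vx; apply: contra => /eqP/rowP Jy0; have d0 := psi_det Vx.
have Jy m : \sum_l p m l x * y 0 l = 0.
  have := Jy0 m; rewrite !mxE => Jm; rewrite -[RHS]Jm.
  by apply: eq_bigr => l _; rewrite pdE.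
have := Jy 0; have := Jy 1; rewrite !sum2 => e1 e0.
have y0 : y 0 0 = 0.
  apply: (mulfI d0); rewrite mulr0.
  refine (add_multiple e0 (c := p 1 1 x) _).
  refine (add_multiple e1 (c := - p 0 1 x) _); ring.
have y1 : y 0 1 = 0.
  apply: (mulfI d0); rewrite mulr0.
  refine (add_multiple e0 (c := - p 1 0 x) _).
  refine (add_multiple e1 (c := p 0 0 x) _); ring.
by apply/eqP/rowP; elim/ord2P; rewrite mxE.
Qed.

Let sp m l : smooth V (p m l). Proof. exact: smooth_pd. Qed.
Let spp m i l : smooth V (pp m i l). Proof. exact: smooth_pd. Qed.

Lemma pp_sym m i j x : V x -> pp m i j x = pp m j i x.
Proof. exact: (pd_Schwarz _ _ oV (spsi m)). Qed.

Lemma ppp_sym m i j k x : V x -> ppp m i j k x = ppp m j i k x.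
Proof. by move=> Vx; apply: (eq_pd k oV _ Vx) => z Vz; exact: pp_sym. Qed.

Lemma ppp_sym2 m i j k x : V x -> ppp m i j k x = ppp m i k j x.
Proof. exact: (pd_Schwarz _ _ oV (sp m i)). Qed.

Lemma is_tderiv_pull_x i H : tsmooth U H -> is_tderiv V (inl i) (tpull psi H)
  (fun x y => (p 0 i x * tpull psi (Dx 0 H) x y + p 1 i x * tpull psi (Dx 1 H) x y)
    + ((pp 0 0 i x * y 0 0 + pp 0 1 i x * y 0 1) * tpull psi (Dy 0 H) x y
    + (pp 1 0 i x * y 0 0 + pp 1 1 i x * y 0 1) * tpull psi (Dy 1 H) x y)).
Proof.
move=> sH; split=> [|x y Vx y0].
  exact: (tsmooth_pull oV psiVU spsi pull_push_neq0).
rewrite /= -DxE [LHS](dx_pull oV psiVU spsi pull_push_neq0 _ sH) //.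
transitivity (\sum_j p j i x * tpull psi (Dx j H) x y
  + \sum_j (\sum_l pp j l i x * y 0 l) * tpull psi (Dy j H) x y).
  congr (_ + _); apply: eq_bigr => j _; first by rewrite pdE DxE.
  rewrite DyE; congr (_ * _); apply: eq_bigr => l _; by rewrite !pdE.
by rewrite !sum2.
Qed.

Lemma is_tderiv_pull_y i H : tsmooth U H -> is_tderiv V (inr i) (tpull psi H)
  (fun x y => p 0 i x * tpull psi (Dy 0 H) x y + p 1 i x * tpull psi (Dy 1 H) x y).
Proof.
move=> sH; split=> [|x y Vx y0].
  exact: (tsmooth_pull oV psiVU spsi pull_push_neq0).
rewrite /= -DyE [LHS](dy_pull oV psiVU spsi pull_push_neq0 _ sH) //.
transitivity (\sum_j p j i x * tpull psi (Dy j H) x y).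
  by apply: eq_bigr => j _; rewrite pdE DyE.
by rewrite !sum2.
Qed.

Ltac pull_leaf tac :=
  lazymatch goal with
  | |- is_tderiv _ (inl ?i) (fun x y => tpull psi ?H x y) _ =>
      refine (@is_tderiv_pull_x i H _); tsmoothness oU tac
  | |- is_tderiv _ (inr ?i) (fun x y => tpull psi ?H x y) _ =>
      refine (@is_tderiv_pull_y i H _); tsmoothness oU tac
  | |- is_tderiv _ _ (fun x _ => p ?m ?l x) _ =>
      exact: (is_tderiv_x oV _ (sp m l))
  | |- is_tderiv _ _ (fun x _ => pp ?m ?i ?l x) _ =>
      exact: (is_tderiv_x oV _ (spp m i l))
  | |- is_tderiv _ _ (fun x _ => ppp ?m ?i ?l ?k x) _ =>
      exact: (is_tderiv_x oV _ (smooth_pd k (spp m i l)))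
  end.

(** Turns the goal A = B, where A is the derivative stated by [dA] of the left
    side of the equation E, into D = B for the derivative D of its right side. *)
Ltac differentiate dA E Vx y0 tac :=
  refine (etrans (is_tderiv_eq oV dA (_ : is_tderiv V _ _ ?[D]) E Vx y0) _);
  [tderive oV ltac:(idtac; pull_leaf tac) | rewrite /=].

Section Geodesics.
Variable F : @tfun R 2.
Hypothesis rF : regular_metric U F.
Let L := sqF F.
Let Lt : @tfun R 2 := sqF (tpull psi F).
Let sL : tsmooth U L := rF.1.

Let sLt : tsmooth V Lt.
Proof. exact: (tsmooth_pull oV psiVU spsi pull_push_neq0 sL). Qed.

Let Lt_y i x y : V x -> y != 0 ->
  Dy i Lt x y = p 0 i x * tpull psi (Dy 0 L) x y + p 1 i x * tpull psi (Dy 1 L) x y.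
Proof. exact: (is_tderiv_pull_y i sL).2. Qed.

Let Lt_x i x y : V x -> y != 0 -> Dx i Lt x y =
  (p 0 i x * tpull psi (Dx 0 L) x y + p 1 i x * tpull psi (Dx 1 L) x y)
    + ((pp 0 0 i x * y 0 0 + pp 0 1 i x * y 0 1) * tpull psi (Dy 0 L) x y
    + (pp 1 0 i x * y 0 0 + pp 1 1 i x * y 0 1) * tpull psi (Dy 1 L) x y).
Proof. exact: (is_tderiv_pull_x i sL).2. Qed.

Let Lt_yy i j x y : V x -> y != 0 -> Dy j (Dy i Lt) x y =
  \sum_m \sum_k p m i x * p k j x * tpull psi (Dy k (Dy m L)) x y.
Proof.
move=> Vx y0; rewrite !sum2.
differentiate (is_tderiv_Dy j (tsmooth_Dy i sLt)) (Lt_y i) Vx y0 ltac:(exact: sL).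
by ring.
Qed.

Let Lt_xy k l x y : V x -> y != 0 -> Dy l (Dx k Lt) x y =
  \sum_m \sum_n p m k x * p n l x * tpull psi (Dy n (Dx m L)) x y
  + \sum_m \sum_n (\sum_j pp m j k x * y 0 j) * p n l x *
      tpull psi (Dy n (Dy m L)) x y
  + \sum_m pp m k l x * tpull psi (Dy m L) x y.
Proof.
move=> Vx y0; rewrite !sum2.
differentiate (is_tderiv_Dy l (tsmooth_Dx k sLt)) (Lt_x k) Vx y0 ltac:(exact: sL).
rewrite (pp_sym 0 k l Vx) (pp_sym 1 k l Vx).
by elim/ord2P: l => /=; ring.
Qed.

Let ft_pull i j x y : V x -> y != 0 -> fundamental_tensor (tpull psi F) x y i j =
  2^-1 * \sum_m \sum_k p m i x * p k j x * tpull psi (Dy k (Dy m L)) x y.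
Proof. by move=> Vx y0; rewrite fundamental_tensorE Lt_yy. Qed.

Lemma regular_pull : regular_metric V (tpull psi F).
Proof.
split=> // x y Vx y0; rewrite det2 !ft_pull // !sum2.
have := rF.2 (psi x) (J x y) (psiVU Vx) (pull_push_neq0 Vx y0).
rewrite det2 !fundamental_tensorE => g0.
set A := (X in X != 0); suff -> : A = (p 0 0 x * p 1 1 x - p 0 1 x * p 1 0 x) ^+ 2 *
    (2^-1 * tpull psi (Dy 0 (Dy 0 L)) x y * (2^-1 * tpull psi (Dy 1 (Dy 1 L)) x y) -
     2^-1 * tpull psi (Dy 1 (Dy 0 L)) x y * (2^-1 * tpull psi (Dy 0 (Dy 1 L)) x y)).
  by rewrite mulf_neq0 // expf_neq0 // psi_det.
by rewrite /A; ring.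
Qed.

Let Gt := geodesic_coeff (tpull psi F).
Let G := geodesic_coeff F.

(** The geodesic coefficients of the pull-back are determined by their linear
    system, so it is enough that the expected values, Z, solve it; this is
    [spray_change]. *)
Lemma geodesic_pull m x y : V x -> y != 0 ->
  p m 0 x * Gt 0 x y + p m 1 x * Gt 1 x y =
  tpull psi (G m) x y + 2^-1 * (pp m 0 0 x * y 0 0 * y 0 0 +
    pp m 0 1 x * y 0 0 * y 0 1 + (pp m 1 0 x * y 0 1 * y 0 0 + pp m 1 1 x * y 0 1 * y 0 1)).
Proof.
move=> Vx y0; have d0 := psi_det Vx.
pose w m := tpull psi (G m) x y + 2^-1 * \sum_i \sum_j pp m i j x * y 0 i * y 0 j.
pose d := p 0 0 x * p 1 1 x - p 0 1 x * p 1 0 x.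
pose Z (i : 'I_2) := if i == 0 then (p 1 1 x * w 0 - p 0 1 x * w 1) / d
                     else (p 0 0 x * w 1 - p 1 0 x * w 0) / d.
have JZ k : \sum_i p k i x * Z i = w k.
  rewrite sum2 /Z /=; move: d0; rewrite /d; elim/ord2P: k;
  move: (p 0 0 x) (p 0 1 x) (p 1 0 x) (p 1 1 x) (w 0) (w 1); by move=> *; field.
have GZ i : Gt i x y = Z i.
  apply: (geodesic_unique regular_pull Vx y0) => {}m.
  rewrite (eq_bigr (fun i => 2^-1 * (\sum_m0 \sum_k p m0 m x * p k i x *
    tpull psi (Dy k (Dy m0 L)) x y) * Z i)); last by move=> j _; rewrite ft_pull.
  rewrite (@spray_change (fun m l => p m l x)
    (fun m n => tpull psi (Dy n (Dy m L)) x y) (fun n m => tpull psi (Dy n (Dx m L)) x y)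
    (fun m i j => pp m i j x) (fun m => tpull psi (G m) x y) (fun l => y 0 l)
    (fun m => tpull psi (Dy m L) x y) (fun m => tpull psi (Dx m L) x y) Z) //.
  - rewrite /spray_rhs Lt_x // !sum2 !Lt_xy // !sum2; by congr (_ * (_ - _)); rewrite ?sum2.
  - by move=> k; rewrite pp_sym.
  - exact: (Dy_Dy _ _ oU (psiVU Vx) (pull_push_neq0 Vx y0) sL).
  - move=> k; have := geodesic_eqn k rF (psiVU Vx) (pull_push_neq0 Vx y0).
    under eq_bigr do rewrite fundamental_tensorE.
    move=> ->; rewrite /spray_rhs; congr (_ * (_ - _)).
    apply: eq_bigr => j _; congr (_ * _); rewrite mxE.
    by apply: eq_bigr => l _; rewrite pdE.
have := JZ m; rewrite /w !sum2 !GZ //.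
Qed.

Let sG m : tsmooth U (G m) := tsmooth_geodesic_coeff oU rF m.
Let sGt m : tsmooth V (Gt m) := tsmooth_geodesic_coeff oV regular_pull m.

Ltac spray_leaf :=
  lazymatch goal with
  | |- is_tderiv _ (inl ?k) (fun x y => Gt ?m x y) _ =>
      exact: (is_tderiv_Dx k (sGt m))
  | |- is_tderiv _ (inr ?k) (fun x y => Gt ?m x y) _ =>
      exact: (is_tderiv_Dy k (sGt m))
  | |- is_tderiv _ (inr ?k) (fun x y => Dy ?j (Gt ?m) x y) _ =>
      exact: (is_tderiv_Dy k (tsmooth_Dy j (sGt m)))
  | |- is_tderiv _ (inr ?k) (fun x y => Dx ?j (Gt ?m) x y) _ =>
      exact: (is_tderiv_Dy k (tsmooth_Dx j (sGt m)))
  | |- _ => pull_leaf ltac:(exact: sG)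
  end.

Ltac differentiate_spray d E Vx y0 :=
  refine (etrans _ (etrans (is_tderiv_eq oV (_ : is_tderiv V d _ ?[A])
    (_ : is_tderiv V d _ ?[B]) E Vx y0) _));
  [| tderive oV ltac:(idtac; spray_leaf) | tderive oV ltac:(idtac; spray_leaf) |];
  rewrite /=.

Let Gt_y m k x y : V x -> y != 0 ->
  p m 0 x * Dy k (Gt 0) x y + p m 1 x * Dy k (Gt 1) x y =
  (tpull psi (Dy 0 (G m)) x y * p 0 k x + tpull psi (Dy 1 (G m)) x y * p 1 k x)
  + (pp m 0 k x * y 0 0 + pp m 1 k x * y 0 1).
Proof.
move=> Vx y0; differentiate_spray (inr k : 'I_2 + 'I_2) (geodesic_pull m) Vx y0.
  by ring.
by elim/ord2P: k => /=; rewrite (pp_sym m 1 0 Vx); field.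
Qed.

Let Gt_yy m j k x y : V x -> y != 0 ->
  p m 0 x * Dy k (Dy j (Gt 0)) x y + p m 1 x * Dy k (Dy j (Gt 1)) x y =
  \sum_n \sum_q tpull psi (Dy q (Dy n (G m))) x y * p n j x * p q k x + pp m j k x.
Proof.
move=> Vx y0; rewrite !sum2.
differentiate_spray (inr k : 'I_2 + 'I_2) (fun x y => @Gt_y m j x y) Vx y0.
  by ring.
by elim/ord2P: k => /=; rewrite (pp_sym m j _ Vx); ring.
Qed.

Let Gt_x m k x y : V x -> y != 0 ->
  (pp m 0 k x * Gt 0 x y + pp m 1 k x * Gt 1 x y)
  + (p m 0 x * Dx k (Gt 0) x y + p m 1 x * Dx k (Gt 1) x y) =
  (tpull psi (Dx 0 (G m)) x y * p 0 k x + tpull psi (Dx 1 (G m)) x y * p 1 k x)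
  + (tpull psi (Dy 0 (G m)) x y * (pp 0 0 k x * y 0 0 + pp 0 1 k x * y 0 1)
    + tpull psi (Dy 1 (G m)) x y * (pp 1 0 k x * y 0 0 + pp 1 1 k x * y 0 1))
  + 2^-1 * ((ppp m 0 0 k x * y 0 0 * y 0 0 + ppp m 0 1 k x * y 0 0 * y 0 1)
    + (ppp m 1 0 k x * y 0 1 * y 0 0 + ppp m 1 1 k x * y 0 1 * y 0 1)).
Proof.
move=> Vx y0; differentiate_spray (inl k : 'I_2 + 'I_2) (geodesic_pull m) Vx y0.
  by rewrite -/(pp m 0 k) -/(pp m 1 k); ring.
rewrite -/(ppp m 0 0 k) -/(ppp m 0 1 k) -/(ppp m 1 0 k) -/(ppp m 1 1 k).
by ring.
Qed.

Let Gt_xy m j k x y : V x -> y != 0 ->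
  (pp m 0 j x * Dy k (Gt 0) x y + pp m 1 j x * Dy k (Gt 1) x y)
  + (p m 0 x * Dy k (Dx j (Gt 0)) x y + p m 1 x * Dy k (Dx j (Gt 1)) x y) =
  \sum_n \sum_q tpull psi (Dy q (Dx n (G m))) x y * p n j x * p q k x
  + \sum_n \sum_q tpull psi (Dy q (Dy n (G m))) x y *
      (\sum_l pp n l j x * y 0 l) * p q k x
  + \sum_n tpull psi (Dy n (G m)) x y * pp n k j x
  + \sum_l ppp m l k j x * y 0 l.
Proof.
move=> Vx y0; rewrite !sum2.
differentiate_spray (inr k : 'I_2 + 'I_2) (fun x y => @Gt_x m j x y) Vx y0.
  by ring.
elim/ord2P: k => /=; rewrite (ppp_sym m 1 0 j Vx); by field.
Qed.

(** Differentiating [geodesic_pull] in x and y gives the transformation laws of the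
    derivatives of the geodesic coefficients, to which
    [jacobi_endomorphism_change] applies. *)
Lemma riemann_pull m k x y : V x -> y != 0 ->
  \sum_i p m i x * riemann_curvature (tpull psi F) i k x y =
  \sum_n tpull psi (riemann_curvature F m n) x y * p n k x.
Proof.
move=> Vx y0; under eq_bigr do rewrite riemann_curvatureE.
rewrite /tpull; under [RHS]eq_bigr do rewrite riemann_curvatureE.
rewrite (@jacobi_endomorphism_change R (fun m l => p m l x)
  (fun m n => tpull psi (Dx n (G m)) x y) (fun m n => Dx n (Gt m) x y)
  (fun m n => tpull psi (Dy n (G m)) x y) (fun m n => Dy n (Gt m) x y)
  (fun m i j => pp m i j x)
  (fun m n q => tpull psi (Dy q (Dx n (G m))) x y) (fun m n q => Dy q (Dx n (Gt m)) x y)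
  (fun m n q => tpull psi (Dy q (Dy n (G m))) x y) (fun m n q => Dy q (Dy n (Gt m)) x y)
  (fun m i j k => ppp m i j k x)
  (fun m => tpull psi (G m) x y) (fun m => Gt m x y) (fun l => y 0 l)).
- apply: eq_bigr => n _; congr ((_ - _ + _ - _) * _).
  apply: eq_bigr => j _; congr (_ * _); rewrite mxE.
  by apply: eq_bigr => l _; rewrite pdE.
- by move=> {}m; exact: pp_sym.
- by move=> {}m i j l; exact: ppp_sym.
- by move=> {}m i j l; exact: ppp_sym2.
- by move=> {}m; rewrite !sum2; exact: geodesic_pull.
- by move=> {}m {}k; rewrite !sum2; exact: Gt_y.
- by move=> {}m j {}k; rewrite [LHS]sum2; exact: Gt_yy.
- by move=> {}m {}k; rewrite !sum2; exact: Gt_x.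
- by move=> {}m j {}k; rewrite ![in LHS]sum2; exact: Gt_xy.
Qed.

Theorem ricci_pull x y : V x -> y != 0 ->
  ricci (tpull psi F) x y = tpull psi (ricci F) x y.
Proof.
move=> Vx y0.
exact: (@trace_change (fun m l => p m l x)
  (fun i k => riemann_curvature (tpull psi F) i k x y)
  (fun i k => tpull psi (riemann_curvature F i k) x y) (psi_det Vx)
  (fun m k => riemann_pull m k Vx y0)).
Qed.

End Geodesics.

End PullMetric.

(** * Square-root metrics *)

Section PoleAlgebra.
Context {R : realType}.
Variables (P : 'I_2 -> R) (Px Py : 'I_2 -> 'I_2 -> R)
  (Pxy Pyy : 'I_2 -> 'I_2 -> 'I_2 -> R) (d : R) (dx dy : 'I_2 -> R)
  (dxy dyy : 'I_2 -> 'I_2 -> R) (y : 'I_2 -> R).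

(** First and second derivatives of the quotient P/d. *)
Definition quot1 (p px dx : R) := px * d^-1 - p * (d^-1 * d^-1 * dx).
Definition quot2 (p px py pxy dx dy dxy : R) :=
  pxy * d^-1 - px * (d^-1 * d^-1 * dy)
  - (py * (d^-1 * d^-1 * dx) + p * (d^-1 * d^-1 * dxy
       - 2 * (d^-1 * d^-1 * d^-1 * dx * dy))).

Definition pole_rest : R :=
  \sum_k (2 * (Px k k * d - P k * dx k) * d
    - \sum_j y j * (Pxy k j k * d ^+ 2
        - (Px k j * dy k + Py k k * dx j + P k * dxy j k) * d + 2 * P k * dx j * dy k)
    + 2 * \sum_j P j * (Pyy k j k * d - (Py k j * dy k + Py k k * dy j + P k * dyy j k))
    - \sum_j (Py k j * Py j k * d - Py k j * P j * dy k - P k * dy j * Py j k)).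

(** P stands for numerators of the geodesic coefficients and d for their common
    denominator; the left-hand sum is the Ricci curvature.  Only the products of
    first derivatives, and the products of a coefficient with a second derivative,
    have a pole of order four, and these combine to a square. *)
Lemma ricci_pole : d != 0 ->
  d ^+ 4 * \sum_k (2 * quot1 (P k) (Px k k) (dx k)
    - \sum_j y j * quot2 (P k) (Px k j) (Py k k) (Pxy k j k) (dx j) (dy k) (dxy j k)
    + 2 * \sum_j (P j * d^-1)
        * quot2 (P k) (Py k j) (Py k k) (Pyy k j k) (dy j) (dy k) (dyy j k)
    - \sum_j quot1 (P k) (Py k j) (dy j) * quot1 (P j) (Py j k) (dy k)) =
  3 * (\sum_j P j * dy j) ^+ 2 + d * pole_rest.
Proof.
by move=> d0; rewrite /pole_rest /quot1 /quot2 !sum2; field.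
Qed.

End PoleAlgebra.

Section SqrootMetric.
Context {R : realType}.
Variables (U : set 'rV[R]_2) (a : 'rV[R]_2 -> 'M[R]_2) (b : 'rV[R]_2 -> 'rV[R]_2).
Hypotheses (oU : open U) (hF : is_sqroot_metric a b U).
Implicit Types x y : 'rV[R]_2.

Definition e00 x := a x 0 0.
Definition e01 x := a x 0 1.
Definition e11 x := a x 1 1.
Definition cb0 x := b x 0 0.
Definition cb1 x := b x 0 1.
Definition gram x := e00 x * e11 x - e01 x * e01 x.

(** The squared norm of beta times the Gram determinant. *)
Definition gram_norm x :=
  e11 x * cb0 x * cb0 x - 2 * e01 x * cb0 x * cb1 x + e00 x * cb1 x * cb1 x.

Definition qform : @tfun R 2 := fun x y =>
  e00 x * y 0 0 * y 0 0 + 2 * e01 x * y 0 0 * y 0 1 + e11 x * y 0 1 * y 0 1.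
Definition lform : @tfun R 2 := fun x y => cb0 x * y 0 0 + cb1 x * y 0 1.
Definition qsqrt : @tfun R 2 := fun x y => Num.sqrt (qform x y).
Definition sqroot_sq : @tfun R 2 := fun x y => qform x y + qsqrt x y * lform x y.

Lemma smooth_e00 : smooth U e00. Proof. by have [[+ _ _] _ _] := hF; exact. Qed.
Lemma smooth_e01 : smooth U e01. Proof. by have [[+ _ _] _ _] := hF; exact. Qed.
Lemma smooth_e11 : smooth U e11. Proof. by have [[+ _ _] _ _] := hF; exact. Qed.
Lemma smooth_cb0 : smooth U cb0. Proof. by have [_ + _] := hF; exact. Qed.
Lemma smooth_cb1 : smooth U cb1. Proof. by have [_ + _] := hF; exact. Qed.

Lemma qformE x y : U x -> \sum_i \sum_j a x i j * y 0 i * y 0 j = qform x y.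
Proof.
move=> Ux; have [[_ /(_ x 1 0 Ux) a10 _] _ _] := hF.
by rewrite !sum2 a10 /qform /e00 /e01 /e11; ring.
Qed.

Lemma alphaE x y : U x -> alpha a x y = qsqrt x y.
Proof. by move=> Ux; rewrite /alpha qformE. Qed.

Lemma betaE x y : beta b x y = lform x y.
Proof. by rewrite /beta sum2. Qed.

Lemma qform_gt0 x y : U x -> y != 0 -> 0 < qform x y.
Proof. by move=> Ux y0; rewrite -qformE //; have [[_ _ +] _ _] := hF; exact. Qed.

Lemma qsqrt_gt0 x y : U x -> y != 0 -> 0 < qsqrt x y.
Proof. by move=> Ux y0; rewrite sqrtr_gt0 qform_gt0. Qed.

Lemma qsqrt_sq x y : U x -> y != 0 -> qsqrt x y ^+ 2 = qform x y.
Proof. by move=> Ux y0; rewrite sqr_sqrtr // ltW // qform_gt0. Qed.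

Lemma row2_neq0 (s t : R) : s != 0 -> \row_(j < 2) (if j == 0 then s else t) != 0.
Proof. by apply: contra => /eqP/rowP/(_ 0); rewrite !mxE /= => ->. Qed.

Lemma e00_gt0 x : U x -> 0 < e00 x.
Proof.
move=> Ux; have := qform_gt0 Ux (row2_neq0 0 (oner_neq0 R)).
by rewrite /qform !mxE /= !mulr1 !mulr0 !addr0.
Qed.

Lemma gram_gt0 x : U x -> 0 < gram x.
Proof.
move=> Ux; have e0 := e00_gt0 Ux; rewrite -(pmulr_rgt0 _ e0).
have [e01_0|e01_n0] := eqVneq (e01 x) 0.
  have y0 : \row_(j < 2) (if j == 0 then 0 : R else 1) != 0.
    by apply/eqP => /rowP/(_ 1); rewrite !mxE /= => /eqP; rewrite oner_eq0.
  have := qform_gt0 Ux y0; rewrite /qform !mxE /= !mulr0 !mulr1 !add0r => e1.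
  by rewrite /gram e01_0 mulr0 subr0 !mulr_gt0.
have y0 := row2_neq0 (e00 x) (_ : - e01 x != 0).
have := qform_gt0 Ux (y0 _); rewrite oppr_eq0 => /(_ e01_n0).
by rewrite /qform !mxE /= /gram; set u := (X in 0 < X) => + ; rewrite (_ : u = e00 x * gram x) //
  /u /gram; ring.
Qed.

Lemma beta_norm_gram x : a x 1 0 = a x 0 1 -> gram x != 0 ->
  beta_norm a b x = Num.sqrt (gram_norm x / gram x).
Proof.
move=> a10 g0; have ua : a x \in unitmx by rewrite unitmx2 det2 a10.
congr Num.sqrt; rewrite /invmx ua !sum2 !mxE /cofactor !det_mx11 !mxE /=.
rewrite det2 a10 -/(gram x).
have -> : lift 0 0 = 1 :> 'I_2 by exact: val_inj.
have -> : lift 1 0 = 0 :> 'I_2 by exact: val_inj.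
rewrite a10 /gram_norm /e00 /e01 /e11 /cb0 /cb1 /= !expr2 !expr1 !expr0.
by move: g0; set g := gram x => g0; field.
Qed.

Lemma beta_normE x : U x -> beta_norm a b x = Num.sqrt (gram_norm x / gram x).
Proof.
move=> Ux; apply: beta_norm_gram; last by rewrite gt_eqF // gram_gt0.
by have [[_ aS _] _ _] := hF; exact: aS.
Qed.

Lemma gram_norm_lt x : U x -> gram_norm x < gram x.
Proof.
move=> Ux; have [_ _ /(_ x Ux)] := hF; rewrite beta_normE //.
rewrite -[X in _ < X](sqrtr1 R) ltr_sqrt ?ltr01 //.
by rewrite ltr_pdivrMr ?gram_gt0 // mul1r.
Qed.

(** Cauchy-Schwarz, with the bound on the norm of beta. *)
Lemma lform_lt x y : U x -> y != 0 -> `|lform x y| < qsqrt x y.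
Proof.
move=> Ux y0; rewrite -sqrtr_sqr ltr_sqrt ?qform_gt0 //.
rewrite -(ltr_pM2l (gram_gt0 Ux)).
apply: le_lt_trans (_ : gram_norm x * qform x y < _); last first.
  by rewrite ltr_pM2r ?qform_gt0 ?gram_norm_lt.
rewrite -subr_ge0 (_ : _ - _ = ((e00 x * y 0 0 + e01 x * y 0 1) * cb1 x -
   (e01 x * y 0 0 + e11 x * y 0 1) * cb0 x) ^+ 2) ?sqr_ge0 //.
by rewrite /gram_norm /qform /gram /lform; ring.
Qed.

Lemma sqroot_pos x y : U x -> y != 0 -> 0 < qsqrt x y + lform x y.
Proof.
move=> Ux y0; rewrite -ltrBlDr sub0r.
by apply: le_lt_trans (lform_lt Ux y0); rewrite -normrN ler_norm.
Qed.

Lemma sqF_sqroot x y : U x -> y != 0 ->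
  sqF (sqroot_metric a b) x y = sqroot_sq x y.
Proof.
move=> Ux y0; rewrite /sqF /sqroot_metric alphaE // betaE sqr_sqrtr; last first.
  by rewrite mulr_ge0 // ltW // ?qsqrt_gt0 // sqroot_pos.
by rewrite mulrDr -expr2 qsqrt_sq.
Qed.

Lemma sqroot_sq_gt0 x y : U x -> y != 0 -> 0 < sqroot_sq x y.
Proof.
move=> Ux y0; rewrite /sqroot_sq -qsqrt_sq // expr2 -mulrDr.
by rewrite mulr_gt0 ?qsqrt_gt0 ?sqroot_pos.
Qed.

Definition qcov (k : 'I_2) : @tfun R 2 := fun x y =>
  if k == 0 then e00 x * y 0 0 + e01 x * y 0 1 else e01 x * y 0 0 + e11 x * y 0 1.

Definition qform_x (k : 'I_2) : @tfun R 2 := fun x y =>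
  pd k e00 x * y 0 0 * y 0 0 + 2 * pd k e01 x * y 0 0 * y 0 1
  + pd k e11 x * y 0 1 * y 0 1.

Definition iqsqrt : @tfun R 2 := fun x y => (qsqrt x y)^-1.

Ltac coef_leaf :=
  lazymatch goal with
  | |- is_tderiv _ _ (fun x _ => e00 x) _ => exact: (is_tderiv_x oU _ smooth_e00)
  | |- is_tderiv _ _ (fun x _ => e01 x) _ => exact: (is_tderiv_x oU _ smooth_e01)
  | |- is_tderiv _ _ (fun x _ => e11 x) _ => exact: (is_tderiv_x oU _ smooth_e11)
  | |- is_tderiv _ _ (fun x _ => cb0 x) _ => exact: (is_tderiv_x oU _ smooth_cb0)
  | |- is_tderiv _ _ (fun x _ => cb1 x) _ => exact: (is_tderiv_x oU _ smooth_cb1)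
  | |- is_tderiv _ _ (fun x _ => pd ?k e00 x) _ =>
      exact: (is_tderiv_x oU _ (smooth_pd k smooth_e00))
  | |- is_tderiv _ _ (fun x _ => pd ?k e01 x) _ =>
      exact: (is_tderiv_x oU _ (smooth_pd k smooth_e01))
  | |- is_tderiv _ _ (fun x _ => pd ?k e11 x) _ =>
      exact: (is_tderiv_x oU _ (smooth_pd k smooth_e11))
  | |- is_tderiv _ _ (fun x _ => pd ?k cb0 x) _ =>
      exact: (is_tderiv_x oU _ (smooth_pd k smooth_cb0))
  | |- is_tderiv _ _ (fun x _ => pd ?k cb1 x) _ =>
      exact: (is_tderiv_x oU _ (smooth_pd k smooth_cb1))
  end.

Lemma is_tderiv_trans d (H K K' : @tfun R 2) : is_tderiv U d H K' ->
  (forall x y, U x -> y != 0 -> K' x y = K x y) -> is_tderiv U d H K.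
Proof. by move=> [sH dH] KK; split=> // x y Ux y0; rewrite dH // KK. Qed.

Lemma is_tderiv_qsqrt_x k : is_tderiv U (inl k) qsqrt
  (fun x y => 2^-1 * (iqsqrt x y * qform_x k x y)).
Proof.
have dA : is_tderiv U (inl k) qform (qform_x k).
  refine (is_tderiv_trans (K' := fun x y => _) _ _).
    by rewrite /qform; tderive oU ltac:(idtac; coef_leaf).
  by move=> x y _ _; rewrite /qform_x /=; ring.
refine (is_tderiv_trans (is_tderiv_sqrt oU qform_gt0 dA) _).
by move=> x y _ _; rewrite /iqsqrt /qsqrt invfM; ring.
Qed.

Lemma is_tderiv_qsqrt_y k : is_tderiv U (inr k) qsqrt
  (fun x y => iqsqrt x y * qcov k x y).
Proof.
have dA : is_tderiv U (inr k) qform (fun x y => 2 * qcov k x y).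
  refine (is_tderiv_trans (K' := fun x y => _) _ _).
    by rewrite /qform; tderive oU ltac:(idtac; coef_leaf).
  by move=> x y _ _; rewrite /qcov; elim/ord2P: k => /=; ring.
refine (is_tderiv_trans (is_tderiv_sqrt oU qform_gt0 dA) _).
by move=> x y Ux y0; rewrite /iqsqrt -/(qsqrt x y); field; rewrite gt_eqF // qsqrt_gt0.
Qed.

Lemma is_tderiv_iqsqrt_x k : is_tderiv U (inl k) iqsqrt
  (fun x y => - 2^-1 * (iqsqrt x y ^+ 3 * qform_x k x y)).
Proof.
refine (is_tderiv_trans (is_tderivV oU _ (is_tderiv_qsqrt_x k)) _) => x y Ux y0.
  by rewrite gt_eqF // qsqrt_gt0.
by rewrite /iqsqrt; field; rewrite gt_eqF // qsqrt_gt0.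
Qed.

Lemma is_tderiv_iqsqrt_y k : is_tderiv U (inr k) iqsqrt
  (fun x y => - (iqsqrt x y ^+ 3 * qcov k x y)).
Proof.
refine (is_tderiv_trans (is_tderivV oU _ (is_tderiv_qsqrt_y k)) _) => x y Ux y0.
  by rewrite gt_eqF // qsqrt_gt0.
by rewrite /iqsqrt; field; rewrite gt_eqF // qsqrt_gt0.
Qed.

(** The functions that are polynomial in y, alpha and 1/alpha over the smooth
    functions of x.  They are closed under differentiation, and the fundamental
    tensor consists of such functions. *)
Inductive apoly : @tfun R 2 -> Prop :=
| apoly_x f : smooth U f -> apoly (fun x _ => f x)
| apoly_y j : apoly (fun _ y => y 0 j)
| apoly_qsqrt : apoly qsqrt
| apoly_iqsqrt : apoly iqsqrt
| apolyD H K : apoly H -> apoly K -> apoly (fun x y => H x y + K x y)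
| apolyM H K : apoly H -> apoly K -> apoly (fun x y => H x y * K x y)
| apoly_eq H K : apoly H -> (forall x y, U x -> y != 0 -> H x y = K x y) -> apoly K.

Lemma apoly_cst c : apoly (fun _ _ => c).
Proof. exact: apoly_x (smooth_cst U c). Qed.

Lemma apolyN H : apoly H -> apoly (fun x y => - H x y).
Proof.
move=> pH; apply: (apoly_eq (apolyM (apoly_cst (-1)) pH)) => x y _ _.
by rewrite mulN1r.
Qed.

Ltac apolyness leaf :=
  lazymatch goal with
  | |- apoly (fun x y => @?H x y + @?K x y) =>
      refine (@apolyD H K _ _); apolyness leaf
  | |- apoly (fun x y => @?H x y * @?K x y) =>
      refine (@apolyM H K _ _); apolyness leaf
  | |- apoly (fun x y => - (@?H x y)) =>
      refine (@apolyN H _); apolyness leaf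
  | |- apoly (fun x y => @?H x y ^+ 2) =>
      refine (@apolyM H H _ _); apolyness leaf
  | |- apoly (fun x y => @?H x y ^+ 3) =>
      refine (@apolyM H _ _ (@apolyM H H _ _)); apolyness leaf
  | |- apoly (fun _ y => fun_of_matrix y _ ?j) => exact: (apoly_y j)
  | |- apoly (fun _ _ => ?c) => exact: (apoly_cst c)
  | |- apoly (fun x _ => e00 x) => exact: (apoly_x smooth_e00)
  | |- apoly (fun x _ => e01 x) => exact: (apoly_x smooth_e01)
  | |- apoly (fun x _ => e11 x) => exact: (apoly_x smooth_e11)
  | |- apoly (fun x _ => cb0 x) => exact: (apoly_x smooth_cb0)
  | |- apoly (fun x _ => cb1 x) => exact: (apoly_x smooth_cb1)
  | |- apoly (fun x _ => pd ?k e00 x) => exact: (apoly_x (smooth_pd k smooth_e00))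
  | |- apoly (fun x _ => pd ?k e01 x) => exact: (apoly_x (smooth_pd k smooth_e01))
  | |- apoly (fun x _ => pd ?k e11 x) => exact: (apoly_x (smooth_pd k smooth_e11))
  | |- apoly (fun x y => qsqrt x y) => exact: apoly_qsqrt
  | |- apoly (fun x y => iqsqrt x y) => exact: apoly_iqsqrt
  | |- _ => leaf
  end.

Lemma apoly_qcov k : apoly (qcov k).
Proof. by elim/ord2P: k; rewrite /qcov /=; apolyness idtac. Qed.

Lemma apoly_qform_x k : apoly (qform_x k).
Proof. by rewrite /qform_x; apolyness idtac. Qed.

Lemma apoly_tderiv H : apoly H -> tsmooth U H /\ forall d, apoly (tderiv d H).
Proof.
have D K (d : 'I_2 + 'I_2) K' : is_tderiv U d K K' -> apoly K' -> apoly (tderiv d K).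
  by move=> [_ dK] pK; apply: (apoly_eq pK) => x y Ux y0; rewrite dK.
have L d H' : tsmooth U H' -> is_tderiv U d H' (tderiv d H') by [].
elim=> {H} [f sf|j|||H K pH [sH IH] pK [sK IK]|H K pH [sH IH] pK [sK IK]|H K pH [sH IH] HK].
- split=> [|d]; first exact: tsmooth_x.
  by apply: (D _ _ _ (is_tderiv_x oU d sf)); case: d => k;
    [exact/apoly_x/smooth_pd|exact: apoly_cst].
- split=> [|d]; first exact: tsmooth_y.
  by apply: (D _ _ _ (is_tderiv_y _ d j)); case: d => k; exact: apoly_cst.
- split=> [|[k|k]]; first exact: (is_tderiv_qsqrt_x 0).1.
    apply: (D _ _ _ (is_tderiv_qsqrt_x k)).
    by apolyness ltac:(exact: apoly_qform_x).
  by apply: (D _ _ _ (is_tderiv_qsqrt_y k)); apolyness ltac:(exact: apoly_qcov).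
- split=> [|[k|k]]; first exact: (is_tderiv_iqsqrt_x 0).1.
    apply: (D _ _ _ (is_tderiv_iqsqrt_x k)).
    by apolyness ltac:(exact: apoly_qform_x).
  by apply: (D _ _ _ (is_tderiv_iqsqrt_y k)); apolyness ltac:(exact: apoly_qcov).
- split=> [|d]; first exact: tsmoothD.
  by apply: (D _ _ _ (is_tderivD oU (L d _ sH) (L d _ sK))); exact: apolyD.
- split=> [|d]; first exact: tsmoothM.
  apply: (D _ _ _ (is_tderivM oU (L d _ sH) (L d _ sK))).
  by apply: apolyD; apply: apolyM.
split=> [|d]; first exact: (tsmooth_eq oU HK sH).
apply: (apoly_eq (IH d)) => x y Ux y0.
exact: (is_tderiv_eq oU (L d _ sH) (L d _ (tsmooth_eq oU HK sH)) HK Ux y0).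
Qed.

Lemma apoly_smooth H : apoly H -> tsmooth U H.
Proof. by move=> /apoly_tderiv[]. Qed.

Lemma apoly_Dx k H : apoly H -> apoly (Dx k H).
Proof. by move=> /apoly_tderiv[_ /(_ (inl k))]. Qed.

Lemma apoly_Dy k H : apoly H -> apoly (Dy k H).
Proof. by move=> /apoly_tderiv[_ /(_ (inr k))]. Qed.

Lemma apoly_sqroot_sq : apoly sqroot_sq.
Proof. by rewrite /sqroot_sq /qform /lform; apolyness idtac. Qed.

(** On the tangent space at a point where the metric is the unit matrix, the
    directions (1 - t^2, 2 t) make alpha = 1 + t^2 polynomial. *)
Definition dir (t : R) : 'rV[R]_2 := \row_j if j == 0 then 1 - t ^+ 2 else 2 * t.

Lemma dir_neq0 t : dir t != 0.
Proof.
apply/eqP => /rowP E; have := E 1; have := E 0; rewrite !mxE /= => E0 /eqP.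
rewrite mulf_eq0 pnatr_eq0 /= => /eqP t0; move: E0; rewrite t0 expr0n /= subr0.
by move/eqP; rewrite oner_eq0.
Qed.

Lemma qsqrt_dir p t : a p = 1%:M -> qsqrt p (dir t) = 1 + t ^+ 2.
Proof.
move=> ap; rewrite /qsqrt (_ : qform p _ = (1 + t ^+ 2) ^+ 2).
  by rewrite sqrtr_sqr ger0_norm // addr_ge0 // sqr_ge0.
by rewrite /qform /e00 /e01 /e11 ap !mxE /=; ring.
Qed.

(** Along these directions a polynomial in y, alpha and 1/alpha is a rational
    function of t whose denominator is a power of 1 + t^2. *)
Lemma apoly_rational p H : U p -> a p = 1%:M -> apoly H -> exists N m, forall t : R,
  H p (dir t) * (1 + t ^+ 2) ^+ m = N.[t].
Proof.
move=> Up ap; have r0 t : 1 + t ^+ 2 != 0 :> R.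
  by rewrite gt_eqF // ltr_wpDr // sqr_ge0.
have q t := qsqrt_dir t ap.
elim=> {H} [f _|j|||H K _ [N [m HN]] _ [N' [m' KN]]|H K _ [N [m HN]] _ [N' [m' KN]]
            |H K _ [N [m HN]] HK].
- by exists (f p)%:P, 0%N => t; rewrite hornerC mulr1.
- elim/ord2P: j.
    by exists (1 - 'X ^+ 2), 0%N => t; rewrite !mxE /= !hornerE.
  by exists (2 *: 'X), 0%N => t; rewrite !mxE /= !hornerE.
- by exists (1 + 'X ^+ 2), 0%N => t; rewrite q !hornerE.
- by exists 1, 1%N => t; rewrite /iqsqrt q hornerE mulVf.
- exists (N * (1 + 'X^2) ^+ m' + N' * (1 + 'X^2) ^+ m), (m + m')%N => t.
  by rewrite !hornerE -HN -KN exprD; ring.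
- exists (N * N'), (m + m')%N => t.
  by rewrite !hornerE -HN -KN exprD; ring.
- by exists N, m => t; rewrite -HN HK // dir_neq0.
Qed.

Definition ee (i j : 'I_2) : 'rV[R]_2 -> R :=
  if i == 0 then (if j == 0 then e00 else e01)
  else (if j == 0 then e01 else e11).
Definition cb (i : 'I_2) : 'rV[R]_2 -> R := if i == 0 then cb0 else cb1.
Definition lform_x (k : 'I_2) : @tfun R 2 := fun x y =>
  pd k cb0 x * y 0 0 + pd k cb1 x * y 0 1.
Definition qcov_x (k l : 'I_2) : @tfun R 2 := fun x y =>
  if l == 0 then pd k e00 x * y 0 0 + pd k e01 x * y 0 1
  else pd k e01 x * y 0 0 + pd k e11 x * y 0 1.

Ltac sq_leaf :=
  lazymatch goal with
  | |- is_tderiv _ (inl ?k) (fun x y => qsqrt x y) _ => exact: is_tderiv_qsqrt_x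
  | |- is_tderiv _ (inr ?k) (fun x y => qsqrt x y) _ => exact: is_tderiv_qsqrt_y
  | |- is_tderiv _ (inl ?k) (fun x y => iqsqrt x y) _ => exact: is_tderiv_iqsqrt_x
  | |- is_tderiv _ (inr ?k) (fun x y => iqsqrt x y) _ => exact: is_tderiv_iqsqrt_y
  | |- _ => coef_leaf
  end.

Let L := sqroot_sq.
Let sL : tsmooth U L := apoly_smooth apoly_sqroot_sq.

Lemma qsqrt_neq0 x y : U x -> y != 0 -> qsqrt x y != 0.
Proof. by move=> Ux y0; rewrite gt_eqF // qsqrt_gt0. Qed.

Lemma sqroot_y i x y : U x -> y != 0 -> Dy i L x y =
  2 * qcov i x y + iqsqrt x y * qcov i x y * lform x y + qsqrt x y * cb i x.
Proof.
move: x y; refine (is_tderiv_trans (K' := fun x y => _) (H := L) (d := inr i) _ _).2.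
  by rewrite /L /sqroot_sq /qform /lform; tderive oU ltac:(idtac; sq_leaf).
move=> x y Ux y0; rewrite /qcov /cb /lform.
by elim/ord2P: i => /=; ring.
Qed.

Lemma sqroot_yy i j x y : U x -> y != 0 -> Dy j (Dy i L) x y =
  2 * ee i j x + iqsqrt x y * (ee i j x * lform x y + qcov i x y * cb j x
    + qcov j x y * cb i x) - iqsqrt x y ^+ 3 * qcov i x y * qcov j x y * lform x y.
Proof.
move=> Ux y0.
rewrite /qcov /cb /lform /ee; elim/ord2P: i;
refine (etrans (is_tderiv_eq oU (is_tderiv_Dy j (tsmooth_Dy _ sL))
  (_ : is_tderiv U _ _ ?[D]) (sqroot_y _) Ux y0) _);
  [ by rewrite /qcov /cb /lform /=; tderive oU ltac:(idtac; sq_leaf) |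
  | by rewrite /qcov /cb /lform /=; tderive oU ltac:(idtac; sq_leaf) | ];
by rewrite /qcov /=; elim/ord2P: j => /=; ring.
Qed.

Lemma sqroot_x k x y : U x -> y != 0 -> Dx k L x y =
  qform_x k x y + 2^-1 * (iqsqrt x y * qform_x k x y) * lform x y
  + qsqrt x y * lform_x k x y.
Proof.
move: x y; refine (is_tderiv_trans (K' := fun x y => _) (H := L) (d := inl k) _ _).2.
  by rewrite /L /sqroot_sq /qform /lform; tderive oU ltac:(idtac; sq_leaf).
by move=> x y Ux y0; rewrite /lform /lform_x /= /qform_x; ring.
Qed.

Lemma sqroot_xy k l x y : U x -> y != 0 -> Dy l (Dx k L) x y =
  2 * qcov_x k l x y
  + iqsqrt x y * (qcov_x k l x y * lform x y + 2^-1 * qform_x k x y * cb l x)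
  - 2^-1 * (iqsqrt x y ^+ 3 * qcov l x y * qform_x k x y * lform x y)
  + iqsqrt x y * qcov l x y * lform_x k x y + qsqrt x y * pd k (cb l) x.
Proof.
move=> Ux y0.
refine (etrans (is_tderiv_eq oU (is_tderiv_Dy l (tsmooth_Dx k sL))
  (_ : is_tderiv U _ _ ?[D]) (sqroot_x k) Ux y0) _).
  by rewrite /qform_x /lform /lform_x; tderive oU ltac:(idtac; sq_leaf).
rewrite /qcov_x /cb /=; elim/ord2P: l => /=;
  by rewrite /qcov /= /qform_x /lform /lform_x; field.
Qed.

(** Proportional to the determinant of the fundamental tensor. *)
Definition sq_det : @tfun R 2 := fun x y =>
  gram x * (4 * qform x y + 6 * qsqrt x y * lform x y + 3 * lform x y ^+ 2)
  - gram_norm x * qform x y.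

Lemma sq_det_gt0 x y : U x -> y != 0 -> 0 < sq_det x y.
Proof.
move=> Ux y0; have q0 := qform_gt0 Ux y0; have g0 := gram_gt0 Ux.
rewrite /sq_det (_ : _ - _ = 3 * gram x * (qsqrt x y + lform x y) ^+ 2
  + (gram x - gram_norm x) * qform x y); last first.
  by have := qsqrt_sq Ux y0; move: (qform x y) => q <-; ring.
apply: ltr_wpDl; first by rewrite mulr_ge0 ?sqr_ge0 // mulr_ge0 // ltW.
by rewrite mulr_gt0 // subr_gt0 gram_norm_lt.
Qed.

Lemma sq_det_y i x y : U x -> y != 0 -> Dy i sq_det x y =
  gram x * (8 * qcov i x y + 6 * (iqsqrt x y * qcov i x y * lform x y
    + qsqrt x y * cb i x) + 6 * lform x y * cb i x)
  - 2 * gram_norm x * qcov i x y.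
Proof.
move: x y; refine (is_tderiv_trans (K' := fun x y => _) (H := sq_det) (d := inr i) _ _).2.
  refine (is_tderiv_trans (H := fun x y =>
     gram x * (4 * qform x y + 6 * qsqrt x y * lform x y + 3 * (lform x y * lform x y))
     - gram_norm x * qform x y) (K' := fun x y => _) _ _).
  by rewrite /gram /gram_norm /qform /lform; tderive oU ltac:(idtac; sq_leaf).
  by move=> x y _ _; reflexivity.
move=> x y Ux y0; rewrite /qcov /cb /lform /gram /gram_norm.
by elim/ord2P: i => /=; rewrite /qform; ring.
Qed.

(** With q = alpha(y), H is the matrix of second derivatives of
    alpha^2 + alpha beta. *)
Lemma hessian_det (a00 a01 a11 c0 c1 s t q : R) (w0 := a00 * s + a01 * t)
    (w1 := a01 * s + a11 * t) (l := c0 * s + c1 * t)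
    (H := fun aij wi wj ci cj => 2 * aij + q^-1 * (aij * l + wi * cj + wj * ci)
                                  - q^-1 ^+ 3 * wi * wj * l) :
  q != 0 -> q ^+ 2 = a00 * s * s + 2 * a01 * s * t + a11 * t * t ->
  q ^+ 2 * (H a00 w0 w0 c0 c0 * H a11 w1 w1 c1 c1
            - H a01 w0 w1 c0 c1 * H a01 w1 w0 c1 c0) =
  (a00 * a11 - a01 * a01) * (4 * q ^+ 2 + 6 * q * l + 3 * l ^+ 2)
  - (a11 * c0 * c0 - 2 * a01 * c0 * c1 + a00 * c1 * c1) * q ^+ 2.
Proof.
move=> q0 qE; rewrite /H /w0 /w1 /l; field: qE; exact: q0.
Qed.

Lemma sqroot_hessian_det x y : U x -> y != 0 ->
  qsqrt x y ^+ 2 * (Dy 0 (Dy 0 L) x y * Dy 1 (Dy 1 L) x y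
                    - Dy 1 (Dy 0 L) x y * Dy 0 (Dy 1 L) x y) = sq_det x y.
Proof.
move=> Ux y0; rewrite !sqroot_yy // /sq_det /gram /gram_norm.
have := qsqrt_sq Ux y0; rewrite /qform => qE.
have := hessian_det (cb0 x) (cb1 x) (qsqrt_neq0 Ux y0) qE.
rewrite /ee /qcov /cb /iqsqrt /= -/(lform x y) -qE => <-.
by congr (_ * (_ - _)).
Qed.

Lemma Dy2_sqF i j x y : U x -> y != 0 ->
  Dy j (Dy i (sqF (sqroot_metric a b))) x y = Dy j (Dy i L) x y.
Proof.
move=> Ux y0; rewrite -!DyE; apply: (eq_dy oU) Ux y0 => {}x {}y Ux y0.
by apply: (eq_dy oU) Ux y0 => {}x {}y Ux y0; exact: sqF_sqroot.
Qed.

Lemma regular_sqroot : regular_metric U (sqroot_metric a b).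
Proof.
split=> [|x y Ux y0].
  by apply: (tsmooth_eq oU _ sL) => x y Ux y0; rewrite sqF_sqroot.
have := sq_det_gt0 Ux y0; rewrite -sqroot_hessian_det //.
rewrite det2 !fundamental_tensorE !Dy2_sqF // => h; apply: contraTneq h => h0.
rewrite (_ : _ - _ = 4 * 0); first by rewrite mulr0 mulr0 ltxx.
by rewrite -h0; field.
Qed.

(** Numerators of the geodesic coefficients over the denominator [sq_det]. *)
Definition spray_num (i : 'I_2) : @tfun R 2 := fun x y =>
  let E l := spray_rhs (sqroot_metric a b) l x y in
  if i == 0 then
    2^-1 * qsqrt x y ^+ 2 * (Dy 1 (Dy 1 L) x y * E 0 - Dy 1 (Dy 0 L) x y * E 1)
  else
    2^-1 * qsqrt x y ^+ 2 * (Dy 0 (Dy 0 L) x y * E 1 - Dy 0 (Dy 1 L) x y * E 0).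

Lemma spray_rhs_sqroot l x y : U x -> y != 0 ->
  spray_rhs (sqroot_metric a b) l x y =
  Dy l (Dx 0 L) x y * y 0 0 + Dy l (Dx 1 L) x y * y 0 1 - Dx l L x y.
Proof.
have EX k z w : U z -> w != 0 ->
    Dx k (sqF (sqroot_metric a b)) z w = Dx k L z w.
  move=> Uz w0; rewrite -!DxE; apply: (eq_dx oU) Uz w0 => {}z {}w Uz w0.
  exact: sqF_sqroot.
have EYX k z w : U z -> w != 0 ->
    Dy l (Dx k (sqF (sqroot_metric a b))) z w = Dy l (Dx k L) z w.
  move=> Uz w0; rewrite -!DyE; apply: (eq_dy oU) Uz w0 => {}z {}w Uz w0.
  exact: EX.
by move=> Ux y0; rewrite /spray_rhs sum2 EX // !EYX.
Qed.

Lemma geodesic_sqroot i x y : U x -> y != 0 ->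
  geodesic_coeff (sqroot_metric a b) i x y = spray_num i x y / sq_det x y.
Proof.
move=> Ux y0; have [G0 G1] := geodesic_cramer regular_sqroot Ux y0.
have q0 := qsqrt_neq0 Ux y0; have := sq_det_gt0 Ux y0.
rewrite -sqroot_hessian_det // => d0; have {}d0 := lt0r_neq0 d0.
move: d0; rewrite mulf_eq0 expf_eq0 (negPf q0) /= => d0.
have cramer (q h00 h01 h10 h11 E E' : R) : q != 0 -> h00 * h11 - h01 * h10 != 0 ->
    (2^-1 * h11 * E - 2^-1 * h01 * E') /
      (4 * (2^-1 * h00 * (2^-1 * h11) - 2^-1 * h01 * (2^-1 * h10))) =
    2^-1 * q ^+ 2 * (h11 * E - h01 * E') / (q ^+ 2 * (h00 * h11 - h01 * h10)).
  move=> *; field; apply/andP; split=> //; apply/andP; split=> //.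
have cramer' (q h00 h01 h10 h11 E E' : R) : q != 0 -> h00 * h11 - h01 * h10 != 0 ->
    (2^-1 * h00 * E - 2^-1 * h10 * E') /
      (4 * (2^-1 * h00 * (2^-1 * h11) - 2^-1 * h01 * (2^-1 * h10))) =
    2^-1 * q ^+ 2 * (h00 * E - h10 * E') / (q ^+ 2 * (h00 * h11 - h01 * h10)).
  move=> *; field; apply/andP; split=> //; apply/andP; split=> //.
elim/ord2P: i; [rewrite G0|rewrite G1]; rewrite /spray_num /= !fundamental_tensorE !Dy2_sqF //.
  exact: cramer.
exact: cramer'.
Qed.

Lemma apoly_spray_num i : apoly (spray_num i).
Proof.
have pE l : apoly (fun x y => spray_rhs (sqroot_metric a b) l x y).
  refine (apoly_eq (H := fun x y =>
    Dy l (Dx 0 L) x y * y 0 0 + Dy l (Dx 1 L) x y * y 0 1 - Dx l L x y) _ _).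
    by apolyness ltac:(idtac; first [exact: (apoly_Dx _ apoly_sqroot_sq)
      | exact: (apoly_Dy _ (apoly_Dx _ apoly_sqroot_sq))]).
  by move=> x y Ux y0; rewrite spray_rhs_sqroot.
have pL j k : apoly (fun x y => Dy j (Dy k L) x y).
  exact: (apoly_Dy _ (apoly_Dy _ apoly_sqroot_sq)).
by elim/ord2P: i; rewrite /spray_num /=;
  apolyness ltac:(idtac; first [exact: pE | exact: pL]).
Qed.

Lemma apoly_sq_det : apoly sq_det.
Proof. by rewrite /sq_det /gram /gram_norm /qform /lform; apolyness idtac. Qed.

Let F := sqroot_metric a b.
Let G := geodesic_coeff F.
Let P := spray_num.
Let d := sq_det.
Let pP i : apoly (P i) := apoly_spray_num i.
Let pd' : apoly d := apoly_sq_det.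
Let sP i : tsmooth U (P i) := apoly_smooth (pP i).
Let sd : tsmooth U d := apoly_smooth pd'.
Let d0 x y : U x -> y != 0 -> d x y != 0.
Proof. by move=> Ux y0; rewrite gt_eqF // sq_det_gt0. Qed.
Let id : @tfun R 2 := fun x y => (d x y)^-1.

Let GE i x y : U x -> y != 0 -> G i x y = P i x y * id x y.
Proof. exact: geodesic_sqroot. Qed.

Let sG i : tsmooth U (G i) := tsmooth_geodesic_coeff oU regular_sqroot i.

Let is_tderiv_id s : is_tderiv U s id (fun x y => - (id x y * id x y * tderiv s d x y)).
Proof.
have dd : is_tderiv U s d (tderiv s d) by [].
refine (is_tderiv_trans (is_tderivV oU d0 dd) _) => x y _ _.
by rewrite /id -exprVn expr2 mulNr.
Qed.

Ltac pole_leaf :=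
  lazymatch goal with
  | |- is_tderiv _ _ (fun x y => id x y) _ => exact: is_tderiv_id
  | |- is_tderiv _ (inl ?k) (fun x y => P ?i x y) _ => exact: (is_tderiv_Dx k (sP i))
  | |- is_tderiv _ (inr ?k) (fun x y => P ?i x y) _ => exact: (is_tderiv_Dy k (sP i))
  | |- is_tderiv _ (inr ?k) (fun x y => Dy ?j (P ?i) x y) _ =>
      exact: (is_tderiv_Dy k (tsmooth_Dy j (sP i)))
  | |- is_tderiv _ (inr ?k) (fun x y => Dx ?j (P ?i) x y) _ =>
      exact: (is_tderiv_Dy k (tsmooth_Dx j (sP i)))
  | |- is_tderiv _ (inr ?k) (fun x y => Dy ?j d x y) _ =>
      exact: (is_tderiv_Dy k (tsmooth_Dy j sd))
  | |- is_tderiv _ (inr ?k) (fun x y => Dx ?j d x y) _ =>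
      exact: (is_tderiv_Dy k (tsmooth_Dx j sd))
  end.

Ltac differentiate_quot dA E Ux y0 :=
  refine (etrans (is_tderiv_eq oU dA (_ : is_tderiv U _ _ ?[D]) E Ux y0) _);
  [tderive oU ltac:(idtac; pole_leaf) | rewrite /=].

Let G_x k j x y : U x -> y != 0 -> Dx j (G k) x y =
  Dx j (P k) x y * id x y - P k x y * (id x y * id x y * Dx j d x y).
Proof.
move=> Ux y0; differentiate_quot (is_tderiv_Dx j (sG k)) (GE k) Ux y0.
by rewrite mulrN.
Qed.

Let G_y k j x y : U x -> y != 0 -> Dy j (G k) x y =
  Dy j (P k) x y * id x y - P k x y * (id x y * id x y * Dy j d x y).
Proof.
move=> Ux y0; differentiate_quot (is_tderiv_Dy j (sG k)) (GE k) Ux y0.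
by rewrite mulrN.
Qed.

Let G_xy k j l x y : U x -> y != 0 -> Dy l (Dx j (G k)) x y =
  quot2 (d x y) (P k x y) (Dx j (P k) x y) (Dy l (P k) x y) (Dy l (Dx j (P k)) x y)
    (Dx j d x y) (Dy l d x y) (Dy l (Dx j d) x y).
Proof.
move=> Ux y0.
differentiate_quot (is_tderiv_Dy l (tsmooth_Dx j (sG k))) (G_x k j) Ux y0.
by rewrite /quot2 -/(id x y); ring.
Qed.

Let G_yy k j l x y : U x -> y != 0 -> Dy l (Dy j (G k)) x y =
  quot2 (d x y) (P k x y) (Dy j (P k) x y) (Dy l (P k) x y) (Dy l (Dy j (P k)) x y)
    (Dy j d x y) (Dy l d x y) (Dy l (Dy j d) x y).
Proof.
move=> Ux y0.
differentiate_quot (is_tderiv_Dy l (tsmooth_Dy j (sG k))) (G_y k j) Ux y0.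
by rewrite /quot2 -/(id x y); ring.
Qed.

Definition sq_rest : @tfun R 2 := fun x y =>
  pole_rest (fun k => P k x y) (fun k j => Dx j (P k) x y) (fun k j => Dy j (P k) x y)
    (fun k j l => Dy l (Dx j (P k)) x y) (fun k j l => Dy l (Dy j (P k)) x y)
    (d x y) (fun j => Dx j d x y) (fun j => Dy j d x y)
    (fun j l => Dy l (Dx j d) x y) (fun j l => Dy l (Dy j d) x y) (fun j => y 0 j).

(** The geodesic coefficients have a simple pole along d = 0, so the products
    of their derivatives give the curvature a pole of order four. *)
Lemma ricci_sqroot_pole x y : U x -> y != 0 ->
  d x y ^+ 4 * ricci F x y =
  3 * (\sum_j P j x y * Dy j d x y) ^+ 2 + d x y * sq_rest x y.
Proof.
move=> Ux y0; rewrite /sq_rest -ricci_pole ?d0 //; congr (_ * _).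
rewrite /ricci; apply: eq_bigr => k _; rewrite riemann_curvatureE.
congr (_ - _ + _ - _).
- by rewrite G_x.
- by apply: eq_bigr => j _; rewrite G_xy.
- by congr (_ * _); apply: eq_bigr => j _; rewrite G_yy //; congr (_ * _); exact: GE.
- by apply: eq_bigr => j _; rewrite !G_y.
Qed.

Lemma apoly_sq_rest : apoly sq_rest.
Proof.
have pP1 i : apoly (fun x y => P i x y) := pP i.
have pd1 : apoly (fun x y => d x y) := pd'.
have pPx k j : apoly (fun x y => Dx j (P k) x y) by exact: apoly_Dx.
have pPy k j : apoly (fun x y => Dy j (P k) x y) by exact: apoly_Dy.
have pPxy k j l : apoly (fun x y => Dy l (Dx j (P k)) x y).
  by apply: apoly_Dy; exact: apoly_Dx.
have pPyy k j l : apoly (fun x y => Dy l (Dy j (P k)) x y).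
  by apply: apoly_Dy; exact: apoly_Dy.
have pdx j : apoly (fun x y => Dx j d x y) by exact: apoly_Dx.
have pdy j : apoly (fun x y => Dy j d x y) by exact: apoly_Dy.
have pdxy j l : apoly (fun x y => Dy l (Dx j d) x y).
  by apply: apoly_Dy; exact: apoly_Dx.
have pdyy j l : apoly (fun x y => Dy l (Dy j d) x y).
  by apply: apoly_Dy; exact: apoly_Dy.
refine (apoly_eq (H := fun x y => _) _ _); last first.
  by move=> x y Ux y0; rewrite /sq_rest /pole_rest !sum2; reflexivity.
apolyness ltac:(idtac; lazymatch goal with
  | |- apoly (fun x y => P _ x y) => exact: pP1
  | |- apoly (fun x y => d x y) => exact: pd1
  | |- apoly (fun x y => Dx _ (P _) x y) => exact: pPx
  | |- apoly (fun x y => Dy _ (P _) x y) => exact: pPy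
  | |- apoly (fun x y => Dy _ (Dx _ (P _)) x y) => exact: pPxy
  | |- apoly (fun x y => Dy _ (Dy _ (P _)) x y) => exact: pPyy
  | |- apoly (fun x y => Dx _ d x y) => exact: pdx
  | |- apoly (fun x y => Dy _ d x y) => exact: pdy
  | |- apoly (fun x y => Dy _ (Dx _ d) x y) => exact: pdxy
  | |- apoly (fun x y => Dy _ (Dy _ d) x y) => exact: pdyy
  end).
Qed.

End SqrootMetric.

(** * Evaluation of the pole at a complex direction *)

Section ComplexDirection.
Context {R : realType}.

(** For q the length of y = (y0, y1): the denominator of the curvature, and the
    factor whose square carries its pole. *)
Definition dir_den {K : pzRingType} (be q y0 : K) : K :=
  (4 - be ^+ 2) * q ^+ 2 + 6 * be * q * y0 + 3 * be ^+ 2 * y0 ^+ 2.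
Definition dir_num {K : pzRingType} (be k00 k01 k10 k11 q y0 y1 : K) : K :=
  (q + be * y0) * y1 * (2 * (k01 - k10) * (q + be * y0) * q ^+ 2
    - be * y1 * (k00 * y0 ^+ 2 + (k01 + k10) * y0 * y1 + k11 * y1 ^+ 2)).

Lemma dir_den_rmorph (K K' : comNzRingType) (f : {rmorphism K -> K'}) be q y0 :
  f (dir_den be q y0) = dir_den (f be) (f q) (f y0).
Proof.
by rewrite /dir_den; ring.
Qed.

Lemma dir_num_rmorph (K K' : comNzRingType) (f : {rmorphism K -> K'})
    be k00 k01 k10 k11 q y0 y1 :
  f (dir_num be k00 k01 k10 k11 q y0 y1) =
  dir_num (f be) (f k00) (f k01) (f k10) (f k11) (f q) (f y0) (f y1).
Proof.
by rewrite /dir_num; ring.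
Qed.

Lemma poly_ext (p q : {poly R}) : (forall t, p.[t] = q.[t]) -> p = q.
Proof.
move=> pq; apply/eqP; rewrite -subr_eq0; apply/eqP.
apply: (@roots_geq_poly_eq0 _ _ [seq i%:R : R | i <- iota 0 (size (p - q))]).
- by apply/allP => x _; rewrite /root hornerD hornerN pq subrr.
- rewrite map_inj_uniq ?iota_uniq // => i j /eqP.
  by rewrite eqr_nat => /eqP.
- by rewrite size_map size_iota.
Qed.

Let C := R[i].
Let toC : {rmorphism R -> C} := real_complex R.
Let I : C := 'i%C.

Lemma real_imag_eq0 (u v : R) : toC u + I * toC v = 0 -> u = 0 /\ v = 0.
Proof.
move=> /eqP; rewrite eq_complex /= !(mul0r, mul1r, mulr0, subr0, addr0, add0r).
by rewrite ?oppr0 ?subr0 ?addr0 ?add0r => /andP[/eqP -> /eqP ->].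
Qed.

(** A rational identity in the real directions persists at the complex
    directions, among them the zeros of the denominator.  There the numerator
    vanishes, which is two complex equations for the four coefficients. *)
Lemma pole_conditions (be k00 k01 k10 k11 : R) (N : {poly R}) m :
  be != 0 -> be ^+ 2 < 1 ->
  (forall t : R, dir_num be k00 k01 k10 k11 (1 + t ^+ 2) (1 - t ^+ 2) (2 * t) ^+ 2
                 * (1 + t ^+ 2) ^+ m =
               dir_den be (1 + t ^+ 2) (1 - t ^+ 2) * N.[t]) ->
  [/\ k00 = 0, k11 = 0 &
      3 * be ^+ 2 * (k01 - k10) = - (k01 + k10) * (4 - be ^+ 2)].
Proof.
move=> be0 be1 HN.
have sqm (K : comNzRingType) (f : {rmorphism {poly R} -> K}) A B :
    f (A ^+ 2 * B ^+ m) = f A ^+ 2 * f B ^+ m by rewrite rmorphM !rmorphXn.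
have HP : dir_num be%:P k00%:P k01%:P k10%:P k11%:P (1 + 'X ^+ 2) (1 - 'X ^+ 2)
      (2 * 'X) ^+ 2 * (1 + 'X ^+ 2) ^+ m
    = dir_den be%:P (1 + 'X ^+ 2) (1 - 'X ^+ 2) * N.
  apply: poly_ext => t.
  pose f : {rmorphism {poly R} -> R} := horner_eval t.
  have X k : f k%:P = k by rewrite /f /= /horner_eval hornerC.
  have E1 : f (1 + 'X ^+ 2) = 1 + t ^+ 2 by rewrite /f /= /horner_eval !hornerE.
  have E2 : f (1 - 'X ^+ 2) = 1 - t ^+ 2 by rewrite /f /= /horner_eval !hornerE.
  have E3 : f (2 * 'X) = 2 * t by rewrite /f /= /horner_eval !hornerE.
  have := HN t; rewrite -[N.[t]]/(f N) => HNt.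
  rewrite -[LHS]/(f _) -[RHS]/(f _) sqm (rmorphM f (dir_den _ _ _) N).
  by rewrite dir_num_rmorph dir_den_rmorph !X E1 E2 E3.
have ev (z : C) : dir_den (toC be) (1 + z ^+ 2) (1 - z ^+ 2) = 0 ->
    dir_num (toC be) (toC k00) (toC k01) (toC k10) (toC k11)
      (1 + z ^+ 2) (1 - z ^+ 2) (2 * z) ^+ 2 * (1 + z ^+ 2) ^+ m = 0.
  pose f : {rmorphism {poly R} -> C} := horner_eval z \o map_poly toC.
  move=> dz; have := congr1 f HP.
  rewrite sqm (rmorphM f (dir_den _ _ _) N) dir_num_rmorph dir_den_rmorph.
  have X k : f k%:P = toC k.
    by rewrite /f /= /horner_eval map_polyC hornerC.
  have E1 : f (1 + 'X ^+ 2) = 1 + z ^+ 2.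
    by rewrite /f /= /horner_eval rmorphD rmorphXn rmorph1 /= map_polyX !hornerE.
  have E2 : f (1 - 'X ^+ 2) = 1 - z ^+ 2.
    by rewrite /f /= /horner_eval rmorphB rmorphXn rmorph1 /= map_polyX !hornerE.
  have E3 : f (2 * 'X) = 2 * z.
    by rewrite /f /= /horner_eval !mulr_natl rmorphMn /= map_polyX hornerMn hornerX.
  by rewrite !X E1 E2 E3 dz mul0r.
pose T : R := Num.sqrt ((1 - be ^+ 2) / 3).
have T2 : 3 * T ^+ 2 = 1 - be ^+ 2.
  rewrite sqr_sqrtr; last by rewrite divr_ge0 // subr_ge0 ltW.
  by field.
have T0 : T != 0 by rewrite gt_eqF // sqrtr_gt0 divr_gt0 // subr_gt0.
have I2 : I ^+ 2 = -1 by exact: sqr_i.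
have I0 : I != 0 by rewrite -sqrf_eq0 I2 oppr_eq0 oner_eq0.
have B0 : toC be != 0 by rewrite fmorph_eq0.
have TC0 : toC T != 0 by rewrite fmorph_eq0.
have T2C : 3 * toC T ^+ 2 = 1 - toC be ^+ 2.
  transitivity (toC (3 * T ^+ 2)); first by ring.
  by rewrite T2; ring.
pose c : C := (-1 + I * toC T) / toC be.
have bc : toC be * c = -1 + I * toC T by rewrite mulrC divfK.
have c1 (s : R) : c + toC s != 0.
  apply/eqP => cs; have : toC (-1 + s * be) + I * toC T = 0.
    rewrite rmorphD rmorphM rmorphN rmorph1 -(mulr0 (toC be)) -cs; rewrite mulrDr bc.
    by ring.
  by move=> /real_imag_eq0[_ /eqP]; rewrite (negPf T0).
have c1p : 1 + c != 0 by have := c1 1; rewrite rmorph1 addrC.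
have c1m : 1 - c != 0.
  by have := c1 (-1); rewrite rmorphN rmorph1 -oppr_eq0 opprB.
pose z := sqrtc ((1 - c) / (1 + c)).
have z2 : z ^+ 2 = (1 - c) / (1 + c) by exact: sqr_sqrtc.
pose q : C := 1 + z ^+ 2.
have qE : q * (1 + c) = 2 by rewrite /q z2 mulrDl divfK // mul1r; ring.
have q0 : q != 0.
  by apply/eqP => q0; move/eqP: qE; rewrite q0 mul0r eq_sym pnatr_eq0.
have yE : 1 - z ^+ 2 = c * q.
  apply: (mulIf c1p); rewrite -mulrA qE /q z2 mulrDl mulNr divfK // mul1r.
  by ring.
have z0 : z != 0.
  by rewrite -sqrf_eq0 z2 mulf_neq0 // invr_eq0.
have B2 : toC be ^+ 2 = 1 - 3 * toC T ^+ 2 by rewrite T2C; ring.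
have bc2 : (toC be * c) ^+ 2 = 1 - 2 * I * toC T - toC T ^+ 2.
  by rewrite bc; ring: I2.
have dz : dir_den (toC be) (1 + z ^+ 2) (1 - z ^+ 2) = 0.
  rewrite yE -/q /dir_den.
  transitivity (q ^+ 2 * (4 - toC be ^+ 2 + 6 * (toC be * c) + 3 * (toC be * c) ^+ 2)).
    by ring.
  by rewrite bc2 bc B2; ring.
pose y := 2 * z.
have y0 : y != 0 by rewrite mulf_neq0 // pnatr_eq0.
have y2 : y ^+ 2 = (1 - c ^+ 2) * q ^+ 2.
  transitivity (q ^+ 2 - (1 - z ^+ 2) ^+ 2); first by rewrite /q /y; ring.
  by rewrite yE; ring.
have fz0 : q + toC be * (c * q) != 0.
  have -> : q + toC be * (c * q) = I * toC T * q by rewrite mulrA bc; ring.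
  by rewrite !mulf_neq0.
pose fac (s : C) := 2 * (toC k01 - toC k10) * (q + toC be * (c * q)) * q ^+ 2
  - toC be * s * (toC k00 * (c * q) ^+ 2 + (toC k01 + toC k10) * (c * q) * s
                  + toC k11 * s ^+ 2).
have fac0 s : s != 0 -> dir_num (toC be) (toC k00) (toC k01) (toC k10) (toC k11)
      q (c * q) s ^+ 2 * q ^+ m = 0 -> fac s = 0.
  move=> s0 /eqP; rewrite mulf_eq0 [q ^+ m == 0]expf_eq0 (negPf q0) andbF orbF.
  by rewrite expf_eq0 /= /dir_num !mulf_eq0 (negPf fz0) (negPf s0) => /eqP.
have f1 : fac y = 0 by apply: (fac0 _ y0); rewrite -yE; exact: ev dz.
have f2 : fac (- y) = 0.
  apply: fac0; first by rewrite oppr_eq0.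
  have := ev (- z); rewrite sqrrN mulrN => /(_ dz) evz.
  by rewrite -yE; exact: evz.
have e1 : toC k00 * c ^+ 2 + toC k11 * (1 - c ^+ 2) = 0.
  have w : - 2 * toC be * y * q ^+ 2 != 0.
    by rewrite !mulf_neq0 // ?expf_neq0 // oppr_eq0 pnatr_eq0.
  apply: (mulfI w); rewrite mulr0; transitivity (fac y - fac (- y)).
    by rewrite /fac; ring: y2.
  by rewrite f1 f2 subrr.
have e2 : 2 * (toC k01 - toC k10) * (I * toC T)
    = toC be * (toC k01 + toC k10) * c * (1 - c ^+ 2).
  have w : 2 * q ^+ 3 != 0 by rewrite mulf_neq0 ?expf_neq0 // pnatr_eq0.
  apply: (mulfI w); apply/eqP; rewrite -subr_eq0; apply/eqP.
  transitivity (fac y + fac (- y)); last by rewrite f1 f2 addr0.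
  have -> : I * toC T = 1 + toC be * c by rewrite bc; ring.
  by rewrite /fac; ring: y2.
have [r1 r2] : (k00 - k11) * (1 - T ^+ 2) + k11 * be ^+ 2 = 0
    /\ - 2 * T * (k00 - k11) = 0.
  apply: real_imag_eq0; rewrite -[RHS](mulr0 (toC be ^+ 2)) -e1.
  transitivity (toC k00 * (toC be * c) ^+ 2
    + toC k11 * (toC be ^+ 2 - (toC be * c) ^+ 2)); last by ring.
  by rewrite bc2; ring.
have k0011 : k00 = k11.
  apply/eqP; rewrite -subr_eq0; apply/eqP.
  by move/eqP: r2; rewrite !mulf_eq0 (negPf T0) oppr_eq0 pnatr_eq0 /= => /eqP.
have k11_0 : k11 = 0.
  move: r1; rewrite k0011 subrr mul0r add0r => /eqP.
  by rewrite mulf_eq0 expf_eq0 (negPf be0) andbF orbF => /eqP.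
split; [by rewrite k0011|by []|].
have e3 : be ^+ 2 * (k01 - k10) = - (k01 + k10) * (1 + T ^+ 2).
  apply: (fmorph_inj toC).
  have w : 2 * I * toC T != 0 by rewrite !mulf_neq0 // pnatr_eq0.
  apply: (mulfI w).
  transitivity (toC be ^+ 2 * (2 * (toC k01 - toC k10) * (I * toC T))); first by ring.
  rewrite e2.
  transitivity ((toC k01 + toC k10) * (toC be * c) * (toC be ^+ 2 - (toC be * c) ^+ 2)).
    by ring.
  by rewrite bc2 bc B2; ring: I2.
have -> : 4 - be ^+ 2 = 3 * (1 + T ^+ 2) by rewrite mulrDr T2; ring.
by rewrite [RHS]mulrCA -e3; ring.
Qed.

End ComplexDirection.

(** * First-order consequences of the Einstein condition *)

Section NormalizedPoint.
Context {R : realType}.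

(** The expression squared in [ricci_sqroot_pole], at a point where the metric is
    the unit matrix to first order and beta is be times the first coordinate form.
    Only its class modulo the denominator matters. *)
Lemma pole_numerator (be k00 k01 k10 k11 s t q : R) (l := be * s)
    (H := fun aij wi wj ci cj => 2 * aij + q^-1 * (aij * l + wi * cj + wj * ci)
                                  - q^-1 ^+ 3 * wi * wj * l)
    (h00 := H 1 s s be be) (h01 := H 0 s t be 0) (h10 := H 0 t s 0 be)
    (h11 := H 1 t t 0 0)
    (lx0 := k00 * s + k10 * t) (lx1 := k01 * s + k11 * t)
    (E := fun yl kl0 kl1 lxl => (q^-1 * yl * lx0 + q * kl0) * s
            + (q^-1 * yl * lx1 + q * kl1) * t - q * lxl)
    (E0 := E s k00 k01 lx0) (E1 := E t k10 k11 lx1)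
    (D := fun w c => 8 * w + 6 * (q^-1 * w * l + q * c) + 6 * l * c
                     - 2 * be ^+ 2 * w)
    (r := k00 * s ^+ 2 + (k01 + k10) * s * t + k11 * t ^+ 2) :
  q != 0 -> q ^+ 2 = s * s + t * t ->
  2^-1 * q ^+ 2 * (h11 * E0 - h01 * E1) * D s be
  + 2^-1 * q ^+ 2 * (h00 * E1 - h10 * E0) * D t 0 =
  3 * be * ((q + be * s) * t * (2 * (k01 - k10) * (q + be * s) * q ^+ 2 - be * t * r))
  + dir_den be q s * (r * (2 * q + be * s) - be * (k01 - k10) * t * q ^+ 2).
Proof.
move=> q0 qE; rewrite /h00 /h01 /h10 /h11 /E0 /E1 /D /E /H /r /lx0 /lx1 /l /dir_den.
by field: qE.
Qed.

End NormalizedPoint.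

Ltac build_apoly leaf :=
  lazymatch goal with
  | |- apoly ?U ?a (fun x y => @?H x y + @?K x y) =>
      refine (@apolyD _ U a H K _ _); build_apoly leaf
  | |- apoly ?U ?a (fun x y => @?H x y * @?K x y) =>
      refine (@apolyM _ U a H K _ _); build_apoly leaf
  | |- apoly ?U ?a (fun x y => - (@?H x y)) =>
      refine (@apolyN _ U a H _); build_apoly leaf
  | |- apoly ?U ?a (fun x y => @?H x y ^+ 2) =>
      refine (@apolyM _ U a H H _ _); build_apoly leaf
  | |- apoly _ _ (fun _ y => fun_of_matrix y _ ?j) => exact: apoly_y
  | |- apoly _ _ (fun _ _ => ?c) => exact: apoly_cst
  | |- apoly _ _ (fun x y => qsqrt _ x y) => exact: apoly_qsqrt
  | |- _ => leaf
  end.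

Section EinsteinPoint.
Context {R : realType}.
Variables (U : set 'rV[R]_2) (a : 'rV[R]_2 -> 'M[R]_2) (b : 'rV[R]_2 -> 'rV[R]_2).
Hypotheses (oU : open U) (hF : is_sqroot_metric a b U).
Variables (p : 'rV[R]_2) (be : R).
Hypotheses (Up : U p) (ap : a p = 1%:M) (b0 : b p 0 0 = be) (b1 : b p 0 1 = 0).
Hypothesis da : forall k, [/\ pd k (e00 a) p = 0, pd k (e01 a) p = 0 & pd k (e11 a) p = 0].
Let k00 := pd 0 (cb0 b) p.
Let k01 := pd 1 (cb0 b) p.
Let k10 := pd 0 (cb1 b) p.
Let k11 := pd 1 (cb1 b) p.

Let E00 : e00 a p = 1. Proof. by rewrite /e00 ap mxE. Qed.
Let E01 : e01 a p = 0. Proof. by rewrite /e01 ap mxE. Qed.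
Let E11 : e11 a p = 1. Proof. by rewrite /e11 ap mxE. Qed.

Let gram1 : gram a p = 1.
Proof. by rewrite /gram E00 E01 E11; ring. Qed.

Let gram_norm_be : gram_norm a b p = be ^+ 2.
Proof. by rewrite /gram_norm E00 E01 E11 /cb0 /cb1 b0 b1; ring. Qed.

Let qform_p y : qform a p y = y 0 0 * y 0 0 + y 0 1 * y 0 1.
Proof. by rewrite /qform E00 E01 E11; ring. Qed.

Let lform_p y : lform b p y = be * y 0 0.
Proof. by rewrite /lform /cb0 /cb1 b0 b1; ring. Qed.

Let qcov_p i y : qcov a i p y = y 0 i.
Proof. by rewrite /qcov E00 E01 E11; elim/ord2P: i => /=; ring. Qed.

Let sq_det_p y : y != 0 -> sq_det a b p y = dir_den be (qsqrt a p y) (y 0 0).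
Proof.
move=> y0; have := qsqrt_sq hF Up y0; rewrite qform_p => qE.
rewrite /sq_det gram1 gram_norm_be qform_p lform_p -qE /dir_den; ring.
Qed.

Let sq_det_y_p i y : y != 0 -> Dy i (sq_det a b) p y =
  8 * y 0 i + 6 * ((qsqrt a p y)^-1 * y 0 i * (be * y 0 0) + qsqrt a p y * b p 0 i)
  + 6 * (be * y 0 0) * b p 0 i - 2 * be ^+ 2 * y 0 i.
Proof.
move=> y0; rewrite (sq_det_y oU hF) // gram1 gram_norm_be lform_p qcov_p /iqsqrt.
by rewrite /cb /cb0 /cb1; elim/ord2P: i => /=; ring.
Qed.

Let L_yy_p i j y : y != 0 -> Dy j (Dy i (sqroot_sq a b)) p y =
  2 * (i == j)%:R + (qsqrt a p y)^-1 * ((i == j)%:R * (be * y 0 0)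
    + y 0 i * b p 0 j + y 0 j * b p 0 i)
  - (qsqrt a p y)^-1 ^+ 3 * y 0 i * y 0 j * (be * y 0 0).
Proof.
move=> y0; rewrite (sqroot_yy oU hF) // lform_p !qcov_p /iqsqrt /ee /cb.
by elim/ord2P: i; elim/ord2P: j => /=; rewrite ?E00 ?E01 ?E11 /cb0 /cb1; ring.
Qed.

Let qform_x_p k y : qform_x a k p y = 0.
Proof. by have [e1 e2 e3] := da k; rewrite /qform_x e1 e2 e3; ring. Qed.

Let qcov_x_p k l y : qcov_x a k l p y = 0.
Proof. by have [e1 e2 e3] := da k; rewrite /qcov_x e1 e2 e3; elim/ord2P: l => /=; ring. Qed.

Let L_x_p k y : y != 0 -> Dx k (sqroot_sq a b) p y = qsqrt a p y * lform_x b k p y.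
Proof. by move=> y0; rewrite (sqroot_x oU hF) // qform_x_p; ring. Qed.

Let L_xy_p k l y : y != 0 -> Dy l (Dx k (sqroot_sq a b)) p y =
  (qsqrt a p y)^-1 * y 0 l * lform_x b k p y + qsqrt a p y * pd k (cb b l) p.
Proof.
by move=> y0; rewrite (sqroot_xy oU hF) // qform_x_p qcov_x_p qcov_p /iqsqrt; ring.
Qed.

Let pole_value y : y != 0 ->
  \sum_j spray_num a b j p y * Dy j (sq_det a b) p y =
  3 * be * ((qsqrt a p y + be * y 0 0) * y 0 1 *
    (2 * (k01 - k10) * (qsqrt a p y + be * y 0 0) * qsqrt a p y ^+ 2 - be * y 0 1 *
      (k00 * y 0 0 ^+ 2 + (k01 + k10) * y 0 0 * y 0 1 + k11 * y 0 1 ^+ 2)))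
  + sq_det a b p y * ((k00 * y 0 0 ^+ 2 + (k01 + k10) * y 0 0 * y 0 1 + k11 * y 0 1 ^+ 2)
    * (2 * qsqrt a p y + be * y 0 0) - be * (k01 - k10) * y 0 1 * qsqrt a p y ^+ 2).
Proof.
move=> y0; have q0 := qsqrt_neq0 hF Up y0.
have := qsqrt_sq hF Up y0; rewrite qform_p => qE.
rewrite sq_det_p // sum2 !sq_det_y_p // b0 b1 /spray_num /=.
rewrite !(spray_rhs_sqroot oU hF) // !L_yy_p // !L_xy_p // !L_x_p // /cb /=.
rewrite b0 b1 /lform_x -/k00 -/k01 -/k10 -/k11.
have := pole_numerator be k00 k01 k10 k11 q0 qE.
by move=> <-.
Qed.

(** If the curvature is a multiple of F^2, then it has no pole, so the denominator
    divides the square in [ricci_sqroot_pole]; along the directions [dir] this is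
    the hypothesis of [pole_conditions]. *)
Lemma einstein_normalized : be != 0 -> einstein U (sqroot_metric a b) ->
  [/\ k00 = 0, k11 = 0 & 3 * be ^+ 2 * (k01 - k10) = - (k01 + k10) * (4 - be ^+ 2)].
Proof.
move=> be0 [lam hlam].
have be1 : be ^+ 2 < 1 by rewrite -gram_norm_be -gram1; exact: (gram_norm_lt hF).
pose num : @tfun R 2 := fun x y => (qsqrt a x y + be * y 0 0) * y 0 1 *
    (2 * (k01 - k10) * (qsqrt a x y + be * y 0 0) * qsqrt a x y ^+ 2 - be * y 0 1 *
      (k00 * y 0 0 ^+ 2 + (k01 + k10) * y 0 0 * y 0 1 + k11 * y 0 1 ^+ 2)).
pose Z : @tfun R 2 := fun x y =>
  (k00 * y 0 0 ^+ 2 + (k01 + k10) * y 0 0 * y 0 1 + k11 * y 0 1 ^+ 2)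
    * (2 * qsqrt a x y + be * y 0 0) - be * (k01 - k10) * y 0 1 * qsqrt a x y ^+ 2.
pose S : @tfun R 2 := fun x y => (27 * be ^+ 2)^-1 *
  (sq_det a b x y * sq_det a b x y * sq_det a b x y * (lam p * sqroot_sq a b x y)
   - sq_rest a b x y - 3 * (6 * be * num x y * Z x y + sq_det a b x y * Z x y ^+ 2)).
have pS : apoly U a S.
  have pd' : apoly U a (fun x y => sq_det a b x y) := apoly_sq_det hF.
  have pL : apoly U a (fun x y => sqroot_sq a b x y) := apoly_sqroot_sq hF.
  have pr : apoly U a (fun x y => sq_rest a b x y) := apoly_sq_rest oU hF.
  rewrite /S /num /Z; build_apoly ltac:(idtac; lazymatch goal with
    | |- apoly _ _ (fun x y => sq_det _ _ x y) => exact: pd'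
    | |- apoly _ _ (fun x y => sqroot_sq _ _ x y) => exact: pL
    | |- apoly _ _ (fun x y => sq_rest _ _ x y) => exact: pr
    end).
have [N [m HN]] := apoly_rational Up ap pS.
apply: (@pole_conditions _ be k00 k01 k10 k11 N m) => // t.
rewrite -HN; have y0 := dir_neq0 t; have q := qsqrt_dir t ap.
have -> : dir_num be k00 k01 k10 k11 (1 + t ^+ 2) (1 - t ^+ 2) (2 * t) = num p (dir t).
  by rewrite /num q !mxE /= /dir_num.
have -> : dir_den be (1 + t ^+ 2) (1 - t ^+ 2) = sq_det a b p (dir t).
  by rewrite sq_det_p // q !mxE.
have := ricci_sqroot_pole oU hF Up y0; rewrite hlam // pole_value //.
have -> : sqroot_metric a b p (dir t) ^+ 2 = sqroot_sq a b p (dir t).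
  exact: (sqF_sqroot hF).
have -> : 2 - 1 = 1 :> R by ring.
rewrite mul1r => E; rewrite mulrA; congr (_ * _).
have E1 : 27 * be ^+ 2 * num p (dir t) ^+ 2 = sq_det a b p (dir t) *
    (27 * be ^+ 2 * S p (dir t)).
  rewrite /S mulVKf; last by rewrite mulf_neq0 ?expf_neq0 // pnatr_eq0.
  move: E; rewrite -/(num p (dir t)) -/(Z p (dir t)).
  move: (sq_det _ _ _ _) (sqroot_sq _ _ _ _) (sq_rest _ _ _ _) (num _ _) (Z _ _).
  by move=> D L r n z E; refine (add_multiple E (c := -1) _); ring.
have w : 27 * be ^+ 2 != 0 :> R by rewrite mulf_neq0 ?expf_neq0 // pnatr_eq0.
by apply: (mulfI w); rewrite E1; ring.
Qed.

End EinsteinPoint.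

(** * Pull-back of square-root metrics *)

Section PullSqroot.
Context {R : realType}.
Variables (U V : set 'rV[R]_2) (a : 'rV[R]_2 -> 'M[R]_2) (b : 'rV[R]_2 -> 'rV[R]_2).
Variable psi : 'rV[R]_2 -> 'rV[R]_2.
Hypotheses (oU : open U) (hF : is_sqroot_metric a b U).
Hypotheses (oV : open V) (psiVU : forall x, V x -> U (psi x)).
Hypothesis spsi : smooth_map V psi.
Implicit Types x y : 'rV[R]_2.
Let p (m l : 'I_2) := pd l (fun x => psi x 0 m).
Definition jac (psi : 'rV[R]_2 -> 'rV[R]_2) x : R :=
  pd 0 (fun x => psi x 0 0) x * pd 1 (fun x => psi x 0 1) x
  - pd 1 (fun x => psi x 0 0) x * pd 0 (fun x => psi x 0 1) x.
Hypothesis jac_gt0 : forall x, V x -> 0 < jac psi x.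

Definition pull_a x : 'M[R]_2 :=
  \matrix_(i, j) \sum_k \sum_l p k i x * p l j x * a (psi x) k l.
Definition pull_b x : 'rV[R]_2 := \row_i \sum_k p k i x * b (psi x) 0 k.

Let J x y : 'rV[R]_2 := \row_m \sum_l partial l (fun x => psi x 0 m) x * y 0 l.

Let JE x y m : J x y 0 m = p m 0 x * y 0 0 + p m 1 x * y 0 1.
Proof.
rewrite mxE (eq_bigr (fun l => p m l x * y 0 l)) ?sum2 // => l _.
by rewrite pdE.
Qed.

(** The pull-back of a square-root metric is the square-root metric of the pulled
    back data, hence curvature conditions can be checked in adapted coordinates. *)
Lemma sqroot_pull : sqroot_metric pull_a pull_b = tpull psi (sqroot_metric a b).
Proof.
apply/funext => x; apply/funext => y; rewrite /tpull -/(J x y).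
have -> : sqroot_metric a b (psi x) (J x y) = Num.sqrt
    (Num.sqrt (\sum_i \sum_j a (psi x) i j * J x y 0 i * J x y 0 j) *
     (Num.sqrt (\sum_i \sum_j a (psi x) i j * J x y 0 i * J x y 0 j)
      + \sum_i b (psi x) 0 i * J x y 0 i)) by [].
rewrite /sqroot_metric /alpha /beta !sum2 !JE !mxE !sum2.
by congr (Num.sqrt (Num.sqrt _ * (Num.sqrt _ + _))); ring.
Qed.

Lemma smooth_psi_comp f : smooth U f -> smooth V (fun x => f (psi x)).
Proof. by move=> sf; exact: (smooth_comp oV psiVU spsi sf). Qed.

Let sp m l : smooth V (p m l). Proof. exact: smooth_pd. Qed.

Lemma pull_e00 x : V x -> e00 pull_a x = p 0 0 x * p 0 0 x * e00 a (psi x)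
  + 2 * p 0 0 x * p 1 0 x * e01 a (psi x) + p 1 0 x * p 1 0 x * e11 a (psi x).
Proof.
move=> Vx; have [[_ /(_ _ 1 0 (psiVU Vx)) a10 _] _ _] := hF.
by rewrite /e00 /e01 /e11 mxE !sum2 a10; ring.
Qed.

Lemma pull_e01 x : V x -> e01 pull_a x = p 0 0 x * p 0 1 x * e00 a (psi x)
  + (p 0 0 x * p 1 1 x + p 1 0 x * p 0 1 x) * e01 a (psi x)
  + p 1 0 x * p 1 1 x * e11 a (psi x).
Proof.
move=> Vx; have [[_ /(_ _ 1 0 (psiVU Vx)) a10 _] _ _] := hF.
by rewrite /e00 /e01 /e11 mxE !sum2 a10; ring.
Qed.

Lemma pull_e11 x : V x -> e11 pull_a x = p 0 1 x * p 0 1 x * e00 a (psi x)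
  + 2 * p 0 1 x * p 1 1 x * e01 a (psi x) + p 1 1 x * p 1 1 x * e11 a (psi x).
Proof.
move=> Vx; have [[_ /(_ _ 1 0 (psiVU Vx)) a10 _] _ _] := hF.
by rewrite /e00 /e01 /e11 mxE !sum2 a10; ring.
Qed.

Lemma pull_cb0 x : cb0 pull_b x = p 0 0 x * cb0 b (psi x) + p 1 0 x * cb1 b (psi x).
Proof. by rewrite /cb0 /cb1 mxE sum2. Qed.

Lemma pull_cb1 x : cb1 pull_b x = p 0 1 x * cb0 b (psi x) + p 1 1 x * cb1 b (psi x).
Proof. by rewrite /cb0 /cb1 mxE sum2. Qed.

Lemma gram_pull x : V x -> gram pull_a x = jac psi x ^+ 2 * gram a (psi x).
Proof.
by move=> Vx; rewrite /gram pull_e00 // pull_e01 // pull_e11 // /jac -!/(p _ _); ring.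
Qed.

Lemma gram_norm_pull x : V x ->
  gram_norm pull_a pull_b x = jac psi x ^+ 2 * gram_norm a b (psi x).
Proof.
move=> Vx; rewrite /gram_norm pull_e00 // pull_e01 // pull_e11 //.
by rewrite pull_cb0 pull_cb1 /jac -!/(p _ _); ring.
Qed.

Let psi_det x : V x -> p 0 0 x * p 1 1 x - p 0 1 x * p 1 0 x != 0.
Proof. by move=> Vx; rewrite gt_eqF //; exact: (jac_gt0 Vx). Qed.

Let J_neq0 x y : V x -> y != 0 -> J x y != 0.
Proof. exact: (pull_push_neq0 psi_det). Qed.

Lemma is_sqroot_pull : is_sqroot_metric pull_a pull_b V.
Proof.
have [[sa aS apos] sb _] := hF.
have rp : riemannian pull_a V.
  split=> [i j|x i j Vx|x y Vx y0].
  - apply: (smooth_eq (f := fun x => \sum_k \sum_l p k i x * p l j x * a (psi x) k l) oV).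
      by move=> x _; rewrite mxE.
    apply: smooth_sum => // k; apply: smooth_sum => // l.
    by do 2?apply: smoothM => //; exact: (smooth_psi_comp (sa k l)).
  - rewrite !mxE exchange_big /=; apply: eq_bigr => k _; apply: eq_bigr => l _.
    by rewrite (aS _ l k) ?(mulrC (p l i x)) //; exact: psiVU.
  - have := apos _ _ (psiVU Vx) (J_neq0 Vx y0).
    rewrite !sum2 !JE !mxE !sum2.
    set u := (X in 0 < X -> _); set v := (X in _ -> 0 < X).
    by have -> : u = v by rewrite /u /v; ring.
have hs : smooth_map V pull_b.
  move=> i; apply: (smooth_eq (f := fun x => \sum_k p k i x * b (psi x) 0 k) oV).
    by move=> x _; rewrite mxE.
  apply: smooth_sum => // k; apply: smoothM => //.
  exact: (smooth_psi_comp (sb k)).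
split=> // x Vx.
have [_ _ bn] := hF; have := bn _ (psiVU Vx); rewrite (beta_normE hF (psiVU Vx)).
have j0 := lt0r_neq0 (jac_gt0 Vx); have g0 := lt0r_neq0 (gram_gt0 hF (psiVU Vx)).
rewrite beta_norm_gram; first last.
- by rewrite gram_pull // mulf_neq0 // expf_neq0.
- by have [_ aS' _] := rp; exact: aS'.
rewrite gram_pull // gram_norm_pull // => h.
by rewrite invfM mulrACA divff ?mul1r // expf_neq0.
Qed.

Lemma einstein_pull :
  einstein U (sqroot_metric a b) -> einstein V (sqroot_metric pull_a pull_b).
Proof.
move=> [lam hlam]; exists (fun x => lam (psi x)) => x y Vx y0.
rewrite sqroot_pull (ricci_pull oV oU psiVU spsi psi_det (regular_sqroot oU hF) Vx y0).
by rewrite /tpull hlam //; [exact: psiVU|exact: J_neq0].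
Qed.

End PullSqroot.

(** * The orthonormal coframe along beta *)

Section FunctionsOfPoint.
Context {R : realType} {n : nat}.
Variable U : set 'rV[R]_n.
Hypothesis oU : open U.
Implicit Types (x y : 'rV[R]_n) (f : 'rV[R]_n -> R).

Lemma pd_tderiv k f H x y : is_tderiv U (inl k) (fun x _ => f x) H ->
  U x -> y != 0 -> pd k f x = H x y.
Proof. by move=> [_ dH] Ux y0; rewrite -dH //= -DxE -pdE. Qed.

Lemma pd_coord j k x : pd k (fun x => x 0 j) x = (k == j)%:R.
Proof. by rewrite -pdE partial_coord. Qed.

Lemma pd_comp m (V : set 'rV[R]_m) (psi : 'rV[R]_m -> 'rV[R]_n) f k
    (x : 'rV[R]_m) :
  (forall z, V z -> U (psi z)) -> (forall j, smooth V (fun z => psi z 0 j)) ->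
  smooth U f -> V x ->
  pd k (fun z => f (psi z)) x = \sum_j pd k (fun z => psi z 0 j) x * pd j f (psi x).
Proof.
move=> pVU sp sf Vx; rewrite -pdE partial_comp; last first.
- by apply: smooth_diff sf _; exact: pVU.
- by move=> j; exact: smooth_diff (sp j) Vx.
by apply: eq_bigr => j _; rewrite !pdE.
Qed.

End FunctionsOfPoint.

Section Coframe.
Context {R : realType}.
Variables (a : 'rV[R]_2 -> 'M[R]_2) (b : 'rV[R]_2 -> 'rV[R]_2).
Implicit Types x y : 'rV[R]_2.

Definition bsq x := gram_norm a b x / gram a x.

(** This is (1 - B)^(3/4), written with square roots so that the rules of
    derivation apply. *)
Definition sig x := Num.sqrt (Num.sqrt ((1 - bsq x) * (1 - bsq x) * (1 - bsq x))).
Definition rho x := sig x / bsq x.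
(** The components of the Hodge dual of beta. *)
Definition star0 x := - (e00 a x * cb1 b x - e01 a x * cb0 b x) / Num.sqrt (gram a x).
Definition star1 x := (e11 a x * cb0 b x - e01 a x * cb1 b x) / Num.sqrt (gram a x).

(** The multiples [om2] of beta and [om1] of its Hodge dual become the
    differentials of the coordinates of the normal form. *)
Definition om1 (i : 'I_2) x := rho x * (if i == 0 then star0 x else star1 x).
Definition om2 (i : 'I_2) x := rho x * cb b i x.

Variable U : set 'rV[R]_2.
Hypotheses (oU : open U) (hF : is_sqroot_metric a b U).
Hypothesis bn0 : forall x, U x -> 0 < gram_norm a b x.

Lemma bsq_gt0 x : U x -> 0 < bsq x.
Proof. by move=> Ux; rewrite divr_gt0 ?bn0 // (gram_gt0 hF). Qed.

Lemma bsq_lt1 x : U x -> bsq x < 1.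
Proof.
move=> Ux; rewrite ltr_pdivrMr ?(gram_gt0 hF) // mul1r.
exact: (gram_norm_lt hF).
Qed.

Let cube_gt0 x : U x -> 0 < (1 - bsq x) * (1 - bsq x) * (1 - bsq x).
Proof. by move=> Ux; rewrite !mulr_gt0 // subr_gt0 bsq_lt1. Qed.

Lemma sig_gt0 x : U x -> 0 < sig x.
Proof. by move=> Ux; rewrite !sqrtr_gt0 cube_gt0. Qed.

Lemma sig4 x : U x -> sig x ^+ 4 = (1 - bsq x) ^+ 3.
Proof.
move=> Ux; rewrite -[4%N]/(2 * 2)%N exprM !sqr_sqrtr ?sqrtr_ge0 ?ltW ?cube_gt0 //.
by rewrite !exprS expr0 mulr1 mulrA.
Qed.

Let se00 := smooth_e00 hF.
Let se01 := smooth_e01 hF.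
Let se11 := smooth_e11 hF.
Let scb0 := smooth_cb0 hF.
Let scb1 := smooth_cb1 hF.

Ltac coef_leaf :=
  lazymatch goal with
  | |- is_tderiv _ _ (fun x _ => e00 _ x) _ => exact: (is_tderiv_x oU _ se00)
  | |- is_tderiv _ _ (fun x _ => e01 _ x) _ => exact: (is_tderiv_x oU _ se01)
  | |- is_tderiv _ _ (fun x _ => e11 _ x) _ => exact: (is_tderiv_x oU _ se11)
  | |- is_tderiv _ _ (fun x _ => cb0 _ x) _ => exact: (is_tderiv_x oU _ scb0)
  | |- is_tderiv _ _ (fun x _ => cb1 _ x) _ => exact: (is_tderiv_x oU _ scb1)
  end.

Lemma smooth_gram : smooth U (gram a).
Proof. by rewrite /gram; apply: smoothB => //; exact: smoothM. Qed.

Lemma smooth_gram_norm : smooth U (gram_norm a b).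
Proof.
rewrite /gram_norm; apply: smoothD => //; last by do 2?apply: smoothM => //.
apply: smoothB => //; first by do 2?apply: smoothM => //.
by do 3?apply: smoothM => //; exact: smooth_cst.
Qed.

Lemma smooth_bsq : smooth U bsq.
Proof.
apply: (smoothM oU smooth_gram_norm); apply: (smoothV oU) smooth_gram => x Ux.
by rewrite gt_eqF // (gram_gt0 hF).
Qed.

Let s1B : smooth U (fun x => 1 - bsq x).
Proof. by apply: smoothB => //; [exact: smooth_cst|exact: smooth_bsq]. Qed.

Lemma smooth_sig : smooth U sig.
Proof.
apply: (smooth_sqrt oU) => [x Ux|]; first by rewrite sqrtr_gt0 cube_gt0.
by apply: (smooth_sqrt oU) => [x Ux|]; [exact: cube_gt0|do 2?apply: smoothM => //].
Qed.

Lemma smooth_rho : smooth U rho.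
Proof.
apply: (smoothM oU smooth_sig); apply: (smoothV oU) smooth_bsq => x Ux.
by rewrite gt_eqF // bsq_gt0.
Qed.

Let s_isqrt : smooth U (fun x => (Num.sqrt (gram a x))^-1).
Proof.
apply: (smoothV oU) => [x Ux|]; first by rewrite gt_eqF // sqrtr_gt0 (gram_gt0 hF).
by apply: (smooth_sqrt oU) smooth_gram => x Ux; exact: (gram_gt0 hF).
Qed.

Lemma smooth_star0 : smooth U star0.
Proof.
apply: (smoothM oU) s_isqrt; apply: smoothN => //.
by apply: smoothB => //; exact: smoothM.
Qed.

Lemma smooth_star1 : smooth U star1.
Proof.
by apply: (smoothM oU) s_isqrt; apply: smoothB => //; exact: smoothM.
Qed.

Lemma smooth_om1 i : smooth U (om1 i).
Proof.
elim/ord2P: i; first exact: (smoothM oU smooth_rho smooth_star0).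
exact: (smoothM oU smooth_rho smooth_star1).
Qed.

Lemma smooth_om2 i : smooth U (om2 i).
Proof.
by elim/ord2P: i; [exact: (smoothM oU smooth_rho scb0)|exact: (smoothM oU smooth_rho scb1)].
Qed.

Let y1 : 'rV[R]_2 := dir 0.
Let y1_neq0 : y1 != 0 := dir_neq0 0.

Lemma pd_mul k f g x : smooth U f -> smooth U g -> U x ->
  pd k (fun x => f x * g x) x = pd k f x * g x + f x * pd k g x.
Proof.
move=> sf sg Ux.
exact: (pd_tderiv (is_tderivM oU (is_tderiv_x oU (inl k) sf) (is_tderiv_x oU (inl k) sg))
  Ux y1_neq0).
Qed.

Lemma pd_inv k f x : (forall x, U x -> f x != 0) -> smooth U f -> U x ->
  pd k (fun x => (f x)^-1) x = - (f x) ^- 2 * pd k f x.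
Proof.
move=> f0 sf Ux.
exact: (pd_tderiv (is_tderivV oU (fun x y Ux _ => f0 x Ux) (is_tderiv_x oU (inl k) sf))
  Ux y1_neq0).
Qed.

Lemma pd_sqrt k f x : (forall x, U x -> 0 < f x) -> smooth U f -> U x ->
  pd k (fun x => Num.sqrt (f x)) x = (2 * Num.sqrt (f x))^-1 * pd k f x.
Proof.
move=> f0 sf Ux.
exact: (pd_tderiv (is_tderiv_sqrt oU (fun x y Ux _ => f0 x Ux) (is_tderiv_x oU (inl k) sf))
  Ux y1_neq0).
Qed.

Lemma pd_sub k f g x : smooth U f -> smooth U g -> U x ->
  pd k (fun x => f x - g x) x = pd k f x - pd k g x.
Proof.
move=> sf sg Ux.
exact: (pd_tderiv (is_tderivD oU (is_tderiv_x oU (inl k) sf)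
  (is_tderivN oU (is_tderiv_x oU (inl k) sg))) Ux y1_neq0).
Qed.

Lemma pd_rho k x : U x -> pd k rho x =
  - rho x * pd k bsq x * (3 / (4 * (1 - bsq x)) + (bsq x)^-1).
Proof.
move=> Ux; have B0 := lt0r_neq0 (bsq_gt0 Ux).
have B1 : 1 - bsq x != 0 by rewrite gt_eqF // subr_gt0 bsq_lt1.
have s0 := lt0r_neq0 (sig_gt0 Ux).
have d1 : pd k (fun x => 1 - bsq x) x = - pd k bsq x.
  rewrite (pd_sub k (smooth_cst U 1) smooth_bsq Ux).
  by rewrite -[pd k (fun=> 1)]pdE partial_cst add0r.
have ds : pd k sig x = - (3 / (4 * (1 - bsq x))) * sig x * pd k bsq x.
  have s2 : smooth U (fun x => (1 - bsq x) * (1 - bsq x)) by exact: smoothM.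
  have s3 : smooth U (fun x => (1 - bsq x) * (1 - bsq x) * (1 - bsq x)).
    exact: smoothM.
  have sr := smooth_sqrt oU cube_gt0 s3.
  have r0 z : U z -> 0 < Num.sqrt ((1 - bsq z) * (1 - bsq z) * (1 - bsq z)).
    by move=> Uz; rewrite sqrtr_gt0 cube_gt0.
  rewrite [LHS](pd_sqrt k r0 sr Ux) (pd_sqrt k cube_gt0 s3 Ux).
  rewrite (pd_mul k s2 s1B Ux) (pd_mul k s1B s1B Ux) d1 -/(sig x).
  have w2 : Num.sqrt ((1 - bsq x) * (1 - bsq x) * (1 - bsq x)) = sig x ^+ 2.
    by rewrite sqr_sqrtr ?sqrtr_ge0.
  rewrite w2; have s4 := sig4 Ux.
  move: (sig x) (pd k bsq x) s0 s4 B1; move: (1 - bsq x) => u w B' s0 s4 u0.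
  by field: s4; rewrite u0 s0.
rewrite [LHS]pd_mul //; [|exact: smooth_sig|]; last first.
  by apply: (smoothV oU) smooth_bsq => z Uz; rewrite gt_eqF // bsq_gt0.
rewrite pd_inv // => [|z Uz|]; [|by rewrite gt_eqF // bsq_gt0|exact: smooth_bsq].
rewrite ds /rho; move: (sig x) (pd k bsq x) (bsq x) B0 B1 => w B' B B0 B1.
by field; rewrite B0 B1.
Qed.

(** The component of the exterior derivative of the 1-form (f, g). *)
Definition curl (f g : 'rV[R]_2 -> R) x := pd 0 g x - pd 1 f x.

Lemma curl_om2 x : U x -> curl (om2 0) (om2 1) x = rho x *
  (pd 0 (cb1 b) x - pd 1 (cb0 b) x - (3 / (4 * (1 - bsq x)) + (bsq x)^-1) *
     (pd 0 bsq x * cb1 b x - pd 1 bsq x * cb0 b x)).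
Proof.
move=> Ux; rewrite /curl [X in X - _]pd_mul // ?[X in _ - X]pd_mul //;
  try exact: smooth_rho.
by rewrite !pd_rho // /cb /=; ring.
Qed.

Lemma curl_om1 x : U x -> curl (om1 0) (om1 1) x = rho x *
  (pd 0 star1 x - pd 1 star0 x - (3 / (4 * (1 - bsq x)) + (bsq x)^-1) *
     (pd 0 bsq x * star1 x - pd 1 bsq x * star0 x)).
Proof.
move=> Ux; rewrite /curl [X in X - _]pd_mul // ?[X in _ - X]pd_mul //;
  try exact: smooth_rho; try exact: smooth_star0; try exact: smooth_star1.
by rewrite !pd_rho //=; ring.
Qed.

Variables (p : 'rV[R]_2) (be : R).
Hypotheses (Up : U p) (ap : a p = 1%:M) (b0 : b p 0 0 = be) (b1 : b p 0 1 = 0).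
Hypothesis da : forall k, [/\ pd k (e00 a) p = 0, pd k (e01 a) p = 0 & pd k (e11 a) p = 0].
Hypotheses (be0 : 0 < be) (hE : einstein U (sqroot_metric a b)).

Let E00 : e00 a p = 1. Proof. by rewrite /e00 ap mxE. Qed.
Let E01 : e01 a p = 0. Proof. by rewrite /e01 ap mxE. Qed.
Let E11 : e11 a p = 1. Proof. by rewrite /e11 ap mxE. Qed.
Let C0 : cb0 b p = be. Proof. by []. Qed.
Let C1 : cb1 b p = 0. Proof. by []. Qed.
Let gram_p : gram a p = 1. Proof. by rewrite /gram E00 E01 E11; ring. Qed.
Let gram_norm_p : gram_norm a b p = be ^+ 2.
Proof. by rewrite /gram_norm E00 E01 E11 C0 C1; ring. Qed.
Let bsq_p : bsq p = be ^+ 2. Proof. by rewrite /bsq gram_p gram_norm_p divr1. Qed.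

Let d_gram k : pd k (gram a) p = 0.
Proof.
have [d0 d1 d2] := da k.
refine (etrans (pd_tderiv (_ : is_tderiv U (inl k) _ ?[H]) Up y1_neq0) _).
  by rewrite /gram; tderive oU ltac:(idtac; coef_leaf).
by rewrite /= d0 d1 d2; ring.
Qed.

Let d_bsq k : pd k bsq p = 2 * be * pd k (cb0 b) p.
Proof.
have [d0 d1 d2] := da k.
rewrite [LHS]pd_mul //; [|exact: smooth_gram_norm|]; last first.
  by apply: (smoothV oU) smooth_gram => x Ux; rewrite gt_eqF // (gram_gt0 hF).
rewrite pd_inv // => [|x Ux|]; [|by rewrite gt_eqF // (gram_gt0 hF)|exact: smooth_gram].
rewrite d_gram gram_p.
have -> : pd k (gram_norm a b) p = 2 * be * pd k (cb0 b) p; last by field.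
refine (etrans (pd_tderiv (_ : is_tderiv U (inl k) _ ?[H]) Up y1_neq0) _).
  by rewrite /gram_norm; tderive oU ltac:(idtac; coef_leaf).
by rewrite /= d0 d1 d2 E00 E01 E11 C0 C1; ring.
Qed.

Let d_isqrt k : pd k (fun x => (Num.sqrt (gram a x))^-1) p = 0.
Proof.
rewrite pd_inv //; last by apply: (smooth_sqrt oU) smooth_gram => x Ux; exact: (gram_gt0 hF).
  rewrite pd_sqrt // ?d_gram ?mulr0 //; first by move=> x Ux; exact: (gram_gt0 hF).
  exact: smooth_gram.
by move=> x Ux; rewrite gt_eqF // sqrtr_gt0 (gram_gt0 hF).
Qed.

Let d_star0 k : pd k star0 p = - pd k (cb1 b) p.
Proof.
have [d0 d1 _] := da k; rewrite [LHS]pd_mul //; last first.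
  by apply: smoothN => //; apply: smoothB => //; exact: smoothM.
rewrite d_isqrt mulr0 addr0 gram_p sqrtr1 invr1 mulr1.
refine (etrans (pd_tderiv (_ : is_tderiv U (inl k) _ ?[H]) Up y1_neq0) _).
  by tderive oU ltac:(idtac; coef_leaf).
by rewrite /= d0 d1 E00 E01 C0 C1; ring.
Qed.

Let d_star1 k : pd k star1 p = pd k (cb0 b) p.
Proof.
have [_ d1 d2] := da k; rewrite [LHS]pd_mul //; last first.
  by apply: smoothB => //; exact: smoothM.
rewrite d_isqrt mulr0 addr0 gram_p sqrtr1 invr1 mulr1.
refine (etrans (pd_tderiv (_ : is_tderiv U (inl k) _ ?[H]) Up y1_neq0) _).
  by tderive oU ltac:(idtac; coef_leaf).
by rewrite /= d1 d2 E11 E01 C0 C1; ring.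
Qed.

(** The factor rho is such that the relation of [einstein_normalized] between the
    two off-diagonal derivatives of beta becomes d om2 = 0; the vanishing of the
    diagonal ones gives the other two equations. *)
Lemma coframe_normalized :
  [/\ curl (om1 0) (om1 1) p = 0, curl (om2 0) (om2 1) p = 0 &
      pd 0 bsq p * star1 p - pd 1 bsq p * star0 p = 0].
Proof.
have [k00 k11 kE] := einstein_normalized oU hF Up ap b0 b1 da (lt0r_neq0 be0) hE.
have s0 : star0 p = 0 by rewrite /star0 E00 E01 C0 C1; ring.
have s1 : star1 p = be by rewrite /star1 E11 E01 C0 C1 gram_p sqrtr1; field.
have B1 : 1 - be ^+ 2 != 0 by rewrite gt_eqF // subr_gt0 -bsq_p bsq_lt1.
rewrite curl_om1 // curl_om2 // !d_bsq d_star0 d_star1 k00 k11 s0 s1 C0 C1 bsq_p.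
split; [by ring| |by ring].
rewrite [X in _ * X](_ : _ = 0) ?mulr0 //.
move: kE B1 (lt0r_neq0 be0); move: (pd 1 (cb0 b) p) (pd 0 (cb1 b) p) => u v kE B1 bn.
have -> : v = - u * (2 + be ^+ 2) / (2 * (1 - be ^+ 2)).
  apply: (mulIf (x := 4 * (1 - be ^+ 2))); first by rewrite mulf_neq0 // pnatr_eq0.
  rewrite [RHS](_ : _ = - u * (4 + 2 * be ^+ 2)); last by field.
  by refine (add_multiple kE (c := 1) _); ring.
by field; rewrite bn B1.
Qed.

End Coframe.

(** * Closedness of the coframe at every point *)

Section CoframePull.
Context {R : realType}.
Variables (U V : set 'rV[R]_2) (a : 'rV[R]_2 -> 'M[R]_2) (b : 'rV[R]_2 -> 'rV[R]_2).
Variable psi : 'rV[R]_2 -> 'rV[R]_2.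
Hypotheses (oU : open U) (hF : is_sqroot_metric a b U).
Hypothesis bn0 : forall x, U x -> 0 < gram_norm a b x.
Hypotheses (oV : open V) (psiVU : forall x, V x -> U (psi x)).
Hypothesis spsi : smooth_map V psi.
Hypothesis jac_gt0 : forall x, V x -> 0 < jac psi x.
Implicit Types x y : 'rV[R]_2.
Let p (m l : 'I_2) := pd l (fun x => psi x 0 m).
Let a' := pull_a a psi.
Let b' := pull_b b psi.

Let jac0 x : V x -> jac psi x != 0. Proof. by move=> /jac_gt0/lt0r_neq0. Qed.

Lemma bsq_pull x : V x -> bsq a' b' x = bsq a b (psi x).
Proof.
move=> Vx; rewrite /bsq (gram_pull hF psiVU) // (gram_norm_pull hF psiVU) //.
by rewrite invfM mulrACA divff ?mul1r // expf_neq0 // jac0.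
Qed.

Lemma rho_pull x : V x -> rho a' b' x = rho a b (psi x).
Proof. by move=> Vx; rewrite /rho /sig bsq_pull. Qed.

Let sqrt_gram_pull x : V x ->
  Num.sqrt (gram a' x) = jac psi x * Num.sqrt (gram a (psi x)).
Proof.
move=> Vx; rewrite (gram_pull hF psiVU) // sqrtrM ?sqr_ge0 //.
by rewrite sqrtr_sqr gtr0_norm // jac_gt0.
Qed.

Lemma star0_pull x : V x -> star0 a' b' x =
  p 0 0 x * star0 a b (psi x) + p 1 0 x * star1 a b (psi x).
Proof.
move=> Vx; have J0 := jac0 Vx.
have r0 : Num.sqrt (gram a (psi x)) != 0.
  by rewrite gt_eqF // sqrtr_gt0 (gram_gt0 hF) //; exact: psiVU.
rewrite /star0 /star1 sqrt_gram_pull // (pull_e00 hF psiVU) // (pull_e01 hF psiVU) //.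
rewrite pull_cb0 pull_cb1; move: J0; rewrite /jac -!/(p _ _) => J0.
by field; rewrite J0 r0.
Qed.

Lemma star1_pull x : V x -> star1 a' b' x =
  p 0 1 x * star0 a b (psi x) + p 1 1 x * star1 a b (psi x).
Proof.
move=> Vx; have J0 := jac0 Vx.
have r0 : Num.sqrt (gram a (psi x)) != 0.
  by rewrite gt_eqF // sqrtr_gt0 (gram_gt0 hF) //; exact: psiVU.
rewrite /star0 /star1 sqrt_gram_pull // (pull_e11 hF psiVU) // (pull_e01 hF psiVU) //.
rewrite pull_cb0 pull_cb1; move: J0; rewrite /jac -!/(p _ _) => J0.
by field; rewrite J0 r0.
Qed.

Lemma om1_pull i x : V x -> om1 a' b' i x =
  p 0 i x * om1 a b 0 (psi x) + p 1 i x * om1 a b 1 (psi x).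
Proof.
by move=> Vx; rewrite /om1 rho_pull //; elim/ord2P: i => /=;
  rewrite ?star0_pull ?star1_pull //; ring.
Qed.

Lemma om2_pull i x : V x -> om2 a' b' i x =
  p 0 i x * om2 a b 0 (psi x) + p 1 i x * om2 a b 1 (psi x).
Proof.
by move=> Vx; rewrite /om2 rho_pull // /cb; elim/ord2P: i => /=;
  rewrite ?pull_cb0 ?pull_cb1 /p; ring.
Qed.

Let sp m l : smooth V (p m l). Proof. exact: smooth_pd. Qed.

Lemma pd_precomp f k x : smooth U f -> V x ->
  pd k (fun x => f (psi x)) x = p 0 k x * pd 0 f (psi x) + p 1 k x * pd 1 f (psi x).
Proof. by move=> sf Vx; rewrite (pd_comp _ psiVU spsi sf Vx) sum2. Qed.

(** The second derivatives of psi cancel by symmetry. *)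
Lemma curl_pull (f g f' g' : 'rV[R]_2 -> R) x : smooth U f -> smooth U g -> V x ->
  (forall x, V x -> f' x = p 0 0 x * f (psi x) + p 1 0 x * g (psi x)) ->
  (forall x, V x -> g' x = p 0 1 x * f (psi x) + p 1 1 x * g (psi x)) ->
  curl f' g' x = jac psi x * curl f g (psi x).
Proof.
move=> sf sg Vx f'E g'E; rewrite /curl.
have D k i : pd k (fun x => p 0 i x * f (psi x) + p 1 i x * g (psi x)) x =
    pd k (p 0 i) x * f (psi x) + p 0 i x * (p 0 k x * pd 0 f (psi x) + p 1 k x * pd 1 f (psi x))
    + (pd k (p 1 i) x * g (psi x) + p 1 i x * (p 0 k x * pd 0 g (psi x) + p 1 k x * pd 1 g (psi x))).
  have sf' := smooth_psi_comp oV psiVU spsi sf.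
  have sg' := smooth_psi_comp oV psiVU spsi sg.
  rewrite -!pd_precomp //.
  refine (pd_tderiv (_ : is_tderiv V (inl k) _ (fun x _ => pd k (p 0 i) x * f (psi x)
    + p 0 i x * pd k (fun x => f (psi x)) x + (pd k (p 1 i) x * g (psi x)
    + p 1 i x * pd k (fun x => g (psi x)) x))) Vx (dir_neq0 0)).
  by apply: (is_tderivD oV (H := fun x _ => p 0 i x * f (psi x)) (K := fun x _ => p 1 i x * g (psi x)));
    apply: (is_tderivM oV (H := fun x _ => p _ i x) (K := fun x _ => _ (psi x)));
    exact: (is_tderiv_x oV (inl k)).
rewrite (eq_pd 0 oV g'E Vx) (eq_pd 1 oV f'E Vx) !D.
have S m : pd 0 (p m 1) x = pd 1 (p m 0) x := pd_Schwarz 0 1 oV (spsi m) Vx.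
by rewrite !S /jac -!/(p _ _); ring.
Qed.

End CoframePull.

Section NormalCoordinates.
Context {R : realType}.
Variables (U : set 'rV[R]_2) (a : 'rV[R]_2 -> 'M[R]_2) (b : 'rV[R]_2 -> 'rV[R]_2).
Hypotheses (oU : open U) (hF : is_sqroot_metric a b U).
Variable x0 : 'rV[R]_2.
Hypotheses (Ux0 : U x0) (bn0 : 0 < gram_norm a b x0).
Let e := e00 a x0.
Let f := e01 a x0.
Let g := e11 a x0.
Let b0 := cb0 b x0.
Let b1 := cb1 b x0.
Let s := Num.sqrt (gram_norm a b x0).
Let r := Num.sqrt (gram a x0).

Let s0 : s != 0. Proof. by rewrite gt_eqF // sqrtr_gt0. Qed.
Let r0 : r != 0. Proof. by rewrite gt_eqF // sqrtr_gt0 (gram_gt0 hF). Qed.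
Let s2 : s ^+ 2 = g * b0 * b0 - 2 * f * b0 * b1 + e * b1 * b1.
Proof. by rewrite sqr_sqrtr // ltW. Qed.
Let r2 : r ^+ 2 = e * g - f * f.
Proof. by rewrite sqr_sqrtr // ltW // (gram_gt0 hF). Qed.

(** The columns of M are the positively oriented orthonormal frame whose first
    vector is dual to beta. *)
Let M (m i : 'I_2) : R :=
  if m == 0 then (if i == 0 then (g * b0 - f * b1) / (r * s) else - b1 / s)
  else (if i == 0 then (e * b1 - f * b0) / (r * s) else b0 / s).

Let T (i j k : 'I_2) : R := \sum_t M t k *
  (M 0 i * M 0 j * pd t (e00 a) x0 + (M 0 i * M 1 j + M 1 i * M 0 j) * pd t (e01 a) x0
   + M 1 i * M 1 j * pd t (e11 a) x0).

(** Minus the Christoffel symbols, in this frame. *)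
Let c (j i k : 'I_2) : R := - 2^-1 * (T j i k + T j k i - T i k j).
Let Q (m i k : 'I_2) : R := M m 0 * c 0 i k + M m 1 * c 1 i k.

Let psi (x : 'rV[R]_2) : 'rV[R]_2 := \row_m (x0 0 m
  + (M m 0 * x 0 0 + M m 1 * x 0 1)
  + 2^-1 * (Q m 0 0 * x 0 0 * x 0 0 + 2 * Q m 0 1 * x 0 0 * x 0 1
            + Q m 1 1 * x 0 1 * x 0 1)).

Let T_sym i j k : T i j k = T j i k.
Proof. by rewrite /T; apply: eq_bigr => t _; ring. Qed.

Let c_sym j i k : c j i k = c j k i.
Proof. by rewrite /c (T_sym k i j); ring. Qed.

Let cT i j k : c j i k + c i j k = - T i j k.
Proof. by rewrite /c (T_sym i j k); field. Qed.

Let psiE m : (fun x => psi x 0 m) = fun x => x0 0 m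
  + (M m 0 * x 0 0 + M m 1 * x 0 1)
  + 2^-1 * (Q m 0 0 * x 0 0 * x 0 0 + 2 * Q m 0 1 * x 0 0 * x 0 1
            + Q m 1 1 * x 0 1 * x 0 1).
Proof. by apply/funext => x; rewrite mxE. Qed.

Let oT : open [set: 'rV[R]_2] := openT.

Ltac coord_leaf :=
  lazymatch goal with
  | |- is_tderiv _ _ (fun x _ => fun_of_matrix x _ ?j) _ =>
      exact: (is_tderiv_x oT _ (smooth_coord _ j))
  end.

Let psi_tderiv k m : is_tderiv setT (inl k) (fun x _ => psi x 0 m)
  (fun x _ => M m k + Q m k 0 * x 0 0 + Q m k 1 * x 0 1).
Proof.
rewrite (_ : (fun x _ => psi x 0 m) = fun x _ => x0 0 m
  + (M m 0 * x 0 0 + M m 1 * x 0 1)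
  + 2^-1 * (Q m 0 0 * x 0 0 * x 0 0 + 2 * Q m 0 1 * x 0 0 * x 0 1
            + Q m 1 1 * x 0 1 * x 0 1)); last first.
  by apply/funext => x; apply/funext => y; rewrite mxE.
refine (is_tderiv_trans (K' := fun x y => _) _ _).
  by tderive oT ltac:(idtac; coord_leaf).
have Qs : Q m 1 0 = Q m 0 1 by rewrite /Q !(c_sym _ 1 0).
by move=> x y _ _ /=; rewrite !pd_coord; elim/ord2P: k => /=; rewrite ?Qs; field.
Qed.

Let psi_smooth m : smooth setT (fun x => psi x 0 m).
Proof.
rewrite psiE.
have sx j : smooth setT (fun x : 'rV[R]_2 => x 0 j : R) := @smooth_coord _ _ _ j.
have sc k := @smooth_cst R 2 setT k.
by repeat first [apply: smoothD => // | apply: smoothM => //].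
Qed.

Let pd_psi k m x : pd k (fun x => psi x 0 m) x = M m k + Q m k 0 * x 0 0 + Q m k 1 * x 0 1.
Proof. exact: (pd_tderiv (psi_tderiv k m) I (dir_neq0 0)). Qed.

Let psi0 : psi 0 = x0.
Proof. by apply/rowP => m; rewrite !mxE; ring. Qed.

Let V : set 'rV[R]_2 := [set x | U (psi x) /\ 0 < jac psi x].

Let jacE x : jac psi x = (M 0 0 + Q 0 0 0 * x 0 0 + Q 0 0 1 * x 0 1) *
    (M 1 1 + Q 1 1 0 * x 0 0 + Q 1 1 1 * x 0 1) -
  (M 0 1 + Q 0 1 0 * x 0 0 + Q 0 1 1 * x 0 1) *
    (M 1 0 + Q 1 0 0 * x 0 0 + Q 1 0 1 * x 0 1).
Proof. by rewrite /jac !pd_psi. Qed.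

Let V0 : V 0.
Proof.
split; first by rewrite psi0.
rewrite jacE !mxE !mulr0 !addr0 /M /= (_ : _ - _ = r^-1).
  by rewrite invr_gt0 sqrtr_gt0 (gram_gt0 hF).
have -> : (g * b0 - f * b1) / (r * s) * (b0 / s) - - b1 / s * ((e * b1 - f * b0) / (r * s))
   = s ^+ 2 / (r * s ^+ 2) by rewrite {1}s2; field; rewrite s0 r0.
by field; rewrite s0 r0.
Qed.

Let oV : open V.
Proof.
apply: openI.
  apply: open_comp oU => x _; apply: continuous_rV => j.
  exact: (psi_smooth j 0%N x I).
apply: (@open_comp _ _ (jac psi) [set x | 0 < x]); last exact: open_gt.
move=> x _; have : smooth setT (jac psi); last by move=> /(_ 0%N x I).
by apply: smoothB => //; apply: smoothM => //; exact: smooth_pd.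
Qed.

Let pd_pd_psi k i m x : pd k (pd i (fun x => psi x 0 m)) x = Q m i k.
Proof.
rewrite (_ : pd i _ = fun x => M m i + Q m i 0 * x 0 0 + Q m i 1 * x 0 1); last first.
  by apply/funext => z; rewrite pd_psi.
refine (etrans (pd_tderiv (_ : is_tderiv setT (inl k) _ ?[H]) I (dir_neq0 0)) _).
  by tderive oT ltac:(idtac; coord_leaf).
by rewrite /= !pd_coord; elim/ord2P: k => /=; ring.
Qed.

Let F00 : M 0 0 * M 0 0 * e + 2 * M 0 0 * M 1 0 * f + M 1 0 * M 1 0 * g = 1.
Proof.
rewrite /M /= (_ : _ + _ = (e * g - f * f) * (g * b0 * b0 - 2 * f * b0 * b1 + e * b1 * b1)
   / (r ^+ 2 * s ^+ 2)); last by field; rewrite s0 r0.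
by rewrite -s2 -r2; field; rewrite s0 r0.
Qed.

Let F01 : M 0 0 * M 0 1 * e + (M 0 0 * M 1 1 + M 1 0 * M 0 1) * f + M 1 0 * M 1 1 * g = 0.
Proof. by rewrite /M /=; field; rewrite s0 r0. Qed.

Let F11 : M 0 1 * M 0 1 * e + 2 * M 0 1 * M 1 1 * f + M 1 1 * M 1 1 * g = 1.
Proof.
rewrite /M /= (_ : _ + _ = (g * b0 * b0 - 2 * f * b0 * b1 + e * b1 * b1) / s ^+ 2);
  last by field.
by rewrite -s2; field.
Qed.

(** The parametrization is quadratic: its linear part is an orthonormal frame along
    beta, and its quadratic part cancels the first derivatives of the metric. *)
Lemma normal_coordinates : exists (V : set 'rV[R]_2) psi,
  [/\ [/\ open V, V 0, forall x, V x -> U (psi x), smooth_map V psi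
        & forall x, V x -> 0 < jac psi x],
      psi 0 = x0, pull_a a psi 0 = 1%:M,
      forall k, [/\ pd k (e00 (pull_a a psi)) 0 = 0, pd k (e01 (pull_a a psi)) 0 = 0
                  & pd k (e11 (pull_a a psi)) 0 = 0]
    & 0 < pull_b b psi 0 0 0 /\ pull_b b psi 0 0 1 = 0].
Proof.
have psiVU x : V x -> U (psi x) by case.
have sV : smooth_map V psi by move=> m; exact: smooth_sub (psi_smooth m).
have p0 m k : pd k (fun x => psi x 0 m) 0 = M m k by rewrite pd_psi !mxE; ring.
have pV x : V x -> 0 < jac psi x by case.
have P00 := pull_e00 hF psiVU; have P01 := pull_e01 hF psiVU; have P11 := pull_e11 hF psiVU.
have se00 := smooth_e00 hF; have se01 := smooth_e01 hF; have se11 := smooth_e11 hF.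
have sp m i : smooth V (pd i (fun x => psi x 0 m)) by exact: smooth_pd.
have sc h : smooth U h -> smooth V (fun x => h (psi x)).
  by move=> sh; exact: (smooth_psi_comp oV psiVU sV sh).
have dc h k : smooth U h -> pd k (fun x => h (psi x)) 0 = M 0 k * pd 0 h x0 + M 1 k * pd 1 h x0.
  by move=> sh; rewrite (pd_precomp psiVU sV k sh V0) !p0 psi0.
have E00 : e00 (pull_a a psi) 0 = 1 by rewrite P00 // !p0 psi0.
have E01 : e01 (pull_a a psi) 0 = 0 by rewrite P01 // !p0 psi0.
have E11 : e11 (pull_a a psi) 0 = 1 by rewrite P11 // !p0 psi0.
exists V, psi; split=> //.
- have [[_ aS _] _ _] := is_sqroot_pull hF oV psiVU sV pV.
  have A10 : pull_a a psi 0 1 0 = 0 by rewrite aS.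
  by apply/matrixP; elim/ord2P; elim/ord2P; rewrite [RHS]mxE.
- move=> k; split.
  + rewrite (eq_pd k oV P00 V0).
    refine (etrans (pd_tderiv (_ : is_tderiv V (inl k) _ ?[H]) V0 (dir_neq0 0)) _).
      by tderive oV ltac:(idtac; lazymatch goal with
        | |- is_tderiv _ _ (fun x _ => pd ?i _ x) _ => exact: (is_tderiv_x oV _ (sp _ i))
        | |- is_tderiv _ _ (fun x _ => e00 _ _) _ => exact: (is_tderiv_x oV _ (sc _ se00))
        | |- is_tderiv _ _ (fun x _ => e01 _ _) _ => exact: (is_tderiv_x oV _ (sc _ se01))
        | |- is_tderiv _ _ (fun x _ => e11 _ _) _ => exact: (is_tderiv_x oV _ (sc _ se11))
        end).
    rewrite /= !pd_pd_psi !dc // !p0 psi0 -/e -/f -/g.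
    transitivity (2 * (c 0 0 k * (M 0 0 * M 0 0 * e + 2 * M 0 0 * M 1 0 * f + M 1 0 * M 1 0 * g)
      + c 1 0 k * (M 0 0 * M 0 1 * e + (M 0 0 * M 1 1 + M 1 0 * M 0 1) * f + M 1 0 * M 1 1 * g))
      + T 0 0 k); first by rewrite /Q /T sum2; ring.
    by rewrite F00 F01 mulr1 mulr0 addr0 mulr_natl mulr2n cT addNr.
  + rewrite (eq_pd k oV P01 V0).
    refine (etrans (pd_tderiv (_ : is_tderiv V (inl k) _ ?[H]) V0 (dir_neq0 0)) _).
      by tderive oV ltac:(idtac; lazymatch goal with
        | |- is_tderiv _ _ (fun x _ => pd ?i _ x) _ => exact: (is_tderiv_x oV _ (sp _ i))
        | |- is_tderiv _ _ (fun x _ => e00 _ _) _ => exact: (is_tderiv_x oV _ (sc _ se00))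
        | |- is_tderiv _ _ (fun x _ => e01 _ _) _ => exact: (is_tderiv_x oV _ (sc _ se01))
        | |- is_tderiv _ _ (fun x _ => e11 _ _) _ => exact: (is_tderiv_x oV _ (sc _ se11))
        end).
    rewrite /= !pd_pd_psi !dc // !p0 psi0 -/e -/f -/g.
    transitivity (c 1 0 k * (M 0 1 * M 0 1 * e + 2 * M 0 1 * M 1 1 * f + M 1 1 * M 1 1 * g)
      + (c 0 0 k + c 1 1 k) * (M 0 0 * M 0 1 * e + (M 0 0 * M 1 1 + M 1 0 * M 0 1) * f
                               + M 1 0 * M 1 1 * g)
      + c 0 1 k * (M 0 0 * M 0 0 * e + 2 * M 0 0 * M 1 0 * f + M 1 0 * M 1 0 * g)
      + T 0 1 k); first by rewrite /Q /T sum2; ring.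
    by rewrite F00 F01 F11 !mulr1 mulr0 addr0 cT addNr.
  + rewrite (eq_pd k oV P11 V0).
    refine (etrans (pd_tderiv (_ : is_tderiv V (inl k) _ ?[H]) V0 (dir_neq0 0)) _).
      by tderive oV ltac:(idtac; lazymatch goal with
        | |- is_tderiv _ _ (fun x _ => pd ?i _ x) _ => exact: (is_tderiv_x oV _ (sp _ i))
        | |- is_tderiv _ _ (fun x _ => e00 _ _) _ => exact: (is_tderiv_x oV _ (sc _ se00))
        | |- is_tderiv _ _ (fun x _ => e01 _ _) _ => exact: (is_tderiv_x oV _ (sc _ se01))
        | |- is_tderiv _ _ (fun x _ => e11 _ _) _ => exact: (is_tderiv_x oV _ (sc _ se11))
        end).
    rewrite /= !pd_pd_psi !dc // !p0 psi0 -/e -/f -/g.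
    transitivity (2 * (c 1 1 k * (M 0 1 * M 0 1 * e + 2 * M 0 1 * M 1 1 * f + M 1 1 * M 1 1 * g)
      + c 0 1 k * (M 0 0 * M 0 1 * e + (M 0 0 * M 1 1 + M 1 0 * M 0 1) * f + M 1 0 * M 1 1 * g))
      + T 1 1 k); first by rewrite /Q /T sum2; ring.
    by rewrite F11 F01 mulr1 mulr0 addr0 mulr_natl mulr2n cT addNr.
- have pb0 : cb0 (pull_b b psi) 0 = s / r.
    by rewrite pull_cb0 !p0 psi0 -/b0 -/b1 /M /= (_ : _ + _ = s ^+ 2 / (r * s));
      [|rewrite s2]; field; rewrite s0 r0.
  have pb1 : cb1 (pull_b b psi) 0 = 0.
    by rewrite pull_cb1 !p0 psi0 -/b0 -/b1 /M /=; field.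
  split; last exact: pb1.
  rewrite -[X in 0 < X]/(cb0 (pull_b b psi) 0) pb0.
  by rewrite divr_gt0 // sqrtr_gt0 ?(gram_gt0 hF).
Qed.

End NormalCoordinates.

Section CoframeClosed.
Context {R : realType}.
Variables (U : set 'rV[R]_2) (a : 'rV[R]_2 -> 'M[R]_2) (b : 'rV[R]_2 -> 'rV[R]_2).
Hypotheses (oU : open U) (hF : is_sqroot_metric a b U).
Hypothesis bn0 : forall x, U x -> 0 < gram_norm a b x.

(** The three conditions do not depend on the coordinates, and in normal
    coordinates they are what the Einstein condition says. *)
Lemma coframe_closed x : U x -> einstein U (sqroot_metric a b) ->
  [/\ curl (om1 a b 0) (om1 a b 1) x = 0, curl (om2 a b 0) (om2 a b 1) x = 0 &
      pd 0 (bsq a b) x * star1 a b x - pd 1 (bsq a b) x * star0 a b x = 0].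
Proof.
move=> Ux hE.
have [V [psi [[oV V0 psiVU spsi jpos] psi0 a0 da [b0 b1]]]] :=
  normal_coordinates oU hF Ux (bn0 Ux).
have hF' := is_sqroot_pull hF oV psiVU spsi jpos.
have hE' := einstein_pull oU hF oV psiVU spsi jpos hE.
have bn0' z : V z -> 0 < gram_norm (pull_a a psi) (pull_b b psi) z.
  move=> Vz; rewrite (gram_norm_pull hF psiVU) //.
  by rewrite mulr_gt0 ?exprn_gt0 ?jpos // bn0 //; exact: psiVU.
have [c1 c2 c3] := coframe_normalized oV hF' bn0' V0 a0 erefl b1 da b0 hE'.
have J0 : jac psi 0 != 0 by rewrite gt_eqF // jpos.
have s1 := smooth_om1 oU hF bn0; have s2 := smooth_om2 oU hF bn0.
have sB := smooth_bsq oU hF.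
have om1P := om1_pull hF psiVU jpos.
have om2P := om2_pull hF psiVU jpos.
have BP := bsq_pull hF psiVU jpos.
split.
- apply: (mulfI J0); rewrite mulr0 -c1 -psi0.
  by rewrite (curl_pull oV psiVU spsi (s1 0) (s1 1) V0 (om1P 0) (om1P 1)).
- apply: (mulfI J0); rewrite mulr0 -c2 -psi0.
  by rewrite (curl_pull oV psiVU spsi (s2 0) (s2 1) V0 (om2P 0) (om2P 1)).
- apply: (mulfI J0); rewrite mulr0 -c3 -psi0.
  rewrite !(eq_pd _ oV BP V0) !(pd_precomp psiVU spsi _ sB V0).
  rewrite (star0_pull hF psiVU jpos V0) (star1_pull hF psiVU jpos V0) /jac.
  by ring.
Qed.

End CoframeClosed.

(** * The Poincare lemma *)

Section MeanValue.
Context {R : realType}.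
Implicit Types (G g : R -> R) (c e s t : R).

Lemma mean_value_le G g s t : s <= t ->
  (forall x, s <= x <= t -> is_derive x 1 G (g x)) ->
  exists2 x, s <= x <= t & G t - G s = g x * (t - s).
Proof.
move=> st dG.
have [||x] := @MVT_segment R G g s t st.
- by move=> x; rewrite in_itv /= => /andP[sx xt]; apply: dG; rewrite !ltW.
- apply: derivable_within_continuous => x; rewrite in_itv /= => sxt.
  by have [] := dG x sxt.
by rewrite in_itv /= => sxt E; exists x.
Qed.

Lemma mean_value_ball G g c e s t :
  (forall t, `|t - c| < e -> is_derive t 1 G (g t)) ->
  `|s - c| < e -> `|t - c| < e ->
  exists x, [/\ `|x - c| < e, `|x - s| <= `|t - s| & G t - G s = g x * (t - s)].
Proof.
move=> dG; rewrite !ltr_norml => /andP[s1 s2] /andP[t1 t2].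
have [st|/ltW ts] := leP s t.
  have [x xs|x /andP[sx xt] E] := @mean_value_le G g s t st.
    case/andP: xs => sx xt; apply: dG; rewrite ltr_norml; apply/andP; split; lra.
  exists x; split=> //; first by rewrite ltr_norml; apply/andP; split; lra.
  by rewrite !ger0_norm ?subr_ge0 // lerD2r.
have [x xs|x /andP[sx xt] E] := @mean_value_le G g t s ts.
  case/andP: xs => sx xt; apply: dG; rewrite ltr_norml; apply/andP; split; lra.
exists x; split=> //; first by rewrite ltr_norml; apply/andP; split; lra.
  by rewrite !ler0_norm ?subr_le0 // lerN2 lerD2r.
by rewrite -opprB E -mulrN opprB.
Qed.

Lemma antiderivative (g : R -> R) (c e : R) : 0 < e ->
  (forall t, `|t - c| < e -> {for t, continuous g}) ->
  exists G, forall t, `|t - c| < e / 2 -> is_derive t 1 G (g t).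
Proof.
move=> e0 cg; pose a := c - e / 2; pose u := c + e / 2.
have cgau : {within `[a, u], continuous g}.
  apply: continuous_in_subspaceT => t /set_mem /=; rewrite in_itv /= => /andP[ta tu].
  apply: cg; rewrite ltr_norml; move: ta tu; rewrite /a /u => ta tu.
  by apply/andP; split; lra.
have ig : (@lebesgue_measure R).-integrable `[a, u] (EFin \o g).
  by apply: continuous_compact_integrable => //; exact: segment_compact.
exists (fun x => \int[@lebesgue_measure R]_(t in `[a, x]) g t) => t.
rewrite ltr_norml => /andP[at' tu].
have tu' : t < u by rewrite /u; lra.
have at'' : a < t by rewrite /a; lra.
have ct : {for t, continuous g}.
  by apply: cg; rewrite ltr_norml; apply/andP; split; lra.
have [dG GE] := @continuous_FTC1_closed R g a t u tu' ig at'' ct.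
exact: (DeriveDef dG (etrans (esym (derive1E _ _)) GE)).
Qed.

End MeanValue.

Section Primitive.
Context {R : realType}.
Implicit Types (U : set 'rV[R]_2) (x : 'rV[R]_2) (s t : R).

(** For the supremum norm this is an open square. *)
Definition norm_ball x (r : R) : set 'rV[R]_2 := [set z | `|z - x| < r].

Lemma open_norm_ball_set x r : open (norm_ball x r).
Proof.
rewrite (_ : norm_ball x r = ball x r); last first.
  by apply/funext => z; rewrite mx_norm_ball /ball_ /norm_ball /= distrC.
exact: ball_open.
Qed.

Definition pt s t : 'rV[R]_2 := s *: delta_mx 0 0 + t *: delta_mx 0 1.

Lemma ptE x : x = pt (x 0 0) (x 0 1).
Proof. by rewrite [LHS]row_sum_delta sum2. Qed.

Lemma pt0 s t : pt s t 0 0 = s.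
Proof. by rewrite !mxE /=; ring. Qed.

Lemma pt1 s t : pt s t 0 1 = t.
Proof. by rewrite !mxE /=; ring. Qed.

Lemma norm_rV2 x (e : R) : 0 < e -> (`|x| < e) = (`|x 0 0| < e) && (`|x 0 1| < e).
Proof.
move=> e0; rewrite /Num.norm /= mx_normrE; apply/bigmax_ltP/andP => [[_ h]|[h0 h1]].
  by split; [exact: (h (0, 0))|exact: (h (0, 1))].
by split=> // -[i j] _ /=; rewrite ord1; elim/ord2P: j.
Qed.

Lemma coord_le_norm x j : `|x 0 j| <= `|x|.
Proof.
rewrite [leRHS]/Num.norm /= mx_normrE.
exact: (le_bigmax _ (fun i => `|x i.1 i.2|) (0, j)).
Qed.

Lemma near_pt x s t (e : R) : 0 < e ->
  (`|pt s t - x| < e) = (`|s - x 0 0| < e) && (`|t - x 0 1| < e).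
Proof. by move=> e0; rewrite norm_rV2 // mxE pt0 mxE [X in _ && (`|X| < _)]mxE pt1 mxE. Qed.

Lemma is_derive_pt0 (f : 'rV[R]_2 -> R) s t : differentiable f (pt s t) ->
  is_derive s 1 (fun s => f (pt s t)) (pd 0 f (pt s t)).
Proof.
by move=> df; rewrite -pdE; exact: (@is_derive_line _ _ f (t *: delta_mx 0 1) (delta_mx 0 0) s).
Qed.

Lemma is_derive_pt1 (f : 'rV[R]_2 -> R) s t : differentiable f (pt s t) ->
  is_derive t 1 (fun t => f (pt s t)) (pd 1 f (pt s t)).
Proof.
rewrite -pdE /pt addrC => df.
rewrite (_ : (fun t => _) = fun t => f (t *: delta_mx 0 1 + s *: delta_mx 0 0)).
  exact: (@is_derive_line _ _ f (s *: delta_mx 0 0) (delta_mx 0 1) t).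
by apply/funext => u; rewrite addrC.
Qed.

(** A function whose partial derivatives are smooth inherits their regularity, one
    order at a time. *)
Lemma smooth_of_pd U f P Q : open U -> smooth U P -> smooth U Q ->
  (forall x, U x -> [/\ differentiable f x, pd 0 f x = P x & pd 1 f x = Q x]) ->
  smooth U f.
Proof.
move=> oU sP sQ df; case=> [|k] /=; first by move=> x /df[/differentiable_continuous].
split=> [x /df[] //|]; rewrite -/(forall i, _); elim/ord2P; rewrite pdE.
  by apply: (Ck_eq oU (f := P)) (sP k) => x /df[].
by apply: (Ck_eq oU (f := Q)) (sQ k) => x /df[].
Qed.

Lemma differentiable_pd (f : 'rV[R]_2 -> R) x (A B : R) :
  (forall e, 0 < e -> exists2 d, 0 < d & forall h : 'rV[R]_2, `|h| < d ->
     `|f (h + x) - f x - (h 0 0 * A + h 0 1 * B)| <= e * `|h|) ->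
  [/\ differentiable f x, pd 0 f x = A & pd 1 f x = B].
Proof.
move=> fe; pose l (h : 'rV[R]_2) : R := h 0 0 * A + h 0 1 * B.
have lL : linear l.
  by move=> k u v; rewrite /l !mxE /GRing.scale /=; ring.
pose L : {linear 'rV[R]_2 -> R} := HB.pack l (GRing.isLinear.Build _ _ _ _ _ lL).
have cL : continuous L.
  have sl : smooth setT l.
    have sx j : smooth setT (fun x : 'rV[R]_2 => x 0 j : R) by exact: smooth_coord.
    have oT : open [set: 'rV[R]_2] := openT.
    by apply: smoothD => //; apply: smoothM => //; exact: smooth_cst.
  by move=> h; exact: (sl 0%N h I).
have [df dE] : differentiable f x /\ 'd f x = L :> ('rV[R]_2 -> R).
  apply: differentiable_eps cL _ => e e0; have [d d0 fd] := fe e e0.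
  by apply/nbhs_norm0P; exists d => // h hd; exact: fd.
split=> //; rewrite -pdE /partial deriveE // dE /= /l !mxE /=; ring.
Qed.

Variables (U : set 'rV[R]_2) (P Q : 'rV[R]_2 -> R) (p : 'rV[R]_2).
Hypotheses (oU : open U) (Up : U p) (sP : smooth U P) (sQ : smooth U Q).
Hypothesis cPQ : forall x, U x -> curl P Q x = 0.

Let p0 := p 0 0.
Let p1 := p 0 1.

(** On the square of radius r around p, H is an antiderivative of P along the
    horizontal line through p, and S s one of Q along the vertical line at s.  The
    constant M bounds the second derivative that controls the error of linearizing
    Q in the horizontal direction. *)
Section Box.
Variables (r M : R).
Hypotheses (r0 : 0 < r) (rU : forall z, `|z - p| < r -> U z).
Hypothesis QM : forall z, `|z - p| < r -> `|pd 0 (pd 0 Q) z| <= M.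
Variables (H : R -> R) (S : R -> R -> R).
Hypothesis dH : forall s, `|s - p0| < r -> is_derive s 1 H (P (pt s p1)).
Hypothesis dS : forall s t, `|s - p0| < r -> `|t - p1| < r ->
  is_derive t 1 (S s) (Q (pt s t)).

Let inU s t : `|s - p0| < r -> `|t - p1| < r -> `|pt s t - p| < r.
Proof. by move=> sr tr; rewrite near_pt // sr. Qed.

Let M0 : 0 <= M.
Proof. by apply: le_trans (QM (z := p) _); rewrite ?subrr ?normr0. Qed.

Let dif f s t : smooth U f -> `|s - p0| < r -> `|t - p1| < r -> differentiable f (pt s t).
Proof. by move=> sf sr tr; apply: (smooth_diff sf); apply: rU; exact: inU. Qed.

(** As the form is closed, the derivative in t of the quantity that is estimated
    is of second order in s' - s. *)
Let increment s s' t : `|s - p0| < r -> `|s' - p0| < r -> `|t - p1| < r ->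
  `|(S s' t - S s' p1) - (S s t - S s p1) - (s' - s) * (P (pt s t) - P (pt s p1))|
    <= M * r * `|s' - s| * `|s' - s|.
Proof.
move=> sr s'r tr.
pose phi t := S s' t - S s t - (s' - s) * P (pt s t).
have dphi u : `|u - p1| < r ->
    is_derive u 1 phi (Q (pt s' u) - Q (pt s u) - (s' - s) * pd 1 P (pt s u)).
  move=> ur; have d1 := dS s'r ur; have d2 := dS sr ur.
  have d3 := is_derive_pt1 (dif sP sr ur).
  exact: (is_deriveB (is_deriveB d1 d2) (is_deriveZ (s' - s) d3)).
have p1r : `|p1 - p1| < r by rewrite subrr normr0.
have [u [ur up E]] := mean_value_ball dphi p1r tr.
have [c [cr cs Ec]] := mean_value_ball
  (fun v vr => is_derive_pt0 (dif sQ vr ur)) sr s'r.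
have [c' [c'r _ Ec']] := mean_value_ball
  (fun v vr => is_derive_pt0 (dif (smooth_pd 0 sQ) vr ur)) sr cr.
have /eqP := cPQ (rU (inU sr ur)); rewrite /curl subr_eq0 => /eqP cE.
rewrite (_ : _ - _ = phi t - phi p1); last by rewrite /phi; ring.
rewrite E Ec -cE.
rewrite (_ : _ * (t - p1) = (pd 0 (pd 0 Q) (pt c' u) * (t - p1)) * ((c - s) * (s' - s)));
  last by rewrite -[pd 0 Q (pt c u)](subrK (pd 0 Q (pt s u))) Ec'; ring.
rewrite [leLHS]normrM [`|(_ * (t - p1))%R|]normrM [`|(_ * (s' - s))%R|]normrM.
rewrite -[leRHS]mulrA; apply: ler_pM; rewrite ?mulr_ge0 //.
  by apply: ler_pM => //; [exact/QM/inU|exact: ltW].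
exact: ler_wpM2r.
Qed.

Definition primitive x := H (x 0 0) + (S (x 0 0) (x 0 1) - S (x 0 0) p1).

Lemma primitive_pd x : `|x - p| < r -> [/\ differentiable primitive x,
  pd 0 primitive x = P x & pd 1 primitive x = Q x].
Proof.
move=> xr; have := xr; rewrite {1}(ptE x) near_pt // => /andP[x0r x1r].
have p1r : `|p1 - p1| < r by rewrite subrr normr0.
apply: differentiable_pd => e e0.
have e3 : 0 < e / 3 by rewrite divr_gt0.
have cP : {for pt (x 0 0) p1, continuous P}.
  exact: (differentiable_continuous (dif sP x0r p1r)).
have cQ : {for x, continuous Q}.
  exact: (differentiable_continuous (smooth_diff sQ (rU xr))).
have [d1 d10 Pd] := continuous_norm_ball cP e3.
have [d2 d20 Qd] := continuous_norm_ball cQ e3.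
have Mr0 : 0 < M * r + 1 by rewrite ltr_wpDl // mulr_ge0 // ltW.
pose d := Num.min (Num.min d1 d2) (Num.min (e / 3 / (M * r + 1)) (r - `|x - p|)).
exists d; first by rewrite !lt_min d10 d20 divr_gt0 //= subr_gt0.
move=> h; rewrite !lt_min => /andP[/andP[h1 h2] /andP[h3 h4]].
have hr : `|(h + x) - p| < r.
  rewrite -addrA; apply: le_lt_trans (ler_normD _ _) _; rewrite -ltrBrDr; exact: h4.
have := hr; rewrite {1}(ptE (h + x)) near_pt // !mxE => /andP[s'r t'r].
set s := x 0 0 in x0r s'r *; set t := x 0 1 in x1r t'r *.
have h0n : `|h 0 0| <= `|h| := coord_le_norm h 0.
have h1n : `|h 0 1| <= `|h| := coord_le_norm h 1.
have [xi [xir xit E1]] := mean_value_ball (fun u ur => dS s'r ur) x1r t'r.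
have [xj [xjr xjs E2]] := mean_value_ball dH x0r s'r.
have I := increment x0r s'r x1r; rewrite addrK in I; rewrite addrK in xit; rewrite addrK in xjs.
rewrite /primitive !mxE -/s -/t.
rewrite (_ : _ - _ = ((S (h 0 0 + s) t - S (h 0 0 + s) p1) - (S s t - S s p1)
     - h 0 0 * (P (pt s t) - P (pt s p1)))
   + h 0 1 * (Q (pt (h 0 0 + s) xi) - Q x) + h 0 0 * (P (pt xj p1) - P (pt s p1))); last first.
  rewrite -[S (h 0 0 + s) (h 0 1 + t)](subrK (S (h 0 0 + s) t)) E1.
  by rewrite -[H (h 0 0 + s)](subrK (H s)) E2 -(ptE x); ring.
rewrite (_ : e * `|h| = e / 3 * `|h| + `|h| * (e / 3) + `|h| * (e / 3)); last by field.
apply: le_trans (ler_normD _ _) _; apply: lerD;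
  first (apply: le_trans (ler_normD _ _) _; apply: lerD).
- apply: le_trans I _; apply: ler_pM; rewrite ?mulr_ge0 // ?(ltW r0) //.
  apply: (@le_trans _ _ ((M * r + 1) * `|h|)).
    by apply: ler_pM; rewrite ?mulr_ge0 ?(ltW r0) // lerDl.
  by rewrite mulrC -ler_pdivlMr // ltW.
- rewrite normrM; apply: ler_pM => //; apply/ltW/Qd.
  rewrite near_pt // -/s -/t addrK (le_lt_trans h0n h2) /=.
  by apply: le_lt_trans xit _; exact: le_lt_trans h1n _.
- rewrite normrM; apply: ler_pM => //; apply/ltW/Pd.
  rewrite near_pt // pt0 pt1 subrr normr0 d10 andbT.
  by apply: le_lt_trans xjs _; exact: le_lt_trans h0n _.
Qed.

End Box.

(** The Poincare lemma: on a square, integrate along horizontal then vertical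
    segments that start at the centre. *)
Lemma closed_form_exact : exists2 r, 0 < r & exists f,
  [/\ norm_ball p r `<=` U, smooth (norm_ball p r) f &
      forall x, norm_ball p r x -> pd 0 f x = P x /\ pd 1 f x = Q x].
Proof.
have [r1 r10 r1U] := open_norm_ball oU Up.
have cQ : {for p, continuous (pd 0 (pd 0 Q))}.
  exact: (differentiable_continuous (smooth_diff (smooth_pd 0 (smooth_pd 0 sQ)) Up)).
have [r2 r20 r2Q] := continuous_norm_ball cQ ltr01.
pose r := Num.min r1 r2; have r0 : 0 < r by rewrite lt_min r10.
have rU z : `|z - p| < r -> U z by rewrite lt_min => /andP[/r1U].
have QM z : `|z - p| < r -> `|pd 0 (pd 0 Q) z| <= `|pd 0 (pd 0 Q) p| + 1.
  rewrite lt_min => /andP[_ /r2Q zQ]; rewrite -[pd 0 _ z](subrK (pd 0 (pd 0 Q) p)) addrC.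
  by apply: le_trans (ler_normD _ _) _; rewrite lerD2l ltW.
have p1r : `|p1 - p1| < r by rewrite subrr normr0.
have in_r s t : `|s - p0| < r -> `|t - p1| < r -> U (pt s t).
  by move=> sr tr; apply: rU; rewrite near_pt // sr.
have rh0 : 0 < r / 2 by rewrite divr_gt0.
have r20' : r / 2 < r by rewrite ltr_pdivrMr // ltr_pMr // ltr1n.
have cont g (t : R) : (exists g', is_derive t 1 g g') -> {for t, continuous (g : R -> R)}.
  by move=> [g' [dg _]]; apply: differentiable_continuous; exact/derivable1_diffP.
have [H dH] : exists H, forall s, `|s - p0| < r / 2 -> is_derive s 1 H (P (pt s p1)).
  apply: antiderivative => // s sr; apply: cont; exists (pd 0 P (pt s p1)).
  by apply: is_derive_pt0; apply: (smooth_diff sP); exact: in_r.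
have /choice[S dS] : forall s, exists S, forall t, `|s - p0| < r -> `|t - p1| < r / 2 ->
    is_derive t 1 S (Q (pt s t)).
  move=> s; have [sr|_] := ltP `|s - p0| r; last by exists id.
  have [S dS] : exists S, forall t, `|t - p1| < r / 2 -> is_derive t 1 S (Q (pt s t)).
    apply: antiderivative => // t tr; apply: cont; exists (pd 1 Q (pt s t)).
    by apply: is_derive_pt1; apply: (smooth_diff sQ); exact: in_r.
  by exists S => t _; exact: dS.
have fpd x (xr : norm_ball p (r / 2) x) :=
  primitive_pd rh0 (fun z zr => rU z (lt_trans zr r20'))
    (fun z zr => QM z (lt_trans zr r20')) dH
    (fun s t sr tr => dS s t (lt_trans sr r20') tr) xr.
exists (r / 2); first by rewrite divr_gt0.
exists (primitive H S); split.
- by move=> z zr; apply: rU; exact: lt_trans zr r20'.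
- apply: (@smooth_of_pd _ _ P Q _ _ _ fpd); first exact: open_norm_ball_set.
    by apply: smooth_sub sP => z zr; apply: rU; exact: lt_trans zr r20'.
  by apply: smooth_sub sQ => z zr; apply: rU; exact: lt_trans zr r20'.
- by move=> x /fpd[].
Qed.

End Primitive.

(** * The inverse function theorem *)

Section InverseFunction.
Context {R : realType}.
Variables (U : set 'rV[R]_2) (phi : 'rV[R]_2 -> 'rV[R]_2) (p : 'rV[R]_2).
Hypotheses (oU : open U) (Up : U p) (sphi : smooth_map U phi) (jac0 : jac phi p != 0).
Implicit Types x y z v : 'rV[R]_2.

Let J (m l : 'I_2) x := pd l (fun x => phi x 0 m) x.

(** The inverse of the Jacobian matrix. *)
Let N (j m : 'I_2) x : R := (jac phi x)^-1 *
  (if j == 0 then (if m == 0 then J 1 1 x else - J 0 1 x)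
   else (if m == 0 then - J 1 0 x else J 0 0 x)).

Let NJ j l x : jac phi x != 0 -> N j 0 x * J 0 l x + N j 1 x * J 1 l x = (j == l)%:R.
Proof.
by rewrite /N /jac -!/(J _ _ _); elim/ord2P: j; elim/ord2P: l => /= D0; field.
Qed.

Let sJ m l : smooth U (J m l). Proof. by apply: smooth_pd; exact: sphi. Qed.

Let sjac : smooth U (jac phi).
Proof. by apply: smoothB => //; apply: smoothM => //; exact: sJ. Qed.

Let lin y : 'rV[R]_2 := \row_j (N j 0 p * y 0 0 + N j 1 p * y 0 1).
Let C : R := `|N 0 0 p| + `|N 0 1 p| + (`|N 1 0 p| + `|N 1 1 p|) + 1.

Let C0 : 0 < C. Proof. by rewrite ltr_wpDl // !addr_ge0. Qed.

Let linB y z : lin (y - z) = lin y - lin z.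
Proof. by apply/rowP => j; rewrite !mxE; ring. Qed.

Let lin_inj y z : lin y = lin z -> y = z.
Proof.
move=> /rowP E; have := E 0; have := E 1; rewrite !mxE /N /= => E1 E0.
have D : J 0 0 p * J 1 1 p - J 0 1 p * J 1 0 p != 0 by exact: jac0.
have {E0} E0 : J 1 1 p * y 0 0 - J 0 1 p * y 0 1 = J 1 1 p * z 0 0 - J 0 1 p * z 0 1.
  by apply: (mulfI (invr_neq0 jac0)); refine (add_multiple E0 (c := 1) _); ring.
have {E1} E1 : J 0 0 p * y 0 1 - J 1 0 p * y 0 0 = J 0 0 p * z 0 1 - J 1 0 p * z 0 0.
  by apply: (mulfI (invr_neq0 jac0)); refine (add_multiple E1 (c := 1) _); ring.
apply/rowP; elim/ord2P; apply: (mulfI D).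
  by refine (add_multiple E0 (c := J 0 0 p) (add_multiple E1 (c := J 0 1 p) _)); ring.
by refine (add_multiple E0 (c := J 1 0 p) (add_multiple E1 (c := J 1 1 p) _)); ring.
Qed.

Let norm_le x (e : R) : 0 <= e -> (forall j, `|x 0 j| <= e) -> `|x| <= e.
Proof.
move=> e0 xe; rewrite /Num.norm /= mx_normrE; apply: bigmax_le => // -[i j] _ /=.
by rewrite ord1.
Qed.

Let lin_le y : `|lin y| <= C * `|y|.
Proof.
apply: norm_le => [|j]; first by rewrite mulr_ge0 // ltW.
have e m : `|N j m p * y 0 m| <= `|N j m p| * `|y|.
  by rewrite [leLHS]normrM; apply: ler_wpM2l => //; exact: coord_le_norm.
rewrite mxE; apply: le_trans (ler_normD _ _) _; apply: le_trans (lerD (e 0) (e 1)) _.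
rewrite -mulrDl ler_wpM2r // /C; have n0 i m : 0 <= `|N i m p| by [].
by elim/ord2P: (j); move: (n0 0 0) (n0 0 1) (n0 1 0) (n0 1 1); lra.
Qed.

Let h x := x - lin (phi x).

Let sh j : smooth U (fun x => h x 0 j).
Proof.
rewrite (_ : (fun x => _) = fun x => x 0 j - (N j 0 p * phi x 0 0 + N j 1 p * phi x 0 1)).
  apply: smoothB => //; first exact: smooth_coord.
  by apply: smoothD => //; apply: smoothM => //; exact: smooth_cst.
by apply/funext => x; rewrite !mxE.
Qed.

Let pd_h i j : pd i (fun x => h x 0 j) p = 0.
Proof.
rewrite (_ : (fun x => _) =
    fun x => x 0 j - (N j 0 p * phi x 0 0 + N j 1 p * phi x 0 1)); last first.
  by apply/funext => x; rewrite !mxE.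
refine (etrans (pd_tderiv (_ : is_tderiv U (inl i) _ ?[H]) Up (dir_neq0 0)) _).
  by tderive oU ltac:(idtac; lazymatch goal with
    | |- is_tderiv _ _ (fun x _ => fun_of_matrix (phi x) _ ?m) _ =>
        exact: (is_tderiv_x oU _ (sphi m))
    | |- is_tderiv _ _ (fun x _ => fun_of_matrix x _ ?m) _ =>
        exact: (is_tderiv_x oU _ (@smooth_coord _ _ _ m)) end).
by rewrite /= pd_coord eq_sym -(NJ j i jac0) /J; ring.
Qed.

(** The map h is a contraction near p, because its differential at p is zero. *)
Let contract : exists2 r, 0 < r & [/\ norm_ball p r `<=` U,
  forall x, norm_ball p r x -> jac phi x != 0 &
  forall x z, norm_ball p r x -> norm_ball p r z -> `|h x - h z| <= 2^-1 * `|x - z|].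
Proof.
have [r0 r00 r0U] := open_norm_ball oU Up.
have cont f : smooth U f -> {for p, continuous f}.
  by move=> sf; exact: (differentiable_continuous (smooth_diff sf Up)).
have q0 : (0 : R) < 4^-1 by rewrite invr_gt0.
have /choice[/= ri riP] : forall ij : 'I_2 * 'I_2, exists r, 0 < r /\ forall z, `|z - p| < r ->
    `|pd ij.1 (fun x => h x 0 ij.2) z| < 4^-1.
  move=> [i j] /=; have [r rp hr] := continuous_norm_ball (cont _ (smooth_pd i (sh j))) q0.
  by exists r; split=> // z /hr; rewrite pd_h subr0.
have J0 : 0 < `|jac phi p| by rewrite normr_gt0.
have [r1 r10 r1J] := continuous_norm_ball (cont _ sjac) J0.
pose r := Num.min (Num.min r0 r1) (Num.min (Num.min (ri (0, 0)) (ri (0, 1)))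
   (Num.min (ri (1, 0)) (ri (1, 1)))).
have rp : 0 < r by rewrite !lt_min r00 r10 !(riP _).1.
have rle z : `|z - p| < r -> [/\ `|z - p| < r0, `|z - p| < r1
    & forall i j, `|pd i (fun x => h x 0 j) z| < 4^-1].
  rewrite !lt_min => /andP[/andP[h0 h1] /andP[/andP[h2 h3] /andP[h4 h5]]]; split=> //.
  by elim/ord2P; elim/ord2P; apply: (riP (_, _)).2.
exists r => //; split.
- by move=> z /rle[/r0U].
- move=> z /rle[_ /r1J + _]; apply: contraTneq => ->.
  by rewrite sub0r normrN ltxx.
move=> x z xr zr; apply: norm_le => [|j]; first by rewrite mulr_ge0 // invr_ge0.
have inr t : 0 <= t <= 1 -> norm_ball p r (t *: (x - z) + z).
  move=> /andP[t0 t1]; rewrite /norm_ball /=.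
  rewrite (_ : _ - p = t *: (x - p) + (1 - t) *: (z - p)); last first.
    by apply/rowP => k; rewrite !mxE; ring.
  apply: le_lt_trans (ler_normD _ _) _; rewrite !normrZ ger0_norm // ger0_norm ?subr_ge0 //.
  have [->|tn] := eqVneq t 0; first by rewrite mul0r add0r subr0 mul1r.
  have tp : 0 < t by rewrite lt_neqAle eq_sym tn.
  rewrite (_ : r = t * r + (1 - t) * r); last by ring.
  apply: ltr_leD; first by rewrite ltr_pM2l.
  by apply: ler_wpM2l; [rewrite subr_ge0|exact: ltW].
have dh t : 0 <= t <= 1 -> differentiable (fun x => h x 0 j) (t *: (x - z) + z).
  by move=> tt; apply: (smooth_diff (sh j)); apply: r0U; have [] := rle _ (inr t tt).
have [t /andP[/ltW t0 /ltW t1] E] := mean_value_line ltr01 dh.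
have tt : 0 <= t <= 1 by rewrite t0.
have [_ _ hq] := rle _ (inr t tt).
have hB : (h x - h z) 0 j = h x 0 j - h z 0 j by rewrite !mxE.
move: E; rewrite scale1r subrK mul1r derive_partial; last exact: dh.
rewrite sum2 !pdE -hB => ->.
rewrite (_ : 2^-1 * `|x - z| = `|x - z| * 4^-1 + `|x - z| * 4^-1); last by field.
apply: le_trans (ler_normD _ _) _; apply: lerD; rewrite normrM;
  apply: ler_pM => //; by [exact: coord_le_norm | exact/ltW/hq].
Qed.

Lemma fixed_point_closed_ball (T : 'rV[R]_2 -> 'rV[R]_2) (q : R) : 0 < q ->
  (forall x, `|x - p| <= q -> `|T x - p| <= q) ->
  (forall x z, `|x - p| <= q -> `|z - p| <= q -> `|T x - T z| <= 2^-1 * `|x - z|) ->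
  exists2 x, `|x - p| <= q & x = T x.
Proof.
move=> q0 TA TL; pose A : set 'rV[R]_2 := [set x | `|x - p| <= q].
have clA : closed A.
  rewrite (_ : A = closed_ball p q); first exact: closed_ball_closed.
  by rewrite closed_ballE //; apply/funext => z; rewrite /A /closed_ball_ /= distrC.
pose F : {fun A >-> A} := HB.pack T (isFun.Build _ _ A A T TA).
have cF : is_contraction F.
  exists (2^-1%:nng); split; first by rewrite /= invf_lt1 // ltr1n.
  by move=> [x z] [/= Ax Az]; exact: TL.
pose X : completeNormedModType R :=
  HB.pack 'rV[R]_2 (NormedModule.on 'rV[R]_2) (Complete.on 'rV[R]_2).
have [|x Ax E] := @banach_fixed_point R X A F cF clA.
  by exists p; rewrite /A /= subrr normr0 ltW.
by exists x.
Qed.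

(** The simplified Newton map x |-> x - lin (phi x - y) is a contraction of a closed
    ball, and its fixed point is the preimage of y.  The expansion estimate makes
    the inverse Lipschitz, hence differentiable with the inverse Jacobian matrix at
    psi y as derivative.  As this matrix is a smooth function of psi y, if psi is
    C^k then its derivatives are C^k. *)
Lemma inverse_function : exists V W psi, V p /\ local_coordinates U V W phi psi.
Proof.
have [r r0 [rU rJ hL]] := contract.
pose W : set 'rV[R]_2 := [set y | `|lin (y - phi p)| < r / 4].
pose V : set 'rV[R]_2 := [set x | norm_ball p r x /\ W (phi x)].
have r4 : 0 < r / 4 by rewrite divr_gt0.
have slin j : smooth setT (fun y => lin (y - phi p) 0 j).
  rewrite (_ : (fun y => _) = fun y => N j 0 p * (y 0 0 - phi p 0 0)
      + N j 1 p * (y 0 1 - phi p 0 1)); last by apply/funext => y; rewrite !mxE.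
  have oT : open [set: 'rV[R]_2] := openT.
  have sx m : smooth setT (fun y => y 0 m - phi p 0 m).
    by apply: smoothB => //; [exact: smooth_coord|exact: smooth_cst].
  by apply: smoothD => //; apply: smoothM => //; exact: smooth_cst.
have oW : open W.
  apply: (@open_comp _ _ (fun y => lin (y - phi p)) [set z | `|z| < r / 4]).
    by move=> y _; apply: continuous_rV => j; exact: (slin j 0%N y I).
  by have := @open_norm_ball_set R 0 (r / 4); congr (open _); apply/funext => z;
    rewrite /norm_ball /= subr0.
have oV : open V.
  rewrite openE => x [xr Wx]; apply: filterI.
    by apply: open_nbhs_nbhs; split=> //; exact: open_norm_ball_set.
  have cphi : {for x, continuous phi}.
    by apply: continuous_rV => j; exact: (sphi j 0%N x (rU x xr)).
  by apply: cphi; exact: open_nbhs_nbhs.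
have expand x z : norm_ball p r x -> norm_ball p r z ->
    `|x - z| <= 2 * (C * `|phi x - phi z|).
  move=> xr zr; apply: le_trans (ler_wpM2l _ (lin_le _)) => //.
  have := hL x z xr zr; rewrite linB.
  have := ler_normD (h x - h z) (lin (phi x) - lin (phi z)).
  rewrite (_ : h x - h z + _ = x - z); last by apply/rowP => j; rewrite !mxE; ring.
  by lra.
have inj x z : norm_ball p r x -> norm_ball p r z -> phi x = phi z -> x = z.
  move=> xr zr E; have := expand x z xr zr; rewrite E subrr normr0 !mulr0.
  by rewrite normr_le0 subr_eq0 => /eqP.
have /choice[psi psiP] : forall y, exists x, W y -> norm_ball p r x /\ phi x = y.
  move=> y; have [Wy|] := pselect (W y); last by exists p.
  have r2 : 0 < r / 2 by rewrite divr_gt0.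
  have r2r : r / 2 < r by rewrite ltr_pdivrMr // ltr_pMr // ltr1n.
  have ball2 x : `|x - p| <= r / 2 -> norm_ball p r x by move=> xr; exact: le_lt_trans xr r2r.
  have pr : norm_ball p r p by rewrite /norm_ball /= subrr normr0.
  have [||x xr xE] := fixed_point_closed_ball (T := fun x => h x + lin y) r2.
  - move=> x xr; have := hL x p (ball2 x xr) pr.
    have := ler_normD (h x - h p) (lin (y - phi p)).
    rewrite (_ : h x - h p + _ = h x + lin y - p); last first.
      by rewrite linB; apply/rowP => j; rewrite !mxE; ring.
    by move: Wy xr; rewrite /W /=; lra.
  - by move=> x z xr zr; rewrite opprD addrACA subrr addr0; apply: hL; exact: ball2.
  exists x => _; split; first exact: ball2.
  apply: lin_inj; move: xE; rewrite /h -addrA -[LHS]addr0 => /addrI/eqP.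
  by rewrite eq_sym addrC subr_eq0 => /eqP.
have psi_phi x : V x -> psi (phi x) = x.
  by move=> [xr Wx]; have [zr E] := psiP _ Wx; exact: inj E.
have VW y : W y -> V (psi y) by move=> Wy; have [xr E] := psiP _ Wy; split; rewrite ?E.
have VU : V `<=` U by move=> x [/rU].
have psi_pd j y : W y -> [/\ differentiable (fun y => psi y 0 j) y,
    pd 0 (fun y => psi y 0 j) y = N j 0 (psi y) & pd 1 (fun y => psi y 0 j) y = N j 1 (psi y)].
  move=> Wy; apply: differentiable_pd => e e0.
  have [xr xE] := psiP _ Wy; set x := psi y in xr xE *.
  have Ux := rU _ xr.
  (* The error of the inverse is at most the norm of the inverse Jacobian matrix
     times the error of phi, times the Lipschitz constant 2 C of the inverse. *)
  pose K := (`|N j 0 x| + `|N j 1 x| + 1) * (2 * C).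
  have K0 : 0 < K by rewrite mulr_gt0 ?mulr_gt0 // ltr_wpDl // addr_ge0.
  have eK : 0 < e / K by rewrite divr_gt0.
  have lin_approx m : exists2 d, 0 < d & forall v, `|v| < d ->
      `|phi (v + x) 0 m - phi x 0 m - (v 0 0 * J m 0 x + v 0 1 * J m 1 x)| <= e / K * `|v|.
    have df := smooth_diff (sphi m) Ux.
    have /nbhs_norm0P[d d0 dP] := diff_eps df eK.
    exists d => // v vd; have := dP v vd; rewrite /= -deriveE // derive_partial // sum2.
    by rewrite !pdE.
  have [d0 d00 A0] := lin_approx 0; have [d1 d10 A1] := lin_approx 1.
  have [dW dW0 inW] := open_norm_ball oW Wy.
  pose d := Num.min dW (Num.min d0 d1 / (2 * C)).
  have C2 : 0 < 2 * C by rewrite mulr_gt0.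
  exists d; first by rewrite lt_min dW0 divr_gt0 // lt_min d00.
  move=> k; rewrite lt_min => /andP[kW]; rewrite ltr_pdivlMr // lt_min => /andP[k0 k1].
  have Wk : W (k + y) by apply: inW; rewrite addrK.
  have [x'r x'E] := psiP _ Wk; set x' := psi (k + y) in x'r x'E *.
  pose v := x' - x; have x'v : x' = v + x by rewrite /v subrK.
  have vk : `|v| <= `|k| * (2 * C).
    have := expand x' x x'r xr; rewrite x'E xE addrK.
    by rewrite [`|k| * _]mulrC mulrA.
  have := A0 v (le_lt_trans vk k0); have := A1 v (le_lt_trans vk k1).
  rewrite -x'v x'E xE [(k + y) 0 0]mxE [(k + y) 0 1]mxE !addrK.
  set w1 := k 0 1 - _; set w0 := k 0 0 - _ => w1e w0e.
  have J0 := rJ x xr.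
  rewrite (_ : _ - _ = - (N j 0 x * w0 + N j 1 x * w1)).
    rewrite normrN; apply: le_trans (ler_normD _ _) _.
    rewrite [`|N j 0 x * w0|]normrM [`|N j 1 x * w1|]normrM.
    apply: (@le_trans _ _ ((`|N j 0 x| + `|N j 1 x|) * (e / K * `|v|))).
      by rewrite [leRHS]mulrDl; apply: lerD; apply: ler_wpM2l.
    apply: (@le_trans _ _ ((`|N j 0 x| + `|N j 1 x| + 1) * (e / K * (`|k| * (2 * C))))).
      have ev : e / K * `|v| <= e / K * (`|k| * (2 * C)).
        by apply: ler_wpM2l => //; exact: ltW.
      apply: ler_pM ev; rewrite ?addr_ge0 ?lerDl //.
      by rewrite mulr_ge0 // ltW.
    rewrite [leLHS](_ : _ = K * (e / K) * `|k|); first by rewrite [K * _]mulrC divfK ?gt_eqF.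
    by rewrite /K; move: (`|N j 0 x|) (`|N j 1 x|) C (_^-1) => n0 n1 c i; ring.
  have E0 := NJ j 0 J0; have E1 := NJ j 1 J0.
  transitivity (v 0 j - (k 0 0 * N j 0 x + k 0 1 * N j 1 x)); first by rewrite !mxE.
  have -> : v 0 j = v 0 0 * (j == 0)%:R + v 0 1 * (j == 1)%:R.
    by elim/ord2P: (j) => /=; ring.
  by rewrite -E0 -E1 /w0 /w1; move: (N j 0 x) (N j 1 x) => n0 n1; ring.
have sN j m : smooth V (N j m).
  have siJ : smooth V (fun x => (jac phi x)^-1).
    by apply: smoothV => // [x [/rJ]//|]; exact: smooth_sub sjac.
  have sJV a b : smooth V (J a b) by exact: smooth_sub (sJ a b).
  by apply: smoothM => //; elim/ord2P: j; elim/ord2P: m => /=; try exact: smoothN; exact: sJV.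
have spsi : smooth_map W psi.
  move=> j k; elim: k j => [|k IH] j.
    by move=> y /(psi_pd j)[/differentiable_continuous].
  split=> [y /(psi_pd j)[] //|]; elim/ord2P; rewrite pdE.
    apply: (Ck_eq oW (f := fun y => N j 0 (psi y))); first by move=> y /(psi_pd j)[].
    by apply: (Ck_comp oW VW) => //; exact: sN.
  apply: (Ck_eq oW (f := fun y => N j 1 (psi y))); first by move=> y /(psi_pd j)[].
  by apply: (Ck_comp oW VW) => //; exact: sN.
exists V, W, psi; split.
  split; first by rewrite /norm_ball /= subrr normr0.
  by rewrite /W /= subrr (_ : lin 0 = 0) ?normr0 //; apply/rowP => j; rewrite !mxE; ring.
split; split=> //.
- by move=> x Vx; split; [have [] := Vx|exact: psi_phi].
- by move=> y Wy; split; [exact: VW|have [] := psiP _ Wy].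
- by move=> j; exact: smooth_sub (sphi j).
Qed.

End InverseFunction.

(** * The model metric *)

Section ModelMetric.
Context {R : realType}.
Variable U : set 'rV[R]_2.
Hypothesis oU : open U.
Variables (m h k : 'rV[R]_2 -> R) (F : @tfun R 2).
Hypotheses (sm : smooth U m) (sh : smooth U h) (sk : smooth U k).
Hypotheses (m1 : forall x, U x -> pd 1 m x = 0) (h1 : forall x, U x -> pd 1 h x = 0).
Hypothesis k1 : forall x, U x -> pd 1 k x = 0.
Hypothesis h0 : forall x, U x -> pd 0 h x = 2 * h x * (1 - h x * h x) * k x.
Hypothesis m0 : forall x, U x -> pd 0 m x = 2 * m x * (2 + h x * h x) * k x.
Hypothesis rF : regular_metric U F.
Implicit Types (x y : 'rV[R]_2).

Let rad y : R := Num.sqrt (y 0 0 * y 0 0 + y 0 1 * y 0 1).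

Hypothesis FE : forall x y, U x -> y != 0 -> sqF F x y =
  m x * (y 0 0 * y 0 0 + y 0 1 * y 0 1 + h x * (rad y * y 0 1)).

Let rad_gt0 y : y != 0 -> 0 < y 0 0 * y 0 0 + y 0 1 * y 0 1.
Proof.
rewrite -!expr2 => y0; rewrite lt_neqAle eq_sym addr_ge0 ?sqr_ge0 // andbT.
apply: contra y0; rewrite paddr_eq0 ?sqr_ge0 // !sqrf_eq0 => /andP[/eqP e0 /eqP e1].
by apply/eqP/rowP; elim/ord2P; rewrite mxE.
Qed.

Let rad0 y : y != 0 -> rad y != 0.
Proof. by move=> y0; rewrite gt_eqF // sqrtr_gt0 rad_gt0. Qed.

Let rad2 y : y != 0 -> rad y ^+ 2 = y 0 0 * y 0 0 + y 0 1 * y 0 1.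
Proof. by move=> y0; rewrite sqr_sqrtr // ltW // rad_gt0. Qed.

Let d_rad d : is_tderiv U d (fun _ y => rad y) (fun _ y =>
  match d with inl _ => 0 | inr i => (rad y)^-1 * y 0 i end).
Proof.
refine (is_tderiv_trans (K' := fun x y => _) _ _).
  apply: (is_tderiv_sqrt oU (H := fun _ y => y 0 0 * y 0 0 + y 0 1 * y 0 1)).
    by move=> x y _; exact: rad_gt0.
  by tderive oU ltac:(idtac; fail).
move=> x y _ y0 /=; have r0 := rad0 y0; rewrite -/(rad y); case: d => i /=; first by field.
by elim/ord2P: i => /=; field.
Qed.

Let d_irad d : is_tderiv U d (fun _ y => (rad y)^-1) (fun _ y =>
  match d with inl _ => 0 | inr i => - (rad y)^-1 ^+ 3 * y 0 i end).
Proof.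
refine (is_tderiv_trans (K' := fun x y => _) _ _).
  by apply: (is_tderivV oU (H := fun _ y => rad y)) (d_rad d) => x y _; exact: rad0.
by move=> x y _ y0 /=; have r0 := rad0 y0; case: d => i /=; field.
Qed.

Let tderiv_unique d H K K' x y : (forall x y, U x -> y != 0 -> H x y = K x y) ->
  is_tderiv U d K K' -> U x -> y != 0 -> tderiv d H x y = K' x y.
Proof.
move=> HK [sK dK] Ux y0; rewrite -dK //; have sH : tsmooth U H.
  by apply: (tsmooth_eq oU _ sK) => u v Uu v0; rewrite HK.
have HH : is_tderiv U d H (tderiv d H) by split.
have KK : is_tderiv U d K (tderiv d K) by split.
exact: (is_tderiv_eq oU HH KK HK).
Qed.

Ltac model_leaf :=
  lazymatch goal with
  | |- is_tderiv _ _ (fun _ y => (rad y)^-1) _ => exact: d_irad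
  | |- is_tderiv _ _ (fun _ y => rad y) _ => exact: d_rad
  | |- is_tderiv _ _ (fun x _ => m x) _ => exact: (is_tderiv_x oU _ sm)
  | |- is_tderiv _ _ (fun x _ => h x) _ => exact: (is_tderiv_x oU _ sh)
  | |- is_tderiv _ _ (fun x _ => k x) _ => exact: (is_tderiv_x oU _ sk)
  | |- is_tderiv _ _ (fun x _ => pd 0 k x) _ => exact: (is_tderiv_x oU _ (smooth_pd 0 sk))
  end.

Let L_y x y (i : 'I_2) : R := m x * (2 * y 0 i + h x * ((rad y)^-1 * y 0 i * y 0 1
  + rad y * (i == 1)%:R)).
Let L_x x y : R := 2 * k x * m x * ((2 + h x * h x) * (y 0 0 * y 0 0 + y 0 1 * y 0 1)
  + 3 * h x * (rad y * y 0 1)).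

Let Dy_L i x y : U x -> y != 0 -> Dy i (sqF F) x y = L_y x y i.
Proof.
move=> Ux y0; refine (etrans (tderiv_unique (d := inr i) FE (_ : is_tderiv U _ _ ?[H]) Ux y0) _).
  by tderive oU ltac:(idtac; model_leaf).
by rewrite /= /L_y; elim/ord2P: i => /=; ring.
Qed.

Let Dx_L i x y : U x -> y != 0 -> Dx i (sqF F) x y = (i == 0)%:R * L_x x y.
Proof.
move=> Ux y0; refine (etrans (tderiv_unique (d := inl i) FE (_ : is_tderiv U _ _ ?[H]) Ux y0) _).
  by tderive oU ltac:(idtac; model_leaf).
by rewrite /= /L_x; elim/ord2P: i => /=; rewrite ?h0 ?m0 ?h1 ?m1 //; ring.
Qed.

Let DyDy_L i j x y : U x -> y != 0 -> Dy j (Dy i (sqF F)) x y =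
  m x * (2 * (j == i)%:R + h x * (- (rad y)^-1 ^+ 3 * y 0 j * y 0 i * y 0 1
   + (rad y)^-1 * ((j == i)%:R * y 0 1 + y 0 i * (j == 1)%:R + y 0 j * (i == 1)%:R))).
Proof.
move=> Ux y0.
refine (etrans (tderiv_unique (d := inr j) (Dy_L i) (_ : is_tderiv U _ _ ?[H]) Ux y0) _).
  by rewrite /L_y; tderive oU ltac:(idtac; model_leaf).
by rewrite /=; elim/ord2P: i; elim/ord2P: j => /=; ring.
Qed.

Let DyDx_L i j x y : U x -> y != 0 -> Dy j (Dx i (sqF F)) x y = (i == 0)%:R *
  (2 * k x * m x * (2 * (2 + h x * h x) * y 0 j
    + 3 * h x * ((rad y)^-1 * y 0 j * y 0 1 + rad y * (j == 1)%:R))).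
Proof.
move=> Ux y0.
refine (etrans (tderiv_unique (d := inr j) (Dx_L i) (_ : is_tderiv U _ _ ?[H]) Ux y0) _).
  by rewrite /L_x; tderive oU ltac:(idtac; model_leaf).
by rewrite /=; elim/ord2P: i; elim/ord2P: j => /=; ring.
Qed.

Let G (i : 'I_2) x y : R := k x * (if i == 0
  then y 0 0 * y 0 0 - y 0 1 * y 0 1 - h x * (rad y * y 0 1)
  else 2 * y 0 0 * y 0 1 + h x * (rad y * y 0 0)).

Let geodesic_model i x y : U x -> y != 0 -> geodesic_coeff F i x y = G i x y.
Proof.
move=> Ux y0; apply: (geodesic_unique (Z := fun i => G i x y) rF Ux y0) => {}i.
rewrite sum2 !fundamental_tensorE !DyDy_L // /spray_rhs sum2 !DyDx_L // Dx_L // /L_x /G.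
have r0 := rad0 y0; have r2 := rad2 y0.
by elim/ord2P: i => /=; move: (rad y) r0 r2 => r r0 r2; field: r2.
Qed.

Let q (i : 'I_2) y : R := if i == 0 then - (rad y * y 0 1) else rad y * y 0 0.
Let q_y (i j : 'I_2) y : R := if i == 0
  then - ((rad y)^-1 * y 0 j * y 0 1 + rad y * (j == 1)%:R)
  else (rad y)^-1 * y 0 j * y 0 0 + rad y * (j == 0)%:R.
Let c_y (i j : 'I_2) y : R := if i == 0
  then 2 * y 0 0 * (j == 0)%:R - 2 * y 0 1 * (j == 1)%:R
  else 2 * y 0 0 * (j == 1)%:R + 2 * y 0 1 * (j == 0)%:R.

Let Dx_G i j x y : U x -> y != 0 -> Dx j (geodesic_coeff F i) x y = (j == 0)%:R *
  (pd 0 k x * (if i == 0 then y 0 0 * y 0 0 - y 0 1 * y 0 1 else 2 * y 0 0 * y 0 1)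
   + (pd 0 k x * h x + 2 * h x * (1 - h x * h x) * k x * k x) * q i y).
Proof.
move=> Ux y0; have GE := geodesic_model i.
elim/ord2P: i GE => GE;
 (refine (etrans (tderiv_unique (d := inl j) GE (_ : is_tderiv U _ _ ?[H]) Ux y0) _);
  [by rewrite /G /=; tderive oU ltac:(idtac; model_leaf)
  |by rewrite /= /q; elim/ord2P: j => /=; rewrite ?h0 ?k1 ?h1 //; ring]).
Qed.

Let Dy_G i j x y : U x -> y != 0 -> Dy j (geodesic_coeff F i) x y =
  k x * (c_y i j y + h x * q_y i j y).
Proof.
move=> Ux y0; have GE := geodesic_model i.
elim/ord2P: i GE => GE;
 (refine (etrans (tderiv_unique (d := inr j) GE (_ : is_tderiv U _ _ ?[H]) Ux y0) _);
  [by rewrite /G /=; tderive oU ltac:(idtac; model_leaf)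
  |by rewrite /= /c_y /q_y; elim/ord2P: j => /=; ring]).
Qed.

Let DyDx_G i j l x y : U x -> y != 0 -> Dy l (Dx j (geodesic_coeff F i)) x y = (j == 0)%:R *
  (pd 0 k x * c_y i l y
   + (pd 0 k x * h x + 2 * h x * (1 - h x * h x) * k x * k x) * q_y i l y).
Proof.
move=> Ux y0; have GE x' y' (Ux' : U x') (y0' : y' != 0) := Dx_G i j Ux' y0'.
rewrite /q in GE; elim/ord2P: i GE => GE;
 (refine (etrans (tderiv_unique (d := inr l) GE (_ : is_tderiv U _ _ ?[H]) Ux y0) _);
  [by rewrite /=; tderive oU ltac:(idtac; model_leaf)
  |by rewrite /= /c_y /q_y; elim/ord2P: l => /=; ring]).
Qed.

Let DyDy_G i j l x y : U x -> y != 0 -> Dy l (Dy j (geodesic_coeff F i)) x y =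
  k x * ((if i == 0 then 2 * (l == 0)%:R * (j == 0)%:R - 2 * (l == 1)%:R * (j == 1)%:R
     else 2 * (l == 0)%:R * (j == 1)%:R + 2 * (l == 1)%:R * (j == 0)%:R)
   + h x * (if i == 0
     then - (- (rad y)^-1 ^+ 3 * y 0 l * y 0 j * y 0 1
          + (rad y)^-1 * ((l == j)%:R * y 0 1 + y 0 j * (l == 1)%:R + y 0 l * (j == 1)%:R))
     else - (rad y)^-1 ^+ 3 * y 0 l * y 0 j * y 0 0
          + (rad y)^-1 * ((l == j)%:R * y 0 0 + y 0 j * (l == 0)%:R + y 0 l * (j == 0)%:R))).
Proof.
move=> Ux y0; have GE x' y' (Ux' : U x') (y0' : y' != 0) := Dy_G i j Ux' y0'.
rewrite /q_y /c_y in GE; elim/ord2P: i GE => GE;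
 (refine (etrans (tderiv_unique (d := inr l) GE (_ : is_tderiv U _ _ ?[H]) Ux y0) _);
  [by rewrite /=; tderive oU ltac:(idtac; model_leaf)
  |by rewrite /=; clear GE; elim/ord2P: l; elim/ord2P: j => /=; ring]).
Qed.

(** The metric with F^2 = m (r^2 + h r y_2), for r the Euclidean length of y and m, h
    functions of the first coordinate only.  Its geodesic coefficients G are
    polynomial in y and r, so that its Ricci curvature has no pole. *)
Lemma ricci_model x y : U x -> y != 0 -> ricci F x y =
  (y 0 0 * y 0 0 + y 0 1 * y 0 1 + h x * (rad y * y 0 1)) *
  (4 * k x * k x * h x * h x - 2 * pd 0 k x).
Proof.
move=> Ux y0; rewrite /ricci sum2 !riemann_curvatureE !sum2.
rewrite !geodesic_model // !Dx_G // !DyDx_G // !Dy_G // !DyDy_G //.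
have r0 := rad0 y0; have r2 := rad2 y0.
rewrite /G /q /c_y /q_y /=; move: (rad y) r0 r2 => r r0 r2.
by field: r2.
Qed.

End ModelMetric.

(** * Coordinates from a closed coframe *)

Section CoframeCoordinates.
Context {R : realType}.
Implicit Types (U V W : set 'rV[R]_2) (x y p : 'rV[R]_2).

(** The Poincare lemma gives primitives of the two forms, and the inverse function
    theorem says that they are coordinates, since the forms are independent. *)
Lemma closed_coframe_coordinates U (om : 'I_2 -> 'I_2 -> 'rV[R]_2 -> R) p :
  open U -> U p -> (forall m i, smooth U (om m i)) ->
  (forall m x, U x -> curl (om m 0) (om m 1) x = 0) ->
  om 0 0 p * om 1 1 p - om 0 1 p * om 1 0 p != 0 ->
  exists V W phi psi, [/\ V p, local_coordinates U V W phi psi &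
    forall m i x, V x -> pd i (fun x => phi x 0 m) x = om m i x].
Proof.
move=> oU Up som com det0.
have [r0 r00 [f0 [U0 sf0 df0]]] := closed_form_exact oU Up (som 0 0) (som 0 1) (com 0).
have [r1 r10 [f1 [U1 sf1 df1]]] := closed_form_exact oU Up (som 1 0) (som 1 1) (com 1).
pose phi x : 'rV[R]_2 := \row_m if m == 0 then f0 x else f1 x.
have phi0 : (fun x => phi x 0 0) = f0 by apply/funext => x; rewrite mxE.
have phi1 : (fun x => phi x 0 1) = f1 by apply/funext => x; rewrite mxE.
pose r := Num.min r0 r1; have rp : 0 < r by rewrite lt_min r00.
have N0 : norm_ball p r `<=` norm_ball p r0 by move=> x; rewrite /norm_ball /= lt_min => /andP[].
have N1 : norm_ball p r `<=` norm_ball p r1 by move=> x; rewrite /norm_ball /= lt_min => /andP[].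
have oN : open (norm_ball p r) := @open_norm_ball_set R p r.
have Np : norm_ball p r p by rewrite /norm_ball /= subrr normr0.
have dphi m i x : norm_ball p r x -> pd i (fun x => phi x 0 m) x = om m i x.
  move=> Nx; have [d00 d01] := df0 x (N0 x Nx); have [d10 d11] := df1 x (N1 x Nx).
  by elim/ord2P: m; rewrite ?phi0 ?phi1; elim/ord2P: i.
have sphi : smooth_map (norm_ball p r) phi.
  by elim/ord2P; rewrite ?phi0 ?phi1; [exact: smooth_sub sf0|exact: smooth_sub sf1].
have J0 : jac phi p != 0 by rewrite /jac !dphi.
have [V [W [psi [Vp [[oV VN oW] H]]]]] := inverse_function oN Np sphi J0.
exists V, W, phi, psi; split=> //.
  by split=> //; split=> // x /VN/N0/U0.
by move=> m i x /VN; exact: dphi.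
Qed.

Lemma pd_inverse U V W phi psi k m x : local_coordinates U V W phi psi -> W x ->
  pd k (fun x => psi x 0 0) x * pd 0 (fun x => phi x 0 m) (psi x) +
  pd k (fun x => psi x 0 1) x * pd 1 (fun x => phi x 0 m) (psi x) = (k == m)%:R.
Proof.
move=> [[oV VU oW] [_ WV sphi spsi]] Wx.
have psiWV z : W z -> V (psi z) by move=> /WV[].
rewrite -(pd_precomp psiWV spsi k (sphi m) Wx) -(pd_coord m k x).
by apply: (eq_pd k oW _ Wx) => z /WV[_ ->].
Qed.

Lemma psi_tangent U V W phi psi x y : local_coordinates U V W phi psi -> W x ->
  forall j, ('d psi x y : 'rV[R]_2) 0 j =
    y 0 0 * pd 0 (fun x => psi x 0 j) x + y 0 1 * pd 1 (fun x => psi x 0 j) x.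
Proof.
move=> [[oV VU oW] [_ WV sphi spsi]] Wx j.
have dpsi i : differentiable (fun x => psi x 0 i) x := smooth_diff (spsi i) Wx.
rewrite -deriveE; last exact: differentiable_rV.
by rewrite derive_rV // mxE derive_partial // sum2 !pdE.
Qed.

End CoframeCoordinates.

(** * The local form *)

Section LocalForm.
Context {R : realType}.
Variables (U : set 'rV[R]_2) (a : 'rV[R]_2 -> 'M[R]_2) (b : 'rV[R]_2 -> 'rV[R]_2).
Hypotheses (oU : open U) (hF : is_sqroot_metric a b U).
Implicit Types (x y p : 'rV[R]_2) (V W : set 'rV[R]_2).

Lemma powR_three_quarters (t s : R) : 0 < t -> 0 < s -> s ^+ 4 = t ^+ 3 ->
  t `^ (3 / 4) = s.
Proof.
move=> t0 s0 E; apply/eqP; rewrite -(@eqrXn2 _ 4) ?powR_ge0 ?ltW // E; apply/eqP.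
rewrite -[LHS]powR_mulrn ?powR_ge0 // -powRrM -[RHS]powR_mulrn ?ltW //.
by congr (_ `^ _); field.
Qed.

Lemma is_sqroot_sub V : V `<=` U -> is_sqroot_metric a b V.
Proof.
case: hF => -[sa aS ap] sb bn VU; split; last by move=> x /VU; exact: bn.
  split=> [i j|x i j /VU|x y /VU]; first exact: smooth_sub (sa i j).
    exact: aS.
  exact: ap.
by move=> i; exact: smooth_sub (sb i).
Qed.

(** Completing the square in the squared norm of beta. *)
Lemma gram_norm_gt0 x : U x -> b x != 0 -> 0 < gram_norm a b x.
Proof.
move=> Ux b0; have e0 := e00_gt0 hF Ux; have g0 := gram_gt0 hF Ux.
have E : e00 a x * gram_norm a b x = gram a x * cb0 b x ^+ 2
    + (e00 a x * cb1 b x - e01 a x * cb0 b x) ^+ 2.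
  by rewrite /gram_norm /gram; ring.
have s1 : 0 <= gram a x * cb0 b x ^+ 2 by rewrite mulr_ge0 ?sqr_ge0 // ltW.
rewrite -(pmulr_rgt0 _ e0) E lt_neqAle addr_ge0 ?sqr_ge0 // andbT eq_sym.
apply: contra b0; rewrite paddr_eq0 ?sqr_ge0 // mulf_eq0 (gt_eqF g0) /= !sqrf_eq0.
move=> /andP[/eqP c0]; rewrite c0 mulr0 subr0 mulf_eq0 (gt_eqF e0) /= => /eqP c1.
by apply/eqP/rowP; elim/ord2P; rewrite mxE.
Qed.

Hypothesis bn0 : forall x, U x -> 0 < gram_norm a b x.

Let om (m i : 'I_2) : 'rV[R]_2 -> R := if m == 0 then om1 a b i else om2 a b i.

Let om_det x : U x -> om 0 0 x * om 1 1 x - om 0 1 x * om 1 0 x != 0.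
Proof.
move=> Ux; have g0 := gram_gt0 hF Ux; have B0 := bsq_gt0 hF bn0 Ux.
have s0 : Num.sqrt (gram a x) != 0 by rewrite gt_eqF // sqrtr_gt0.
have r0 : rho a b x != 0.
  by rewrite gt_eqF // /rho divr_gt0 // (sig_gt0 hF Ux).
rewrite /om /= /om1 /om2 /cb /= /star0 /star1.
rewrite (_ : _ - _ = - (rho a b x ^+ 2 / Num.sqrt (gram a x) * gram_norm a b x)).
  rewrite oppr_eq0; apply: mulf_neq0; first by rewrite mulf_neq0 ?expf_neq0 ?invr_neq0.
  by rewrite gt_eqF // bn0.
by rewrite /gram_norm; field.
Qed.

(** In the coordinates whose differentials are om1 and om2, the metric is
    (om1^2 + om2^2) / (rho^2 B) and beta is om2 / rho, which is the normal form with
    u = 0 and v = 1; the equation on B is the third one of [coframe_closed]. *)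
Lemma local_form p : U p -> einstein U (sqroot_metric a b) ->
  exists V W phi psi (B u v : 'rV[R]_2 -> R),
    [/\ V p, local_coordinates U V W phi psi, normal_form_pde W B u v,
        normal_form a b W psi B u v & forall x, W x -> v x != 0].
Proof.
move=> Up hE; have closed x (Ux : U x) := coframe_closed oU hF bn0 Ux hE.
have som m i : smooth U (om m i).
  by rewrite /om; elim/ord2P: m => /=; [exact: smooth_om1|exact: smooth_om2].
have com m x : U x -> curl (om m 0) (om m 1) x = 0.
  by move=> /closed[c1 c2 _]; elim/ord2P: m.
have [V [W [phi [psi [Vp LC dphi]]]]] := closed_coframe_coordinates oU Up som com (om_det Up).
have [[oV VU oW] [_ WV sphi spsi]] := LC.
have psiWU z : W z -> U (psi z) by move=> /WV[/VU].
pose P k j x := pd k (fun x => psi x 0 j) x.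
have inv k m x : W x -> P k 0 x * om m 0 (psi x) + P k 1 x * om m 1 (psi x) = (k == m)%:R.
  by move=> Wx; rewrite -(pd_inverse k m LC Wx) !dphi //; have [] := WV x Wx.
pose B x := bsq a b (psi x).
have sB := smooth_bsq oU hF.
exists V, W, phi, psi, B, (fun=> 0), (fun=> 1); split=> //.
- split; first split; rewrite ?/B.
  + by apply: (smooth_comp oW psiWU spsi sB).
  + exact: smooth_cst.
  + exact: smooth_cst.
  move=> x Wx; have Ux := psiWU x Wx.
  split; rewrite ?partial_cst ?pdE ?mul0r ?add0r ?mul1r ?oppr0 //.
  + by rewrite (bsq_gt0 hF bn0 Ux) (bsq_lt1 hF Ux).
  have [_ _ dB] := closed _ Ux.
  rewrite (pd_precomp psiWU spsi 1 sB Wx) -/(P 1 0 x) -/(P 1 1 x).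
  have := inv 1 0 x Wx; have := om_det Ux; move: dB.
  rewrite /om /= /om1 /om2 /= => dB D0 E; apply: (mulfI D0); rewrite mulr0.
  set r := rho _ _ _ in D0 E *; set s0 := star0 _ _ _ in D0 E dB *.
  set s1 := star1 _ _ _ in D0 E dB *; set c0 := cb _ 0 _; set c1 := cb _ 1 _.
  set g0 := pd 0 _ _ in dB *; set g1 := pd 1 _ _ in dB *.
  refine (add_multiple E (c := r * (c1 * g0 - c0 * g1)) _).
  refine (add_multiple dB (c := - (r * r * (c1 * P 1 1 x + c0 * P 1 0 x))) _).
  by ring.
- move=> x y Wx; have Ux := psiWU x Wx.
  set Y := 'd psi x y.
  have Yom m : Y 0 0 * om m 0 (psi x) + Y 0 1 * om m 1 (psi x) = y 0 m.
    rewrite !(psi_tangent y LC Wx) -!/(P _ _ x).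
    transitivity (y 0 0 * (P 0 0 x * om m 0 (psi x) + P 0 1 x * om m 1 (psi x))
      + y 0 1 * (P 1 0 x * om m 0 (psi x) + P 1 1 x * om m 1 (psi x))); first by ring.
    by rewrite !inv //; elim/ord2P: (m) => /=; ring.
  have y0E := Yom 0; have y1E := Yom 1.
  have B0 := bsq_gt0 hF bn0 Ux; have B1 := bsq_lt1 hF Ux; have g0 := gram_gt0 hF Ux.
  have S0 := sig_gt0 hF Ux; have sB0 : 0 < Num.sqrt (B x) by rewrite sqrtr_gt0.
  have sB2 : Num.sqrt (B x) ^+ 2 = B x by rewrite sqr_sqrtr // ltW.
  have rE : rho a b (psi x) = sig a b (psi x) / B x by [].
  rewrite (powR_three_quarters (s := sig a b (psi x))) ?subr_gt0 ?(sig4 hF Ux) //.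
  have Sn := lt0r_neq0 S0; have Bn : B x != 0 by exact: lt0r_neq0.
  rewrite expr0n expr1n add0r mul0r add0r mul1r !divr1 betaE (alphaE hF _ Ux).
  have lE : y 0 1 = rho a b (psi x) * lform b (psi x) Y.
    by rewrite -y1E /om /= /om2 /cb /= /lform; ring.
  split; last by rewrite lE rE; field; rewrite Bn Sn.
  have qE : y 0 0 ^+ 2 + y 0 1 ^+ 2 = rho a b (psi x) ^+ 2 * B x * qform a (psi x) Y.
    rewrite lE -y0E /om /= /om1 /= /star0 /star1 /B /bsq.
    have q0 : Num.sqrt (gram a (psi x)) != 0 by rewrite gt_eqF // sqrtr_gt0.
    have q2 : Num.sqrt (gram a (psi x)) ^+ 2 = gram a (psi x) by rewrite sqr_sqrtr // ltW.
    transitivity (rho a b (psi x) ^+ 2 * ((Y 0 0 * - (e00 a (psi x) * cb1 b (psi x)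
        - e01 a (psi x) * cb0 b (psi x)) + Y 0 1 * (e11 a (psi x) * cb0 b (psi x)
        - e01 a (psi x) * cb1 b (psi x))) ^+ 2 / Num.sqrt (gram a (psi x)) ^+ 2
        + lform b (psi x) Y ^+ 2)); first by field.
    rewrite q2 -mulrA; congr (_ * _); apply: (mulIf (lt0r_neq0 g0)).
    rewrite [LHS]mulrDl divfK ?lt0r_neq0 // [RHS]mulrAC divfK ?lt0r_neq0 //.
    by rewrite /gram_norm /gram /qform /lform; ring.
  have r0 : 0 < rho a b (psi x) by rewrite rE divr_gt0.
  have -> : Num.sqrt (y 0 0 ^+ 2 + y 0 1 ^+ 2) =
      rho a b (psi x) * (Num.sqrt (B x) * qsqrt a (psi x) Y).
    rewrite qE -mulrA sqrtrM ?sqr_ge0 // sqrtr_sqr gtr0_norm //; congr (_ * _).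
    by rewrite sqrtrM // ltW.
  rewrite rE; transitivity (Num.sqrt (B x) ^+ 2 / B x * qsqrt a (psi x) Y).
    by rewrite sB2 divff // mul1r.
  by field; rewrite Bn Sn.
Qed.

End LocalForm.

(** * The curvature of the normal form *)

Section NormalFormCurvature.
Context {R : realType}.
Variables (U : set 'rV[R]_2) (a : 'rV[R]_2 -> 'M[R]_2) (b : 'rV[R]_2 -> 'rV[R]_2).
Hypotheses (oU : open U) (hF : is_sqroot_metric a b U).
Variables (V W : set 'rV[R]_2) (phi psi : 'rV[R]_2 -> 'rV[R]_2) (B u v : 'rV[R]_2 -> R).
Hypotheses (LC : local_coordinates U V W phi psi) (pde : normal_form_pde W B u v).
Hypothesis nf : normal_form a b W psi B u v.
Implicit Types (x y z w : 'rV[R]_2).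

Lemma jac_local_coordinates (U' V' W' : set 'rV[R]_2) phi' psi' x :
  local_coordinates U' V' W' phi' psi' -> W' x -> jac psi' x != 0.
Proof.
move=> L Wx; have E k m := pd_inverse k m L Wx.
have := E 1 0; have := E 0 1; have := E 1 1; have := E 0 0; rewrite /jac /=.
set p00 := pd 0 (fun x => psi' x 0 0) x; set p01 := pd 0 (fun x => psi' x 0 1) x.
set p10 := pd 1 (fun x => psi' x 0 0) x; set p11 := pd 1 (fun x => psi' x 0 1) x.
move=> e00 e11 e01 e10; apply/eqP => D0; have /eqP := oner_neq0 R; apply.
set f00 := pd 0 _ (psi' x) in e00 e10 *; set f10 := pd 1 _ (psi' x) in e00 e10 *.
set f01 := pd 0 _ (psi' x) in e11 e01 *; set f11 := pd 1 _ (psi' x) in e11 e01 *.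
refine (add_multiple e00 (c := - 1) _).
refine (add_multiple e11 (c := - (p00 * f00 + p01 * f10)) _).
refine (add_multiple e01 (c := p10 * f00 + p11 * f10) _).
refine (add_multiple D0 (c := f00 * f11 - f10 * f01) _).
by ring.
Qed.

Let oW : open W. Proof. by case: LC => -[]. Qed.
Let psiWU x : W x -> U (psi x).
Proof. by have [[_ VU _] [_ WV _ _]] := LC => /WV[/VU]. Qed.
Let spsi : smooth_map W psi. Proof. by case: LC => _ []. Qed.
Let sB : smooth W B. Proof. by case: pde => -[]. Qed.
Let su : smooth W u. Proof. by case: pde => -[]. Qed.
Let sv : smooth W v. Proof. by case: pde => -[]. Qed.
Let B_gt0 x : W x -> 0 < B x. Proof. by have [_ H] := pde => /H[/andP[]]. Qed.
Let B_lt1 x : W x -> B x < 1. Proof. by have [_ H] := pde => /H[/andP[]]. Qed.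
Let n x := u x ^+ 2 + v x ^+ 2.
Let n0 x : W x -> n x != 0. Proof. by have [_ H] := pde => /H[]. Qed.
Let cr0 x : W x -> pd 0 u x = pd 1 v x.
Proof. by have [_ H] := pde => /H[_ _]; rewrite !pdE. Qed.
Let cr1 x : W x -> pd 1 u x = - pd 0 v x.
Proof. by have [_ H] := pde => /H[_ _ _]; rewrite !pdE. Qed.
Let uvB x : W x -> u x * pd 0 B x + v x * pd 1 B x = 0.
Proof. by have [_ H] := pde => /H[_ _ _ _]; rewrite !pdE. Qed.

Let n_gt0 x : W x -> 0 < n x.
Proof. by move=> Wx; rewrite lt_neqAle eq_sym n0 // addr_ge0 // sqr_ge0. Qed.

Ltac nf_leaf :=
  lazymatch goal with
  | |- is_tderiv _ _ (fun x _ => u x) _ => exact: (is_tderiv_x oW _ su)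
  | |- is_tderiv _ _ (fun x _ => v x) _ => exact: (is_tderiv_x oW _ sv)
  | |- is_tderiv _ _ (fun x _ => B x) _ => exact: (is_tderiv_x oW _ sB)
  | |- is_tderiv _ _ (fun x _ => pd ?i B x) _ => exact: (is_tderiv_x oW _ (smooth_pd i sB))
  end.

Let sn : smooth W n.
Proof. by apply: smoothD => //; exact: smoothX. Qed.

Let pd_n k x : W x -> pd k n x = 2 * (u x * pd k u x + v x * pd k v x).
Proof.
move=> Wx; rewrite (_ : n = fun x => u x * u x + v x * v x); last first.
  by apply/funext => z; rewrite /n !expr2.
refine (etrans (pd_tderiv (_ : is_tderiv W (inl k) _ ?[H]) Wx (dir_neq0 0)) _).
  by tderive oW ltac:(idtac; nf_leaf).
by rewrite /=; ring.
Qed.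

(** The 1-forms dual to the vector fields (v, - u) and (u, v); the
    Cauchy-Riemann equations say that they are closed. *)
Let om (m i : 'I_2) x : R := (n x)^-1 *
  (if m == 0 then (if i == 0 then v x else - u x) else (if i == 0 then u x else v x)).

Let sin : smooth W (fun x => (n x)^-1).
Proof. by apply: smoothV => // x; exact: n0. Qed.

Let som m i : smooth W (om m i).
Proof.
apply: smoothM => //; elim/ord2P: m; elim/ord2P: i => //=; exact: smoothN.
Qed.

Let com m x : W x -> curl (om m 0) (om m 1) x = 0.
Proof.
move=> Wx; rewrite /curl /om; have N0 := n0 Wx.
have sNu : smooth W (fun x => - u x) by exact: smoothN.
have pdN k : pd k (fun x => - u x) x = - pd k u x.
  refine (etrans (pd_tderiv (_ : is_tderiv W (inl k) _ ?[H]) Wx (dir_neq0 0)) _).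
    by tderive oW ltac:(idtac; nf_leaf).
  by [].
have pdV k : pd k (fun x => (n x)^-1) x = - n x ^- 2 * pd k n x.
  by rewrite (pd_inv oW) // => z; exact: n0.
elim/ord2P: m => /=; rewrite !(pd_mul oW) // ?pdN !pdV !pd_n // !cr0 // !cr1 //;
  move: N0; rewrite /n => N0; by field.
Qed.

Let om_det x : W x -> om 0 0 x * om 1 1 x - om 0 1 x * om 1 0 x != 0.
Proof.
move=> Wx; have N0 := n0 Wx; rewrite /om /= (_ : _ - _ = (n x)^-1) ?invr_neq0 //.
by move: N0; rewrite /n => N0; field.
Qed.

Let F := sqroot_metric a b.

Let three_quarters (t : R) : 0 < t -> (t `^ (3 / 4)) ^+ 2 = Num.sqrt t ^+ 3.
Proof.
move=> t0; have s0 : 0 < Num.sqrt t by rewrite sqrtr_gt0.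
rewrite (powR_three_quarters (s := Num.sqrt (Num.sqrt t ^+ 3))) // ?sqrtr_gt0 ?exprn_gt0 //.
  by rewrite sqr_sqrtr // exprn_ge0 // ltW.
rewrite (exprM _ 2 2) sqr_sqrtr ?exprn_ge0 ?(ltW s0) // -exprM mulnC exprM.
by rewrite sqr_sqrtr // ltW.
Qed.

Let pushE x y : W x ->
  \row_m \sum_l partial l (fun x => psi x 0 m) x * y 0 l = 'd psi x y :> 'rV[R]_2.
Proof.
move=> Wx; apply/rowP => j; rewrite (psi_tangent y LC Wx) mxE sum2 !pdE; ring.
Qed.

Let tpullE x y : W x -> tpull psi F x y = F (psi x) ('d psi x y).
Proof. by move=> Wx; rewrite /tpull pushE. Qed.

Let jac0 x : W x -> jac psi x != 0.
Proof. exact: jac_local_coordinates LC. Qed.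

Let sq_normal_form x y : W x -> y != 0 -> sqF (tpull psi F) x y =
  B x / Num.sqrt (1 - B x) ^+ 3 * ((y 0 0 ^+ 2 + y 0 1 ^+ 2) / n x
    + Num.sqrt (B x) * Num.sqrt ((y 0 0 ^+ 2 + y 0 1 ^+ 2) / n x)
      * ((u x * y 0 0 + v x * y 0 1) / n x)).
Proof.
move=> Wx y0; have Ux := psiWU Wx; have [aE bE] := nf y Wx.
have Jy0 : 'd psi x y != 0 :> 'rV[R]_2.
  by rewrite -pushE //; exact: (pull_push_neq0 jac0).
rewrite /sqF tpullE // -/(sqF F _ _) (sqF_sqroot hF Ux Jy0) /sqroot_sq.
have qE : qform a (psi x) ('d psi x y) = alpha a (psi x) ('d psi x y) ^+ 2.
  by rewrite (alphaE hF _ Ux) (qsqrt_sq hF Ux Jy0).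
rewrite qE -(alphaE hF _ Ux) -betaE aE bE.
have B0 := B_gt0 Wx; have B1 : 0 < 1 - B x by rewrite subr_gt0 B_lt1.
have N0 : 0 <= (y 0 0 ^+ 2 + y 0 1 ^+ 2) / n x.
  by rewrite divr_ge0 ?addr_ge0 ?sqr_ge0 // ltW // n_gt0.
rewrite -/(n x) -three_quarters //.
have s2 : Num.sqrt (B x) ^+ 2 = B x by rewrite sqr_sqrtr // ltW.
have p0 : (1 - B x) `^ (3 / 4) != 0 by rewrite gt_eqF // powR_gt0.
have r2 : Num.sqrt ((y 0 0 ^+ 2 + y 0 1 ^+ 2) / n x) ^+ 2 =
  (y 0 0 ^+ 2 + y 0 1 ^+ 2) / n x by rewrite sqr_sqrtr.
set p := _ `^ _ in p0 *; set h := Num.sqrt _ in s2 *; set sr := Num.sqrt _ in r2 *.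
set w := _ / n x in r2 *; set w' := _ / n x; rewrite -r2.
transitivity (h ^+ 2 / p ^+ 2 * sr ^+ 2 + h * sr * (B x / p ^+ 2) * w'); first by field.
by rewrite s2; ring.
Qed.

(** The derivative of B along the vector field (v, - u). *)
Let dB z := v z * pd 0 B z - u z * pd 1 B z.

Let sdB : smooth W dB.
Proof. by apply: smoothB => //; apply: smoothM => //; exact: smooth_pd. Qed.

(** Differentiate the equation on B in both directions, and use the
    Cauchy-Riemann equations. *)
Let laplacian x : W x -> v x * pd 0 dB x - u x * pd 1 dB x =
  n x * (pd 0 (pd 0 B) x + pd 1 (pd 1 B) x).
Proof.
move=> Wx.
have dD k : pd k dB x = pd k v x * pd 0 B x + v x * pd k (pd 0 B) x
    - (pd k u x * pd 1 B x + u x * pd k (pd 1 B) x).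
  refine (etrans (pd_tderiv (_ : is_tderiv W (inl k) _ ?[H]) Wx (dir_neq0 0)) _).
    by rewrite /dB; tderive oW ltac:(idtac; nf_leaf).
  by [].
have dE k : pd k u x * pd 0 B x + u x * pd k (pd 0 B) x
    + (pd k v x * pd 1 B x + v x * pd k (pd 1 B) x) = 0.
  transitivity (pd k (fun x => u x * pd 0 B x + v x * pd 1 B x) x).
    apply/esym; refine (etrans (pd_tderiv (_ : is_tderiv W (inl k) _ ?[H]) Wx (dir_neq0 0)) _).
      by tderive oW ltac:(idtac; nf_leaf).
    by [].
  by rewrite (eq_pd k oW (g := fun=> 0) uvB Wx) -pdE partial_cst.
have S : pd 1 (pd 0 B) x = pd 0 (pd 1 B) x := pd_Schwarz 1 0 oW sB Wx.
have := dE 0; have := dE 1; rewrite !dD S cr0 // cr1 // /n => E1 E0.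
refine (add_multiple E0 (c := - u x) (add_multiple E1 (c := - v x) _)).
by ring.
Qed.

(** In coordinates whose differentials are the forms om, the metric becomes the model
    metric: the vector fields (v, - u) and (u, v) become the coordinate fields, and
    B only depends on the first coordinate. *)
Section ModelCoordinates.
Variables (V' W' : set 'rV[R]_2) (phi' chi : 'rV[R]_2 -> 'rV[R]_2).
Hypothesis LC' : local_coordinates W V' W' phi' chi.
Hypothesis dphi' : forall m i x, V' x -> pd i (fun x => phi' x 0 m) x = om m i x.

Let oW' : open W'. Proof. by case: LC' => -[]. Qed.
Let chiV' w : W' w -> V' (chi w).
Proof. by have [_ [_ H _ _]] := LC' => /H[]. Qed.
Let chiWW w : W' w -> W (chi w).
Proof. by have [[_ VW _] _] := LC' => /chiV'/VW. Qed.
Let schi : smooth_map W' chi. Proof. by case: LC' => _ []. Qed.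
Let chi_jac0 w : W' w -> jac chi w != 0.
Proof. exact: jac_local_coordinates LC'. Qed.

Let pd_chi w : W' w ->
  (pd 0 (fun w => chi w 0 0) w = v (chi w) /\ pd 0 (fun w => chi w 0 1) w = - u (chi w)) /\
  (pd 1 (fun w => chi w 0 0) w = u (chi w) /\ pd 1 (fun w => chi w 0 1) w = v (chi w)).
Proof.
move=> W'w; have N0 := n0 (chiWW W'w).
have E k m := pd_inverse k m LC' W'w.
have := E 1 0; have := E 0 1; have := E 1 1; have := E 0 0.
rewrite !(dphi' _ _ (chiV' W'w)).
move: (pd 0 (fun w => chi w 0 0) w) (pd 0 (fun w => chi w 0 1) w)
  (pd 1 (fun w => chi w 0 0) w) (pd 1 (fun w => chi w 0 1) w) => c00 c01 c10 c11.
move: N0; rewrite /om /n /=; move: (u (chi w)) (v (chi w)) => u' v' N0 e00 e11 e01 e10.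
split; split.
- by refine (add_multiple e00 (c := v') (add_multiple e01 (c := u') _)); field.
- by refine (add_multiple e00 (c := - u') (add_multiple e01 (c := v') _)); field.
- by refine (add_multiple e10 (c := v') (add_multiple e11 (c := u') _)); field.
- by refine (add_multiple e10 (c := - u') (add_multiple e11 (c := v') _)); field.
Qed.

Let Bc w := B (chi w).

Let sBc : smooth W' Bc.
Proof. exact: (smooth_comp oW' chiWW schi sB). Qed.

Let pd1_Bc w : W' w -> pd 1 Bc w = 0.
Proof.
move=> W'w; have [_ [c0 c1]] := pd_chi W'w.
by rewrite (pd_precomp chiWW schi 1 sB W'w) c0 c1; exact: (uvB (chiWW W'w)).
Qed.

Let pd0_Bc w : W' w -> pd 0 Bc w = dB (chi w).
Proof.
move=> W'w; have [[c0 c1] _] := pd_chi W'w.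
by rewrite (pd_precomp chiWW schi 0 sB W'w) c0 c1 /dB; ring.
Qed.

Let pd0pd0_Bc w : W' w ->
  pd 0 (pd 0 Bc) w = n (chi w) * (pd 0 (pd 0 B) (chi w) + pd 1 (pd 1 B) (chi w)).
Proof.
move=> W'w; have [[c0 c1] _] := pd_chi W'w.
rewrite (eq_pd 0 oW' pd0_Bc W'w) (pd_precomp chiWW schi 0 sdB W'w) c0 c1.
by rewrite -(laplacian (chiWW W'w)); ring.
Qed.

Let pd1pd0_Bc w : W' w -> pd 1 (pd 0 Bc) w = 0.
Proof.
move=> W'w; rewrite (pd_Schwarz 1 0 oW' sBc W'w).
by rewrite (eq_pd 0 oW' (g := fun=> 0) pd1_Bc W'w) -pdE partial_cst.
Qed.

Let Bc_gt0 w : W' w -> 0 < Bc w. Proof. by move=> /chiWW; exact: B_gt0. Qed.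
Let Bc_lt1 w : W' w -> 0 < 1 - Bc w.
Proof. by move=> /chiWW W'w; rewrite subr_gt0; exact: B_lt1. Qed.

Let s1B : smooth W' (fun w => 1 - Bc w).
Proof. by apply: smoothB => //; exact: smooth_cst. Qed.

Let pd_1B k w : W' w -> pd k (fun w => 1 - Bc w) w = - pd k Bc w.
Proof.
move=> W'w; refine (etrans (pd_tderiv (_ : is_tderiv W' (inl k) _ ?[H]) W'w (dir_neq0 0)) _).
  by tderive oW' ltac:(idtac; exact: (is_tderiv_x oW' _ sBc)).
by rewrite /= add0r.
Qed.

Let h w := Num.sqrt (Bc w).
Let s w := Num.sqrt (1 - Bc w).
Let si w := (s w)^-1.
Let m w := Bc w * (si w * si w * si w).
Let k w := pd 0 Bc w * (4 * (Bc w * (1 - Bc w)))^-1.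

Let s0 w : W' w -> s w != 0.
Proof. by move=> W'w; rewrite gt_eqF // sqrtr_gt0 Bc_lt1. Qed.
Let h0 w : W' w -> h w != 0.
Proof. by move=> W'w; rewrite gt_eqF // sqrtr_gt0 Bc_gt0. Qed.
Let s2 w : W' w -> s w ^+ 2 = 1 - Bc w.
Proof. by move=> W'w; rewrite sqr_sqrtr // ltW // Bc_lt1. Qed.
Let h2 w : W' w -> h w ^+ 2 = Bc w.
Proof. by move=> W'w; rewrite sqr_sqrtr // ltW // Bc_gt0. Qed.

Let ss : smooth W' s. Proof. by apply: smooth_sqrt => // w; exact: Bc_lt1. Qed.
Let sh : smooth W' h. Proof. by apply: smooth_sqrt => // w; exact: Bc_gt0. Qed.
Let ssi : smooth W' si. Proof. by apply: smoothV => // w; exact: s0. Qed.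
Let sm : smooth W' m. Proof. by repeat apply: smoothM => //. Qed.

Let d4 w : W' w -> 4 * (Bc w * (1 - Bc w)) != 0.
Proof. by move=> W'w; rewrite !mulf_neq0 ?gt_eqF ?Bc_gt0 ?Bc_lt1. Qed.

Let sd : smooth W' (fun w => 4 * (Bc w * (1 - Bc w))).
Proof. by repeat apply: smoothM => //; exact: smooth_cst. Qed.

Let sk : smooth W' k.
Proof.
by apply: smoothM => //; [exact: smooth_pd|apply: smoothV => // w; exact: d4].
Qed.

Let pd_d4 i w : W' w -> pd i (fun w => 4 * (Bc w * (1 - Bc w))) w =
  4 * (1 - 2 * Bc w) * pd i Bc w.
Proof.
move=> W'w; refine (etrans (pd_tderiv (_ : is_tderiv W' (inl i) _ ?[H]) W'w (dir_neq0 0)) _).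
  by tderive oW' ltac:(idtac; exact: (is_tderiv_x oW' _ sBc)).
by rewrite /=; ring.
Qed.

Let pd_k i w : W' w -> pd i k w = pd i (pd 0 Bc) w / (4 * (Bc w * (1 - Bc w)))
  - pd 0 Bc w * pd i Bc w * (1 - 2 * Bc w) / (4 * (Bc w * (1 - Bc w)) ^+ 2).
Proof.
move=> W'w; have B0 := lt0r_neq0 (Bc_gt0 W'w); have B1 := lt0r_neq0 (Bc_lt1 W'w).
rewrite /k (pd_mul oW') //; last 2 first.
- exact: smooth_pd.
- by apply: smoothV => // z; exact: d4.
by rewrite (pd_inv oW' i d4 sd W'w) pd_d4 //; field; rewrite B0 B1.
Qed.

Let pd_h i w : W' w -> pd i h w = (2 * h w)^-1 * pd i Bc w.
Proof. by move=> W'w; rewrite /h (pd_sqrt oW' _ Bc_gt0). Qed.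

Let pd_si i w : W' w -> pd i si w = 2^-1 * si w ^+ 3 * pd i Bc w.
Proof.
move=> W'w; rewrite /si (pd_inv oW' i s0 ss W'w) /s (pd_sqrt oW' i Bc_lt1 s1B W'w) pd_1B //.
by rewrite -/(s w); have S0 := s0 W'w; field.
Qed.

Let pd_m i w : W' w -> pd i m w = pd i Bc w * (si w ^+ 3 + 3 / 2 * Bc w * si w ^+ 5).
Proof.
move=> W'w; refine (etrans (pd_tderiv (_ : is_tderiv W' (inl i) _ ?[H]) W'w (dir_neq0 0)) _).
  by rewrite /m; tderive oW' ltac:(idtac; lazymatch goal with
    | |- is_tderiv _ _ (fun x _ => Bc x) _ => exact: (is_tderiv_x oW' _ sBc)
    | |- is_tderiv _ _ (fun x _ => si x) _ => exact: (is_tderiv_x oW' _ ssi) end).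
by rewrite /= pd_si //; field.
Qed.

Let F1 := tpull psi F.
Let F2 := tpull chi F1.

Let rF1 : regular_metric W F1.
Proof. exact: (regular_pull oW psiWU spsi jac0 (regular_sqroot oU hF)). Qed.

Let rF2 : regular_metric W' F2.
Proof. exact: (regular_pull oW' chiWW schi chi_jac0 rF1). Qed.

Let push w y : 'rV[R]_2 := \row_j \sum_l partial l (fun x => chi x 0 j) w * y 0 l.

Let push_neq0 w y : W' w -> y != 0 -> push w y != 0.
Proof. by move=> W'w y0; exact: (pull_push_neq0 chi_jac0). Qed.

Let sq_model w y : W' w -> y != 0 -> sqF F2 w y = m w * (y 0 0 * y 0 0 + y 0 1 * y 0 1
  + h w * (Num.sqrt (y 0 0 * y 0 0 + y 0 1 * y 0 1) * y 0 1)).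
Proof.
move=> W'w y0; have Ww := chiWW W'w; have N0 := n0 Ww.
have -> : sqF F2 w y = sqF F1 (chi w) (push w y) by [].
rewrite (sq_normal_form Ww (push_neq0 W'w y0)).
have [[c00 c01] [c10 c11]] := pd_chi W'w.
have Y0 : push w y 0 0 = v (chi w) * y 0 0 + u (chi w) * y 0 1.
  by rewrite mxE sum2 !pdE c00 c10.
have Y1 : push w y 0 1 = - u (chi w) * y 0 0 + v (chi w) * y 0 1.
  by rewrite mxE sum2 !pdE c01 c11.
rewrite (_ : (_ ^+ 2 + _) / _ = y 0 0 * y 0 0 + y 0 1 * y 0 1); last first.
  by rewrite Y0 Y1; move: N0; rewrite /n => N0; field.
rewrite (_ : (u (chi w) * _ + _) / _ = y 0 1); last first.
  by rewrite Y0 Y1; move: N0; rewrite /n => N0; field.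
have S0 := s0 W'w; rewrite -/(Bc w) -/(h w) -/(s w) /m /si.
by field.
Qed.

Let BcE w : W' w -> Bc w = 1 - s w ^+ 2.
Proof. by move=> W'w; rewrite s2 //; ring. Qed.

Let s20 w : W' w -> 1 - s w ^+ 2 != 0.
Proof. by move=> W'w; rewrite -BcE // gt_eqF // Bc_gt0. Qed.

Let pd1_m w : W' w -> pd 1 m w = 0.
Proof. by move=> W'w; rewrite pd_m // pd1_Bc // mul0r. Qed.

Let pd1_h w : W' w -> pd 1 h w = 0.
Proof. by move=> W'w; rewrite pd_h // pd1_Bc // mulr0. Qed.

Let pd1_k w : W' w -> pd 1 k w = 0.
Proof. by move=> W'w; rewrite pd_k // pd1pd0_Bc // pd1_Bc //; ring. Qed.

Let pd0_h w : W' w -> pd 0 h w = 2 * h w * (1 - h w * h w) * k w.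
Proof.
move=> W'w; rewrite pd_h // /k; have H0 := h0 W'w; have := Bc_lt1 W'w.
by rewrite -!(h2 W'w) => /lt0r_neq0 H1; field; rewrite H0 H1.
Qed.

Let pd0_m w : W' w -> pd 0 m w = 2 * m w * (2 + h w * h w) * k w.
Proof.
move=> W'w; rewrite pd_m // /k /m /si -[h w * h w]expr2 h2 //.
have S0 := s0 W'w; have S1 := s20 W'w.
by rewrite !BcE //; field; rewrite S0 S1 subKr expf_neq0.
Qed.

Let sq_neq0 w y : W' w -> y != 0 -> sqF F2 w y != 0.
Proof.
move=> W'w y0; have Ww := chiWW W'w.
have P0 := pull_push_neq0 jac0 Ww (push_neq0 W'w y0).
have -> : sqF F2 w y = sqF F (psi (chi w))
  (\row_j \sum_l partial l (fun x => psi x 0 j) (chi w) * push w y 0 l) by [].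
rewrite (sqF_sqroot hF (psiWU Ww) P0) gt_eqF //.
exact: (sqroot_sq_gt0 hF (psiWU Ww) P0).
Qed.

Let flag_model w y : W' w -> y != 0 -> ricci F2 w y / sqF F2 w y =
  - (s w / (2 * Bc w ^+ 2) * pd 0 (pd 0 Bc) w)
  - (3 * Bc w - 2) / (4 * Bc w ^+ 3 * s w) * pd 0 Bc w ^+ 2.
Proof.
move=> W'w y0.
rewrite (ricci_model oW' sm sh sk pd1_m pd1_h pd1_k pd0_h pd0_m rF2 sq_model W'w y0).
have := sq_neq0 W'w y0; rewrite sq_model //.
have S0 := s0 W'w; have S1 := s20 W'w.
move: (_ + h w * _) => E; rewrite mulf_eq0 negb_or => /andP[m0 E0].
rewrite [LHS](_ : _ = (4 * k w * k w * (h w * h w) - 2 * pd 0 k w) / m w); last first.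
  by field; rewrite m0 E0.
rewrite -[h w * h w]expr2 h2 // pd_k // /m /k /si; move: m0; rewrite /m /si !BcE // => m0.
by field; rewrite S0 S1 subKr expf_neq0.
Qed.

Lemma flag_curvature_model w y (z := chi w) : W' w -> y != 0 -> v z != 0 ->
  ricci F2 w y / sqF F2 w y =
  - (n z * Num.sqrt (1 - B z) / (2 * B z ^+ 2) * (pd 0 (pd 0 B) z + pd 1 (pd 1 B) z))
  - n z ^+ 2 * (3 * B z - 2) / (4 * B z ^+ 3 * Num.sqrt (1 - B z)) * (pd 0 B z / v z) ^+ 2.
Proof.
move=> W'w y0 v0; rewrite flag_model // pd0pd0_Bc // pd0_Bc // -/z.
have -> : dB z = n z * (pd 0 B z / v z).
  refine (add_multiple (uvB (chiWW W'w)) (c := - (u z / v z)) _).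
  by rewrite /dB /n -/z; field.
have := s0 W'w; have := lt0r_neq0 (Bc_gt0 W'w); rewrite /s /Bc -/z.
by move: (Num.sqrt _) => r B0 r0; field; rewrite B0 r0 v0.
Qed.

End ModelCoordinates.

Lemma einstein_isotropic : einstein U F <-> isotropic_flag_curvature U F.
Proof.
have F0 x y : U x -> y != 0 -> F x y != 0.
  move=> Ux y0; rewrite -sqrf_eq0 -/(sqF F x y) (sqF_sqroot hF Ux y0) gt_eqF //.
  exact: (sqroot_sq_gt0 hF Ux y0).
split=> -[K hK]; exists K => x y Ux y0; have := hK x y Ux y0; have := F0 x y Ux y0.
  by rewrite /flag_curvature => N0 ->; field.
by rewrite /flag_curvature => N0 <-; field.
Qed.

(** As the flag curvature at a point is the same in all directions, it can be computed
    in the direction that corresponds to y in the model coordinates. *)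
Lemma flag_curvature_normal_form x y : einstein U F -> W x -> v x != 0 -> y != 0 ->
  flag_curvature F (psi x) y =
  - (n x * Num.sqrt (1 - B x) / (2 * B x ^+ 2) * (pd 0 (pd 0 B) x + pd 1 (pd 1 B) x))
  - n x ^+ 2 * (3 * B x - 2) / (4 * B x ^+ 3 * Num.sqrt (1 - B x)) * (pd 0 B x / v x) ^+ 2.
Proof.
move=> /einstein_isotropic[K hK] Wx v0 y0.
have [V' [W' [phi' [chi [V'x L dphi']]]]] := closed_coframe_coordinates oW Wx som com (om_det Wx).
have [[oV' V'W oW'] [phiVW chiWV _ schi]] := L.
have [W'w chiw] := phiVW x V'x; set w := phi' x in W'w chiw.
have jchi z : W' z -> jac chi z != 0 by exact: jac_local_coordinates L.
have chiWW z : W' z -> W (chi z) by move=> /chiWV[/V'W].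
have P0 := pull_push_neq0 jchi W'w y0.
have Px := chiWW w W'w.
have Q0 := pull_push_neq0 jac0 Px P0.
transitivity (K (psi x)); first exact: hK (psiWU Wx) y0.
rewrite -{1}chiw -(hK _ _ (psiWU Px) Q0).
have rF1 := regular_pull oW psiWU spsi jac0 (regular_sqroot oU hF).
have := flag_curvature_model L dphi' W'w y0; rewrite chiw => /(_ v0) <-.
have E1 := ricci_pull oW' oW chiWW schi jchi rF1 W'w y0.
have E2 := ricci_pull oW oU psiWU spsi jac0 (regular_sqroot oU hF) Px P0.
rewrite [RHS]/tpull in E1; rewrite [RHS]/tpull in E2.
rewrite E1 E2 /flag_curvature /sqF.
by rewrite [tpull _ _ _ _]/tpull [tpull _ _ _ _]/tpull chiw /F.
Qed.

End NormalFormCurvature.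

Theorem theorem1p2 (R : realType) (U : set 'rV[R]_2)
    (a : 'rV[R]_2 -> 'M[R]_2) (b : 'rV[R]_2 -> 'rV[R]_2)
    (hU : open U) (hF : is_sqroot_metric a b U) :
  (einstein U (sqroot_metric a b) <->
   isotropic_flag_curvature U (sqroot_metric a b)) /\
  (einstein U (sqroot_metric a b) ->
   (* local form, around every point where beta does not vanish *)
   (forall p, U p -> b p != 0 ->
      exists (V W : set 'rV[R]_2) (phi psi : 'rV[R]_2 -> 'rV[R]_2)
             (B u v : 'rV[R]_2 -> R),
        [/\ V p, local_coordinates U V W phi psi, normal_form_pde W B u v,
            normal_form a b W psi B u v & forall x, W x -> v x != 0]) /\
   (* flag curvature, in any such local form *)
   (forall (V W : set 'rV[R]_2) (phi psi : 'rV[R]_2 -> 'rV[R]_2)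
           (B u v : 'rV[R]_2 -> R),
      local_coordinates U V W phi psi -> normal_form_pde W B u v ->
      normal_form a b W psi B u v ->
      forall x y : 'rV[R]_2, W x -> v x != 0 -> y != 0 ->
        flag_curvature (sqroot_metric a b) (psi x) y =
        - ((u x ^+ 2 + v x ^+ 2) * Num.sqrt (1 - B x) / (2 * B x ^+ 2) *
           (partial 0 (partial 0 B) x + partial 1 (partial 1 B) x))
        - (u x ^+ 2 + v x ^+ 2) ^+ 2 * (3 * B x - 2) /
          (4 * B x ^+ 3 * Num.sqrt (1 - B x)) * (partial 0 B x / v x) ^+ 2)).
Proof.
split; first exact: einstein_isotropic hF.
move=> hE; split=> [p Up bp|V W phi psi B u v LC pde nf x y Wx v0 y0]; last first.
  rewrite !pdE; exact: (flag_curvature_normal_form hU hF LC pde nf hE Wx v0 y0).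
pose U' : set 'rV[R]_2 := [set x | U x /\ 0 < gram_norm a b x].
have U'U : U' `<=` U by move=> x [].
have oU' : open U'.
  rewrite openE => x [Ux nx]; apply: filterI; first exact: open_nbhs_nbhs.
  have c : {for x, continuous (gram_norm a b)} := smooth_gram_norm hU hF 0%N x Ux.
  by apply: (c [set z | 0 < z]); apply: open_nbhs_nbhs; split=> //; exact: open_gt.
have hF' := is_sqroot_sub hF U'U.
have U'p : U' p by split=> //; exact: (gram_norm_gt0 hF Up bp).
have hE' : einstein U' (sqroot_metric a b).
  by case: hE => K hK; exists K => x y /U'U; exact: hK.
have [V [W [phi [psi [B [u [v [Vp LC pde nf v0]]]]]]]] :=
  local_form oU' hF' (fun x xU' => xU'.2) U'p hE'.
exists V, W, phi, psi, B, u, v; split=> //.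
by case: LC => -[oV VU' oW] H; split=> //; split=> // x /VU'/U'U.
Qed.
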